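(* Let $d\ge3$ and let $G$ be a $d$-adapted map. The set $\mathbf{A}_G$ of $d$-GS angular orientations of $G$, ordered by $\mathcal{A}\preceq\mathcal{A}'$ iff $\mathcal{A}'$ can be obtained from $\mathcal{A}$ by a sequence of pushes of counterclockwise positive cycles of $G^+$ not passing through any outer vertex, is a distributive lattice. Moreover, for $\mathcal{A},\mathcal{A}'\in\mathbf{A}_G$, $\mathcal{A}'$ covers $\mathcal{A}$ (flop; equivalently $\mathcal{A}$ is obtained from $\mathcal{A}'$ by a flip) if and only if $\mathcal{A}'$ is obtained from $\mathcal{A}$ by pushing a counterclockwise positive cycle $C$ of $G^+$ not passing through any outer vertex and which is either (i) the contour of an inner face of $G^+$, or (ii) a compatible cycle of enclosing length $d$. (Symmetrically, flips are pushes of clockwise positive cycles of these two types.)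
   Context: A plane map is a connected graph (loops, multiple edges allowed) embedded in the plane without crossings, up to deformation; outer (unbounded) face, inner faces; outer vertices/edges lie on the outer face. A corner is the sector between consecutive half-edges around a vertex; $\deg(f)$ = number of corners of face $f$. A $d$-map ($d\ge3$) is a plane map with inner faces of degree $\le d$ and outer face of degree $d$ bounded by a simple cycle, outer vertices $v_1,\dots,v_d$ clockwise (indices mod $d$). It is $d$-adapted if every simple cycle which is not a face contour has length $\ge d$. An arc is a directed edge; a weighted orientation assigns nonnegative integer weights to arcs; edge weight = sum of its two arc weights; outgoing weight of a vertex = sum of weights of arcs leaving it. Angular map $G^+$: add a star vertex $v_f$ inside each inner face $f$ of $G$ and join it by one star edge to each corner of $f$ (so $\deg(v_f)=\deg(f)$); vertices and edges of $G$ are original. Inner faces of $G^+$ are triangles, each containing one original edge and one star vertex. A $d$-GS angular orientation of $G$ is a weighted orientation of $G^+$ with: (A0) outer arcs have weight 0, and every inner arc whose initial vertex is an outer vertex $v_i$ has weight 0 except the star arc from $v_i$ to the star vertex of the inner face incident to $\{v_{i-1},v_i\}$; (A1) each star vertex $v_f$ has outgoing weight $d-\deg(f)$ and each star edge at $v_f$ has weight $d-\deg(f)$; (A2) each inner original vertex has outgoing weight $d$ and each original inner edge $e$ has weight $\deg(f)+\deg(f')-d-2$, $f,f'$ the faces of $G$ incident to $e$. A positive cycle is a directed cycle all of whose arcs have positive weight; pushing it decreases by 1 the weight of each of its arcs and increases by 1 the weight of each opposite arc. A simple cycle $C$ of $G^+$ is compatible if it visits no star vertex of degree $d$ and, for every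 original edge $e$ on $C$, the star vertex of the triangular face of $G^+$ incident to $e$ lying inside $C$ has degree $d$. The enclosing cycle $\hat C$ of $C$ is the cycle of original edges just outside $C$: it contains the original edges of $C$, and for each star vertex $u$ on $C$, the original edges opposite to $u$ in the triangular faces of $G^+$ incident to $u$ lying outside $C$. The enclosing length of $C$ is the length of $\hat C$. *)

(* Defs.v *)
(* Plane maps are encoded as combinatorial maps (rotation
   systems) of genus 0. *)
From Stdlib Require Import Relations.Relation_Operators.
From HB Require Import structures.
From mathcomp Require Import all_boot all_order all_fingroup.

Set Implicit Arguments.
Unset Strict Implicit.
Unset Printing Implicit Defensive.

Definition simple_cycle (T : finType) (V : eqType) (al : T -> T) (tl : T -> V)
    (s : seq T) : bool :=
  [&& s != [::], path.cycle (fun x y => tl (al x) == tl y) s,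
      uniq (map tl s) & uniq (s ++ map al s)].

Definition dedges (T : finType) (al : T -> T) (X : {set T}) : {set T} :=
  [set z | (z \in X) || (al z \in X)].

Definition is_lub (T : Type) (P : T -> Prop) (le : T -> T -> Prop) (a b c : T) :=
  [/\ P c, le a c, le b c & forall z, P z -> le a z -> le b z -> le c z].
Definition is_glb (T : Type) (P : T -> Prop) (le : T -> T -> Prop) (a b c : T) :=
  [/\ P c, le c a, le c b & forall z, P z -> le z a -> le z b -> le z c].

Definition distributive_lattice (T : Type) (P : T -> Prop) (le : T -> T -> Prop) :=
  [/\ (forall a, P a -> le a a),
      (forall a b, P a -> P b -> le a b -> le b a -> a = b),
      (forall a b c, P a -> P b -> P c -> le a b -> le b c -> le a c),
      (forall a b, P a -> P b -> (exists c, is_lub P le a b c) /\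
                                 (exists c, is_glb P le a b c)) &
      (forall a b c j m1 m2 m3 u, P a -> P b -> P c ->
         is_lub P le b c j -> is_glb P le a j m1 ->
         is_glb P le a b m2 -> is_glb P le a c m3 -> is_lub P le m2 m3 u ->
         m1 = u)].

Definition covers (T : Type) (P : T -> Prop) (le : T -> T -> Prop) (a a' : T) :=
  [/\ P a, P a', le a a', a <> a' &
      forall z, P z -> le a z -> le z a' -> z = a \/ z = a'].

(* Plane maps.  Darts D; alpha = reversal of darts; sigma = counterclockwise
   successor around the tail vertex; phi = sigma^-1 \o alpha is the face
   permutation: the phi-orbit of y is the face on the LEFT of y (inner faces
   are traversed counterclockwise).  The corner of y is the sector between y
   and sigma y; it lies in the face on the left of y.  r is a dart whose left
   face is the outer face. *)

Section PlaneMap.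
Variables (D : finType) (alpha sigma : {perm D}) (r : D).

Definition phi : {perm D} := (alpha * sigma^-1)%g.

Definition vertex (y : D) : {set D} := porbit sigma y.
Definition face (y : D) : {set D} := porbit phi y.
Definition edge (y : D) : {set D} := [set y; alpha y].
Definition deg (y : D) : nat := #|face y|.

Definition outer_face : {set D} := face r.
Definition inner (y : D) : bool := y \notin outer_face.
Definition outer_vertex (X : {set D}) : bool := X \in [set vertex y | y in outer_face].
Definition outer_edge_dart (y : D) : bool :=
  (y \in outer_face) || (alpha y \in outer_face).

(* connected map of genus 0 (Euler's formula) = plane map *)
Definition plane_map : Prop :=
  [/\ forall x, alpha (alpha x) = x,
      forall x, alpha x != x,
      forall x y, connect [rel a b | (b == sigma a) || (b == alpha a)] x y &
      #|porbits sigma| + #|porbits phi| = #|porbits alpha| + 2].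

Definition d_map (d : nat) : Prop :=
  [/\ plane_map,
      forall y, inner y -> deg y <= d,
      #|outer_face| = d &
      {in outer_face &, injective vertex}].   (* outer contour is a simple cycle *)

Definition d_adapted (d : nat) : Prop :=
  d_map d /\
  forall s : seq D, simple_cycle alpha vertex s ->
    ~~ [exists y, dedges alpha [set z in s] == dedges alpha (face y)] ->
    d <= size s.

(* The angular map G^+.  Darts: inl y (original dart y);
   inr (y, false) : star dart from the tail of y to the star vertex of the
   (inner) face left of y, through the corner of y;
   inr (y, true)  : its reverse. *)

Definition pvalid (x : D + D * bool) : bool :=
  if x is inr (y, _) then inner y else true.

Definition PD := {x : D + D * bool | pvalid x}.

Definition orig (y : D) : PD := exist _ (inl y) isT.

Definition plift (f : D + D * bool -> D + D * bool) (x : PD) : PD :=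
  insubd x (f (val x)).

Definition palpha_raw (x : D + D * bool) : D + D * bool :=
  match x with inl y => inl (alpha y) | inr (y, b) => inr (y, ~~ b) end.

Definition pphi_raw (x : D + D * bool) : D + D * bool :=
  match x with
  | inl y => if inner y then inr (phi y, false) else inl (phi y)
  | inr (y, false) => inr ((phi^-1)%g y, true)
  | inr (y, true) => inl y
  end.

Definition palpha : PD -> PD := plift palpha_raw.
Definition pphi : PD -> PD := plift pphi_raw.

(* vertices of G^+: inl (original vertex) or inr (face of G, i.e. star vertex) *)
Definition ptail (x : PD) : {set D} + {set D} :=
  match val x with
  | inl y => inl (vertex y)
  | inr (y, false) => inl (vertex y)
  | inr (y, true) => inr (face y)
  end.

Definition pouter_vertex (v : {set D} + {set D}) : bool :=
  if v is inl X then outer_vertex X else false.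

Definition pouter_arc (x : PD) : bool :=
  if val x is inl y then outer_edge_dart y else false.

Definition outw (w : {ffun PD -> nat}) (v : {set D} + {set D}) : nat :=
  \sum_(x | ptail x == v) w x.

Definition GS (d : nat) (w : {ffun PD -> nat}) : Prop :=
  [/\
      (forall x, pouter_arc x -> w x = 0) /\
      (forall x, ~~ pouter_arc x -> pouter_vertex (ptail x) ->
          ~~ [exists y, (y \in outer_face) && (val x == inr (alpha y, false))] ->
          w x = 0),
      (forall y, inner y -> outw w (inr (face y)) + deg y = d),
      (forall x y b, val x = inr (y, b) -> w x + w (palpha x) + deg y = d),
      (forall y, ~~ outer_vertex (vertex y) -> outw w (inl (vertex y)) = d) &
      (forall y, ~~ outer_edge_dart y ->
          w (orig y) + w (orig (alpha y)) + d + 2 = deg y + deg (alpha y))].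

Definition pcycle (s : seq PD) : bool := simple_cycle palpha ptail s.

(* darts whose left face is separated from the outer face by s *)
Definition pexterior (s : seq PD) (x : PD) : bool :=
  connect [rel a b | (b == pphi a) ||
                     [&& b == palpha a, a \notin s & palpha a \notin s]] (orig r) x.
Definition pinterior (s : seq PD) (x : PD) : bool := ~~ pexterior s x.

Definition ccw (s : seq PD) : bool := all (pinterior s) s.
Definition positive (w : {ffun PD -> nat}) (s : seq PD) : bool := all (fun x => 0 < w x) s.
Definition avoids_outer (s : seq PD) : bool :=
  all (fun x => ~~ pouter_vertex (ptail x)) s.

Definition push (w : {ffun PD -> nat}) (s : seq PD) : {ffun PD -> nat} :=
  [ffun x => if x \in s then (w x).-1 else if palpha x \in s then (w x).+1 else w x].

Definition ccw_push (w w' : {ffun PD -> nat}) : Prop :=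
  exists s, [/\ pcycle s, ccw s, positive w s, avoids_outer s & w' = push w s].

Definition ple : {ffun PD -> nat} -> {ffun PD -> nat} -> Prop :=
  clos_refl_trans _ ccw_push.

Definition pface (x : PD) : {set PD} := [set z | fconnect pphi x z].

Definition inner_face_contour (s : seq PD) : bool :=
  [exists x, ~~ fconnect pphi (orig r) x &&
             (dedges palpha [set z in s] == dedges palpha (pface x))].

Definition compatible (d : nat) (s : seq PD) : bool :=
  [&& all (fun x => if ptail x is inr X then #|X| != d else true) s &
      all (fun x => if val x is inl y then
                      (pinterior s x ==> (deg y == d)) &&
                      (pinterior s (palpha x) ==> (deg (alpha y) == d))
                    else true) s].

(* darts of G whose edges form the enclosing cycle *)
Definition enc_darts (s : seq PD) : {set D} :=
  [set y | (orig y \in s) || (orig (alpha y) \in s)] :|: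
  [set y | [&& [exists x in s, ptail x == inr (face y)], inner y &
              pexterior s (orig y)]].

Definition enclosing_length (s : seq PD) : nat :=
  #|[set edge y | y in enc_darts s]|.

End PlaneMap.

(* Main.v *)
(* The weight that an orientation sends from a counterclockwise cycle C strictly into its
   interior does not depend on the orientation: by Euler's formula it equals the enclosing
   length of C (counted with multiplicity), minus d, plus the sum of d - deg f over the
   faces f lying inside C along the original edges of C.

   - If it is positive, then C has a positive chord in its interior, because a set of inner
     vertices with connected complement emits a weight of at least d; pushing C is then
     the same as pushing successively the two cycles into which the chord cuts it.
   - If it vanishes and C is positive, then C is a triangle or a compatible cycle of
     enclosing length d: when the disc bounded by C meets at least two faces of G, the
     enclosing edges contain a simple cycle that is no contour of an inner face, of length
     at least d by adaptedness; when it meets only one, the count is explicit.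
   - Conversely it vanishes for the cycles of these two types.

   When two counterclockwise cycles share an arc and then separate, one of them enters the
   interior of the other, so any arc lies on at most one cycle of the two types that can be
   pushed in some orientation.  Such cycles
   form a free family, and their coefficients embed the orientations in a power of Z,
   with image closed under coordinatewise minimum and maximum; a cover increases one
   coordinate by 1. *)
Require Import Defs.
From Stdlib Require Import Relations.Relation_Operators Relations.Operators_Properties.
From HB Require Import structures.
From mathcomp Require Import all_boot all_order all_fingroup all_algebra.
From mathcomp Require Import zify ring.
From mathcomp Require Import boolp.

Set Implicit Arguments.
Unset Strict Implicit.
Unset Printing Implicit Defensive.

Import Order.TTheory GRing.Theory Num.Theory.

(** The map is only a pair of permutations subject to Euler's formula, so every planar fact has to
    be drawn from that one equation: that a simple cycle has two sides, Euler's formula inside a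
    cycle, and a bound on the edges that avoid a connected set of vertices. All three are instances
    of a single inequality, [euler_bound], obtained by linear algebra over the rationals without any
    surgery on maps; positivity of a sum of squares replaces topology.

    The formula for the weight sent inwards also yields the local regularity of the map. Applied to
    the outer contour, it determines the star arcs at outer vertices, which (A0) leaves free, so
    that any two orientations agree there. Applied to a cycle of two star edges, it shows that an
    inner face meets a vertex at most once, hence that no inner edge has the same face on both
    sides. *)

Lemma card_le_of_trivial_kernel (I J : finType) (A : {set I}) (B : {set J})
    (M : I -> J -> rat) :
  (forall u : I -> rat, (forall i, i \notin A -> u i = 0%R) ->
     (forall j, j \in B -> (\sum_i u i * M i j)%R = 0%R) -> forall i, u i = 0%R) ->
  #|A| <= #|B|.
Proof.
move=> inj0.
pose N := (\matrix_(i < #|A|, j < #|B|) M (enum_val i) (enum_val j))%R.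
suff fN : row_free N by rewrite -(eqP fN) rank_leq_col.
apply: inj_row_free => v vN0.
pose u i := (\sum_(k < #|A| | enum_val k == i) v ord0 k)%R.
have uE k : u (enum_val k) = v ord0 k.
  rewrite /u (big_pred1 k) // => k'; apply/eqP/eqP => [/enum_val_inj //|-> //].
have u0 : forall i, u i = 0%R.
  apply: inj0 => [i iA|j jB].
    rewrite /u big_pred0 // => k; apply/negP => /eqP ki.
    by rewrite -ki enum_valP in iA.
  have := congr1 (fun X : 'rV_ _ => X ord0 (enum_rank_in jB j)) vN0.
  rewrite !mxE => vj0; rewrite -[RHS]vj0.
  rewrite (bigID (mem A)) /= [X in (_ + X)%R]big1 ?addr0; last first.
    move=> i iA; rewrite /u big_pred0 ?mul0r // => k; apply/negP => /eqP ki.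
    by rewrite -ki enum_valP in iA.
  rewrite big_enum_val /=; apply: eq_bigr => k _.
  by rewrite uE !mxE enum_rankK_in.
apply/rowP => k; by rewrite mxE -uE u0.
Qed.

(** * Euler's formula as a rank bound *)

(** A connected map on the sphere whose vertices and faces are named by [t] and [L]: [t x] is the
    tail of [x], [L x] the face on its left, and [ph \o al] turns around the tail. [euler] is V + F
    = E + 2 doubled, since [#|T|] counts every edge twice. *)
Record plane_darts (T V F : finType) (al ph : T -> T) (t : T -> V) (L : T -> F)
  : Prop := PlaneDarts {
  al_inv : involutive al;
  al_neq : forall x, al x != x;
  ph_inj : injective ph;
  tail_eq : forall x y, (t x == t y) = fconnect (fun z => ph (al z)) x y;
  left_eq : forall x y, (L x == L y) = fconnect ph x y;
  dart_conn : forall x y, connect [rel a b | (b == ph a) || (b == al a)] x y;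
  euler : 2 * (#|t @: [set: T]| + #|L @: [set: T]|) = #|T| + 4 }.

Section PlaneDarts.
Variables (T V F : finType) (al ph : T -> T) (t : T -> V) (L : T -> F).
Hypothesis M : plane_darts al ph t L.

Let alK := al_inv M.
Let al_inj : injective al := inv_inj alK.

Lemma tail_ph x : t (ph x) = t (al x).
Proof.
apply/eqP; rewrite eq_sym (tail_eq M); apply: connect1 => /=.
by rewrite /= alK.
Qed.

Lemma left_ph x : L (ph x) = L x.
Proof. by apply/eqP; rewrite eq_sym (left_eq M) fconnect1. Qed.

Lemma dart_const (W : Type) (p : T -> W) :
  (forall x, p (ph x) = p x) -> (forall x, p (al x) = p x) -> forall x y, p x = p y.
Proof.
move=> pph pal x y; have /connectP[s sP ->] := dart_conn M x y.
elim: s x sP => [|z s IH] x //= /andP[/orP[]/eqP-> /IH <-]; by rewrite ?pph ?pal.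
Qed.

Lemma tail_const (W : Type) (p : V -> W) :
  (forall x, p (t (al x)) = p (t x)) -> forall x y, p (t x) = p (t y).
Proof.
by move=> pal; apply: (@dart_const W (fun x => p (t x))) => // x; rewrite tail_ph.
Qed.

Lemma card_halves (E : {set T}) : (forall x, (al x \in E) = (x \in E)) ->
  #|E| = 2 * #|[set x in E | enum_rank x < enum_rank (al x)]|.
Proof.
move=> Eal; rewrite -(cardsID [set x | enum_rank x < enum_rank (al x)] E).
rewrite mul2n -addnn; congr (_ + _).
  by apply: eq_card => x; rewrite !inE.
rewrite -(card_imset _ al_inj); apply: eq_card => x.
apply/imsetP/idP => [[y]|].
  rewrite !inE -leqNgt => /andP[le yE] ->; rewrite Eal yE alK /= ltn_neqAle le.
  by rewrite andbT; apply: contra (al_neq M y) => /eqP/val_inj/enum_rank_inj->.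
rewrite !inE => /andP[xE lt]; exists (al x); last by rewrite alK.
by rewrite !inE Eal xE alK -leqNgt ltnW.
Qed.

(* On the sphere, coboundaries of vertex functions are orthogonal to boundaries of
   face functions; this forces enough edges to hold both. *)
Lemma euler_bound (Y : {set V}) (E : {set T}) (Fs : {set F}) (f0 : F) (x0 : T) :
  Y \subset t @: [set: T] -> f0 \in Fs -> t x0 \notin Y ->
  (forall x, (al x \in E) = (x \in E)) -> (forall x, t x \in Y -> x \in E) ->
  (forall q : F -> rat, (forall x, x \in E -> q (L x) = q (L (al x))) ->
     forall f, f \in Fs -> q f = q f0) ->
  2 * (#|Y| + #|Fs|) <= #|E| + 2.
Proof.
move=> Ysub f0F x0Y Eal YE qcst; rewrite (card_halves Eal).
set B := [set x in E | _].
(* One face is dropped because face potentials matter only up to a constant; vertex potentials are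
   already pinned, being zero at [t x0]. *)
pose A : {set V + F} := [set i | match i with inl v => v \in Y
   | inr f => (f \in Fs) && (f != f0) end].
have cA : #|A| + 1 = #|Y| + #|Fs|.
  have -> : A = (@inl V F @: Y) :|: (@inr V F @: (Fs :\ f0)).
    apply/setP => -[v|f]; rewrite !inE ?mem_imset //; try by move=> ? ? [].
      rewrite [X in _ || X](_ : _ = false) ?orbF //.
      by apply/imsetP => -[].
    rewrite [X in X || _](_ : _ = false) /= ?inE 1?andbC //.
    by apply/imsetP => -[].
  rewrite cardsU disjoint_setI0 ?cards0 ?subn0.
    rewrite !card_imset; try by move=> ? ? [].
    by rewrite [in RHS](cardsD1 f0) f0F; lia.
  by rewrite -setI_eq0; apply/eqP/setP => i; rewrite !inE; apply/negP => /andP[/imsetP[v _ ->] /imsetP[]].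
suff : #|A| <= #|B| by lia.
pose b2r (b : bool) : rat := (b%:R)%R.
apply: (@card_le_of_trivial_kernel _ _ A B (fun i x => match i with
   | inl v => (b2r (t (al x) == v) - b2r (t x == v))%R
   | inr f => (b2r (L x == f) - b2r (L (al x) == f))%R end)) => u u0 uM.
pose p v := u (inl v); pose q f := u (inr f).
pose g x := (p (t (al x)) - p (t x))%R; pose h x := (q (L x) - q (L (al x)))%R.
have sum1 (I : finType) (w : I -> rat) i : (\sum_j w j * b2r (i == j) = w i)%R.
  rewrite (bigD1 i) //= eqxx mulr1 big1 ?addr0 // => j ji.
  by rewrite eq_sym (negPf ji) mulr0.
have uE x : (\sum_i u i * match i with
   | inl v => (b2r (t (al x) == v) - b2r (t x == v))%R
   | inr f => (b2r (L x == f) - b2r (L (al x) == f))%R end = g x + h x)%R.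
  rewrite big_sumType /=; congr (_ + _)%R.
    rewrite (eq_bigr (fun v => p v * b2r (t (al x) == v) - p v * b2r (t x == v))%R).
      by rewrite sumrB !sum1.
    by move=> v _; rewrite mulrBr.
  rewrite (eq_bigr (fun v => q v * b2r (L x == v) - q v * b2r (L (al x) == v))%R).
    by rewrite sumrB !sum1.
  by move=> v _; rewrite mulrBr.
have gal x : g (al x) = (- g x)%R by rewrite /g alK opprB.
have hal x : h (al x) = (- h x)%R by rewrite /h alK opprB.
have gh0 x : x \in E -> (g x + h x = 0)%R.
  move=> xE; case: (boolP (x \in B)) => xB; first by rewrite -uE uM.
  have : al x \in B.
    move: xB; rewrite !inE Eal xE /= alK -leqNgt leq_eqVlt => /orP[/eqP e|//].
    by have := al_neq M x; rewrite (enum_rank_inj (val_inj e)) eqxx.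
  move=> /uM; rewrite uE gal hal -opprD => /eqP.
  by rewrite oppr_eq0 => /eqP.
have pN v : v \notin Y -> p v = 0%R by move=> vY; rewrite /p u0 // inE.
have gN x : x \notin E -> g x = 0%R.
  move=> xE; rewrite /g !pN ?subr0 //; apply: contra xE => /YE //.
  by rewrite Eal.
(* Turning around the tail keeps [t] and puts on the left the face that was on the right, so the two
   halves of [h] contribute the same sum. *)
have S0 : (\sum_x p (t x) * h x = 0)%R.
  under eq_bigr do rewrite mulrBr.
  rewrite sumrB.
  have phal_inj : injective (fun x => ph (al x)).
    by move=> x y /(ph_inj M)/al_inj.
  rewrite (reindex_inj phal_inj) /=.
  under eq_bigr do rewrite tail_ph alK left_ph.
  by rewrite subrr.
have S1 : (\sum_x g x * h x = 0)%R.
  under eq_bigr do rewrite mulrBl.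
  rewrite sumrB S0 subr0 (reindex_inj al_inj) /=.
  under eq_bigr do rewrite alK hal mulrN.
  by rewrite sumrN S0 oppr0.
(* On [E] the vanishing combination says [g = - h], and off [E] the function [g] is zero, so the
   square norm of [g] is minus its pairing with [h]. Once [g] vanishes, [p] is constant, hence zero,
   and [q] agrees across the edges of [E]. *)
have S2 : (\sum_x g x * g x = 0)%R.
  apply: (etrans (y := (- \sum_x g x * h x)%R)); last by rewrite S1 oppr0.
  rewrite -sumrN; apply: eq_bigr => x _.
  case: (boolP (x \in E)) => [/gh0/eqP|/gN->]; last by rewrite !mul0r oppr0.
  by rewrite addr_eq0 => /eqP e; rewrite -mulrN -e.
have g0 x : g x = 0%R.
  have /eqP := S2; rewrite psumr_eq0 => [|y _]; last by rewrite -expr2 sqr_ge0.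
  by move=> /allP/(_ x); rewrite mem_index_enum => /(_ isT)/eqP/eqP; rewrite mulf_eq0 orbb => /eqP.
have p0 v : p v = 0%R.
  case: (boolP (v \in Y)) => [vY|/pN //].
  have /imsetP[x _ ->] := subsetP Ysub _ vY.
  rewrite -(pN _ x0Y); apply: tail_const => y.
  by apply/eqP; rewrite -subr_eq0; apply/eqP; exact: g0.
have qf0 : q f0 = 0%R by rewrite /q u0 // inE eqxx andbF.
have q0 f : q f = 0%R.
  case: (boolP (f \in Fs)) => [fF|fF]; last by rewrite /q u0 // inE (negPf fF).
  rewrite -qf0; apply: qcst => // x xE; apply/eqP; rewrite -subr_eq0.
  by apply/eqP; move: (gh0 x xE); rewrite g0 add0r.
by case.
Qed.
End PlaneDarts.

(** * Jordan curves *)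

(** The connected components of this relation are the regions cut out by [s]; it is the relation in
    the body of [pexterior]. *)
Definition nocross (T : finType) (al ph : T -> T) (s : seq T) : rel T :=
  [rel a b | (b == ph a) || [&& b == al a, a \notin s & al a \notin s]].

Lemma uniq_map_in_inj (A B : eqType) (f : A -> B) (s : seq A) :
  uniq (map f s) -> {in s &, injective f}.
Proof.
elim: s => //= a s IH /andP[/negP fa /IH inj] x y; rewrite !inE.
move=> /predU1P[->|xs] /predU1P[->|ys] // e; last exact: inj.
  by case: fa; rewrite e map_f.
by case: fa; rewrite -e map_f.
Qed.

Section Jordan.
Variables (T V F : finType) (al ph : T -> T) (t : T -> V) (L : T -> F).
Hypothesis M : plane_darts al ph t L.

Let alK := al_inv M.
Let al_inj : injective al := inv_inj alK.

Lemma cycle_heads (f g : T -> V) (s : seq T) :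
  path.cycle (fun x y => f x == g y) s -> map f s = rot 1 (map g s).
Proof.
case: s => //= x s; rewrite rot1_cons.
have gen (y : T) : path (fun x y => f x == g y) x (rcons s y) ->
    f x :: map f s = rcons (map g s) (g y).
  elim: s x => [|z s IH] x /=; first by rewrite andbT => /eqP->.
  by move=> /andP[/eqP-> /IH->].
exact: gen.
Qed.

Section SimpleCycle.
Variable s : seq T.
Hypothesis sP : simple_cycle al t s.

Lemma cycle_tail_inj : {in s &, injective t}.
Proof. by apply: uniq_map_in_inj; case/and4P: sP. Qed.

Lemma cycle_uniq : uniq s.
Proof. by case/and4P: sP => _ _ _; rewrite cat_uniq => /and3P[]. Qed.

Lemma cycle_al x : x \in s -> al x \notin s.
Proof.
case/and4P: sP => _ _ _; rewrite cat_uniq => /and3P[_ /hasPn/= H _] xs.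
by apply: H; apply: map_f.
Qed.

Lemma heads_perm : perm_eq (map (fun x => t (al x)) s) (map t s).
Proof.
case/and4P: sP => _ c _ _.
by rewrite (cycle_heads (f := fun x => t (al x)) c) perm_rot.
Qed.

Lemma cycle_head_inj : {in s &, injective (fun x => t (al x))}.
Proof.
apply: uniq_map_in_inj; rewrite (perm_uniq heads_perm).
by case/and4P: sP.
Qed.

Lemma cycle_succ x : x \in s -> exists2 y, y \in s & t y = t (al x).
Proof.
move=> xs; have : t (al x) \in map (fun x => t (al x)) s.
  by apply/mapP; exists x.
by rewrite (perm_mem heads_perm) => /mapP[y ys ->]; exists y.
Qed.


Lemma rev_simple_cycle : simple_cycle al t (rev (map al s)).
Proof.
case/and4P: (sP) => nn c u1 u2; apply/and4P; split.
- by case: (s) nn => // x l _; rewrite /= rev_cons; case: (rev _).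
- rewrite rev_cycle cycle_map; apply: sub_cycle c => x y /=.
  by rewrite alK eq_sym.
- rewrite map_rev rev_uniq -map_comp (perm_uniq _ : _ = uniq (map t s)) //.
  exact: heads_perm.
- rewrite map_rev -rev_cat rev_uniq -map_comp (eq_map (g := id)) => [|x /=].
    by rewrite map_id.
  exact: alK.
Qed.

Lemma mem_rev_cycle x : (x \in rev (map al s)) = (al x \in s).
Proof. by rewrite mem_rev -{1}(alK x) mem_map. Qed.
End SimpleCycle.

Section Crossing.
Variable s : seq T.
Local Notation K := (nocross al ph s).

Lemma nocross_left x y : L x = L y -> connect K x y.
Proof.
move/eqP; rewrite (left_eq M); apply: connect_sub => a b /= /eqP <-.
by apply: connect1; rewrite /nocross /= eqxx.
Qed.

Lemma nocross_sym : connect_sym K.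
Proof.
suff H a b : connect K a b -> connect K b a by move=> a b; apply/idP/idP => /H.
move=> /connectP[p pP ->]; elim: p a pP => [|c p IH] a //= /andP[acK /IH cK].
apply: connect_trans cK _; case/orP: acK => [/eqP->|/and3P[/eqP-> n1 n2]].
  by apply: nocross_left; rewrite (left_ph M).
by apply: connect1; rewrite /nocross /= !alK eqxx n1 n2 orbT.
Qed.

Lemma nocross_al x : x \notin s -> al x \notin s -> connect K x (al x).
Proof. by move=> n1 n2; apply: connect1; rewrite /nocross /= eqxx n1 n2 orbT. Qed.
End Crossing.

(* Turning around the head of x on its left side until the first dart of Q. *)
Lemma rotate_to (Q : {set T}) (x q0 : T) : q0 \in Q -> t q0 = t (al x) ->
  exists q, [/\ q \in Q, t q = t (al x) & forall s,
    (forall z, t z = t (al x) -> z \notin Q -> z != al x ->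
      (z \notin s) && (al z \notin s)) ->
    connect (nocross al ph s) x q].
Proof.
move=> q0Q tq0; pose rot z := ph (al z).
have rot_inj : injective rot by move=> a b /(ph_inj M)/al_inj.
have ex : exists n, iter n.+1 rot (al x) \in Q.
  have : fconnect rot (rot (al x)) q0.
    by rewrite -(same_fconnect1 rot_inj) -(tail_eq M) tq0.
  by move=> /iter_findex e; exists (findex rot (rot (al x)) q0); rewrite iterSr e.
have tz n : t (iter n rot (al x)) = t (al x).
  by elim: n => //= n IH; rewrite {1}/rot (tail_ph M) alK IH.
case: (ex_minnP ex) => n nQ nmin; exists (iter n.+1 rot (al x)); split=> // s sH.
have loop m : m <= n -> connect (nocross al ph s) x (iter m.+1 rot (al x)).
  elim: m => [_|m IH lt].
    by apply: nocross_left; rewrite /= /rot alK (left_ph M).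
  apply: connect_trans (IH (ltnW lt)) _; set z := iter m.+1 rot (al x).
  have zQ : z \notin Q by apply/negP => /nmin; rewrite leqNgt lt.
  have zx : z != al x.
    apply/eqP => e; have : iter (n - m) rot (al x) \in Q.
      by rewrite -{1}e -iterD addnS subnK // ltnW.
    rewrite -[n - m]prednK ?subn_gt0 // => /nmin; lia.
  have /andP[n1 n2] := sH z (tz _) zQ zx.
  apply: connect_trans (nocross_al n1 n2) _.
  by apply: nocross_left; rewrite iterS -/z /rot (left_ph M).
exact: loop.
Qed.

(** Consecutive darts are joined by turning around their common vertex on the left side; since [s]
    visits this vertex only once, no other edge of [s] is crossed on the way. *)
Lemma left_connected s : simple_cycle al t s ->
  {in s &, forall x y, connect (nocross al ph s) x y}.
Proof.
move=> sP; have [_ c _ _] := and4P sP.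
have c' : path.cycle (connect (nocross al ph s)) s.
  apply: (sub_in_cycle (P := mem s)) c => [x y xs ys /= e|].
    have [q [/set1P-> _]] := rotate_to (set11 y) (esym (eqP e)).
    apply => z tz zQ zx; apply/andP; split.
      apply: contra zQ => zs; apply/set1P; apply: (cycle_tail_inj sP) => //.
      by rewrite tz (eqP e).
    apply: contra zx => zs; rewrite -[x](@cycle_head_inj s sP (al z)) ?alK //.
  by apply/allP.
move=> x y xs ys; have := connect_cycle c' xs ys.
by apply: connect_sub.
Qed.

Lemma nocross_rev s : nocross al ph (rev (map al s)) =2 nocross al ph s.
Proof.
move=> a b; rewrite /nocross /= !mem_rev_cycle alK.
by congr (_ || _); congr (_ && _); rewrite andbC.
Qed.

Lemma right_connected s : simple_cycle al t s ->
  {in s &, forall x y, connect (nocross al ph s) (al x) (al y)}.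
Proof.
move=> sP x y xs ys; rewrite -(eq_connect (nocross_rev s)).
by apply: left_connected; rewrite ?mem_rev ?map_f //; apply: rev_simple_cycle.
Qed.

Lemma left_or_right s x : simple_cycle al t s -> x \in s -> forall z,
  connect (nocross al ph s) x z || connect (nocross al ph s) (al x) z.
Proof.
move=> sP xs z; have Ksym := nocross_sym s.
pose p z := connect (nocross al ph s) x z || connect (nocross al ph s) (al x) z.
suff pE : p z = p x by rewrite -/(p z) pE /p connect0.
have step a b : connect (nocross al ph s) a b -> p a = p b.
  by move=> ab; rewrite /p !(same_connect_r Ksym ab).
apply: (dart_const M) => a.
  by apply: step; apply: nocross_left; rewrite (left_ph M).
case: (boolP (a \in s)) => [as_|as_].
  by rewrite /p (right_connected sP xs as_) (left_connected sP xs as_) orbT.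
case: (boolP (al a \in s)) => [als|als]; last first.
  by apply: step; rewrite Ksym; exact: nocross_al.
have := right_connected sP xs als; rewrite alK => c1.
by rewrite /p c1 (left_connected sP xs als) orbT.
Qed.

Lemma cycle_vertices s : simple_cycle al t s -> #|[set t x | x in s]| = size s.
Proof.
move=> sP; rewrite card_in_imset; last exact: cycle_tail_inj.
by apply/card_uniqP; exact: cycle_uniq sP.
Qed.

Lemma cycle_darts s : simple_cycle al t s ->
  #|[set x | (x \in s) || (al x \in s)]| = 2 * size s.
Proof.
move=> sP.
have -> : [set x | (x \in s) || (al x \in s)] = [set x in s ++ map al s].
  by apply/setP => x; rewrite !inE mem_cat -{4}(alK x) mem_map.
rewrite cardsE (card_uniqP _) ?size_cat ?size_map; first lia.
by case/and4P: sP.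
Qed.

(** If the two sides of [x] communicated, all faces would be linked across edges off [s]. Removing
    from the map the [size s] vertices and the [size s] edges of the cycle, [euler_bound] would give
    V + F <= E + 1. *)
Lemma jordan s x : simple_cycle al t s -> x \in s ->
  ~~ connect (nocross al ph s) x (al x).
Proof.
move=> sP xs; apply/negP => xx.
pose Y := t @: [set: T] :\: [set t z | z in s].
pose E := [set z | (z \notin s) && (al z \notin s)].
have h : 2 * (#|Y| + #|L @: [set: T]|) <= #|E| + 2.
  apply: (euler_bound M (f0 := L x) (x0 := x)).
  - exact: subsetDl.
  - by apply: imset_f.
  - by rewrite inE (imset_f t xs).
  - by move=> z; rewrite !inE alK andbC.
  - move=> z; rewrite !inE => /andP[zY _]; apply/andP; split.
      by apply: contra zY => zs; apply: imset_f.
    apply: contra zY => /(cycle_succ sP)[y ys e].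
    by apply/imsetP; exists y => //; rewrite e alK.
  - move=> q qE _ /imsetP[z _ ->].
    suff H a b : connect (nocross al ph s) a b -> q (L a) = q (L b).
      case/orP: (left_or_right sP xs z) => [/H//|c].
      by apply/esym/H; apply: connect_trans c.
    move=> /connectP[p pP ->]; elim: p a pP => //= c p IH a /andP[ac /IH <-].
    case/orP: ac => [/eqP->|/and3P[/eqP-> n1 n2]]; first by rewrite (left_ph M).
    by apply: qE; rewrite inE n1 n2.
have cE : #|E| + 2 * size s = #|T|.
  rewrite -(cycle_darts sP) -cardsT.
  rewrite -(cardsID E [set: T]) setTI; congr (_ + _); apply: eq_card => z.
  by rewrite !inE andbT negb_and !negbK.
have cY : #|Y| + size s = #|t @: [set: T]|.
  rewrite -(cycle_vertices sP) -(cardsID [set t z | z in s] (t @: [set: T])) addnC.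
  congr (_ + _); apply: eq_card => v; rewrite inE.
  by rewrite andb_idl // => /imsetP[z _ ->]; apply: imset_f.
have := euler M; lia.
Qed.

End Jordan.

(** The successor is chosen by [o] as a function of the vertex reached, so on the periodic part of
    the iteration distinct darts have distinct tails. *)
Lemma find_simple_cycle (T V : finType) (al : T -> T) (t : T -> V) (S : {set T}) x0 :
  injective al -> x0 \in S -> (forall x, x \in S -> al x \notin S) ->
  (forall x, x \in S -> exists2 y, y \in S & t y = t (al x)) ->
  exists2 s, simple_cycle al t s & {subset s <= S}.
Proof.
move=> al_inj x0S Sal Snext.
pose o v := odflt x0 [pick x in S | t x == v].
pose f x := o (t (al x)).
have oP x : x \in S -> f x \in S /\ t (f x) = t (al x).
  move=> xS; rewrite /f /o; case: pickP => [y /andP[yS /eqP->] //|no].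
  by have [y yS /eqP e] := Snext x xS; have := no y; rewrite yS e.
have fS x n : x \in S -> iter n f x \in S.
  by move=> xS; elim: n => //= n /oP[].
have canon x n : x \in S -> o (t (iter n.+1 f x)) = iter n.+1 f x.
  by move=> xS /=; have [_ ->] := oP _ (fS x n xS).
pose x1 := f x0; pose n := fingraph.order f x1.
have x1S : x1 \in S by case: (oP _ x0S).
have /trajectP[j jn ej] : iter n f x1 \in traject f x1 n by exact: fingraph.looping_order.
pose z := iter j f x1; pose k := (n - j).-1.
have kE : n = j + k.+1 by rewrite /k; lia.
have zz : iter k.+1 f z = z by rewrite /z -iterD addnC -kE.
pose s := traject f z k.+1.
have sS : {subset s <= S}.
  by move=> y /trajectP[i _ ->]; exact: (fS _ _ (fS _ _ x1S)).
have su : uniq s.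
  have := fingraph.orbit_uniq f x1; rewrite /fingraph.orbit -/n kE trajectD cat_uniq.
  by case/and3P.
have sc y : y \in s -> o (t y) = y.
  move=> /trajectP[i _ ->]; rewrite /z -iterD.
  by rewrite /x1 -iterSr canon.
exists s => //; apply/and4P; split=> //.
- have : path (frel f) z (rcons (traject f (f z) k) z).
    have := fpath_traject f z k.+1; rewrite trajectSr.
    by rewrite -iterSr zz.
  move=> c; apply: (sub_in_cycle (P := mem s) (e := frel f)) => //; last by apply/allP.
  move=> x y xs ys /= /eqP <-; have [_ ->] := oP x (sS _ xs); exact: eqxx.
- rewrite map_inj_in_uniq // => x y xs ys e.
  by rewrite -(sc x xs) -(sc y ys) e.
- rewrite cat_uniq su (map_inj_uniq al_inj) su andbT; apply/hasPn => y.
  move=> /mapP[x xs ->]; apply: contra (Sal _ (sS _ xs)); exact: sS.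
Qed.

(** * Inside and outside of a counterclockwise cycle *)

Section Interior.
Variables (T V F : finType) (al ph : T -> T) (t : T -> V) (L : T -> F).
Hypothesis M : plane_darts al ph t L.
Variable r : T.

Let alK := al_inv M.
Let al_inj : injective al := inv_inj alK.
Local Notation ext s := (connect (nocross al ph s) r).

Lemma ext_left s x y : L x = L y -> ext s x = ext s y.
Proof.
by move=> e; rewrite (same_connect_r (nocross_sym M s) (nocross_left M s e)).
Qed.

Lemma ext_ph s x : ext s (ph x) = ext s x.
Proof. by apply: ext_left; rewrite (left_ph M). Qed.

Lemma ext_al s x : x \notin s -> al x \notin s -> ext s (al x) = ext s x.
Proof.
by move=> n1 n2; rewrite (same_connect_r (nocross_sym M s) (nocross_al ph n1 n2)).
Qed.

Lemma ext_connect s x y : connect (nocross al ph s) x y -> ext s x = ext s y.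
Proof. by move=> c; rewrite (same_connect_r (nocross_sym M s) c). Qed.

Section Ccw.
Variable s : seq T.
Hypothesis sP : simple_cycle al t s.
Hypothesis sC : forall x, x \in s -> ~~ ext s x.

Lemma ccw_right x : x \in s -> ext s (al x).
Proof.
move=> xs; case/orP: (left_or_right M sP xs r) => c.
  by case/negP: (sC xs); rewrite (nocross_sym M).
by rewrite (nocross_sym M).
Qed.

Lemma ccw_mem x : (x \in s) = ~~ ext s x && ext s (al x).
Proof.
apply/idP/andP => [xs|[nx ex]]; first by rewrite sC // ccw_right.
case: (boolP (x \in s)) => // xs; case: (boolP (al x \in s)) => als.
  by move: (sC als); rewrite ex.
by rewrite ext_al ?(negPf nx) in ex.
Qed.

Lemma int_connected x y : ~~ ext s x -> ~~ ext s y -> connect (nocross al ph s) x y.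
Proof.
move=> nx ny; have [c cs] : exists c, c \in s.
  by case/and4P: (sP); case: (s) => // c s' _ _ _ _; exists c; rewrite inE eqxx.
have side z : ~~ ext s z -> connect (nocross al ph s) c z.
  move=> nz; case/orP: (left_or_right M sP cs z) => // cz.
  by move: nz; rewrite -(ext_connect cz) ccw_right.
by apply: connect_trans (side y ny); rewrite (nocross_sym M) side.
Qed.

Lemma off_cycle x : t x \notin map t s -> (x \notin s) && (al x \notin s).
Proof.
move=> nx; apply/andP; split; first by apply: contra nx => /(map_f t).
apply: contra nx => /(cycle_succ sP)[y ys e]; rewrite -(alK x) -e.
exact: map_f.
Qed.

Lemma ext_vertex x y : t x \notin map t s -> t x = t y -> ext s x = ext s y.
Proof.
move=> nx /eqP; rewrite (tail_eq M) => /connectP[p pP ->].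
elim: p x nx pP => [|z p IH] x nx //= /andP[/eqP e zP].
have ez : ext s x = ext s z.
  by case/andP: (off_cycle nx) => n1 n2; rewrite -e ext_ph ext_al.
by rewrite ez; apply: IH zP; rewrite -e (tail_ph M) alK.
Qed.

Lemma ext_edge x : t x \notin map t s -> ext s (al x) = ext s x.
Proof. by move=> /off_cycle/andP[n1 n2]; apply: ext_al. Qed.

Definition int_edges := [set x | ~~ ext s x && ~~ ext s (al x)].
Definition int_vertices := [set t x | x in [set x | ~~ ext s x]] :\: [set t x | x in s].
Definition int_faces := [set L x | x in [set x | ~~ ext s x]].

Lemma tails_set v : (v \in [set t x | x in s]) = (v \in map t s).
Proof. by apply/imsetP/mapP => -[x xs ->]; exists x. Qed.

Lemma int_edges_al x : (al x \in int_edges) = (x \in int_edges).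
Proof. by rewrite !inE alK andbC. Qed.

(** [euler_bound] gives one inequality inside and one outside. Together with the cycle, which has as
    many vertices as edges, their sum is Euler's formula, so both are equalities. *)
Lemma int_euler : 2 * (#|int_vertices| + #|int_faces|) = #|int_edges| + 2.
Proof.
pose EE := [set x | ext s x && ext s (al x)].
pose VE := [set t x | x in [set x | ext s x]] :\: [set t x | x in s].
pose FE := [set L x | x in [set x | ext s x]].
have [c cs] : exists c, c \in s.
  by case/and4P: (sP); case: (s) => // c s' _ _ _ _; exists c; rewrite inE eqxx.
have cst (q : F -> rat) (E : {set T}) a b :
    (forall x, x \in E -> q (L x) = q (L (al x))) ->
    (forall x, connect (nocross al ph s) a x -> x \notin s -> al x \notin s -> x \in E) ->
    connect (nocross al ph s) a b -> q (L a) = q (L b).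
  move=> qE sub /connectP[p pP ->]; move: (connect0 (nocross al ph s) a) pP.
  move: {2 3 4 5}a => a' aa'; elim: p a' aa' => //= y p IH a' aa' /andP[ay yp].
  rewrite -(IH y) //; last exact: connect_trans aa' (connect1 ay).
  case/orP: ay => [/eqP->|/and3P[/eqP-> n1 n2]]; first by rewrite (left_ph M).
  exact: qE (sub _ aa' n1 n2).
have h1 : 2 * (#|int_vertices| + #|int_faces|) <= #|int_edges| + 2.
  apply: (euler_bound M (f0 := L c) (x0 := c)).
  - apply/subsetP => v /setDP[/imsetP[x _ ->] _]; exact: imset_f.
  - by apply: imset_f; rewrite inE sC.
  - by rewrite inE (imset_f t cs).
  - exact: int_edges_al.
  - move=> x /setDP[/imsetP[y]]; rewrite inE tails_set => ny e nx.
    by rewrite inE (ext_edge nx) andbb (ext_vertex nx e).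
  - move=> q qE f /imsetP[x]; rewrite inE => nx ->; apply/esym.
    apply: (cst q int_edges) => // [y cy n1 n2|]; last exact: int_connected (sC cs) nx.
    by rewrite inE (ext_al n1 n2) andbb -(ext_connect cy) sC.
have h2 : 2 * (#|VE| + #|FE|) <= #|EE| + 2.
  apply: (euler_bound M (f0 := L r) (x0 := c)).
  - apply/subsetP => v /setDP[/imsetP[x _ ->] _]; exact: imset_f.
  - by apply: imset_f; rewrite inE.
  - by rewrite inE (imset_f t cs).
  - by move=> x; rewrite !inE alK andbC.
  - move=> x /setDP[/imsetP[y]]; rewrite inE tails_set => ny e nx.
    by rewrite inE (ext_edge nx) andbb (ext_vertex nx e).
  - move=> q qE f /imsetP[x]; rewrite inE => nx ->; apply/esym.
    apply: (cst q EE) => // y cy n1 n2.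
    by rewrite inE (ext_al n1 n2) andbb.
have h3 : #|int_vertices| + #|VE| + size s = #|t @: [set: T]|.
  rewrite -(cycle_vertices sP) -(cardsID [set t z | z in s] (t @: [set: T])) addnC.
  have -> : t @: [set: T] :&: [set t z | z in s] = [set t z | z in s].
    by apply/setIidPr/subsetP => _ /imsetP[z _ ->]; apply: imset_f.
  congr (_ + _); rewrite -cardsUI.
  have -> : int_vertices :&: VE = set0.
    apply/setP => v; rewrite !inE; apply/negP => /andP[/andP[nv /imsetP[x nx e]]].
    move=> /andP[_ /imsetP[y ny e']]; rewrite tails_set e in nv.
    by rewrite !inE in nx ny; rewrite (ext_vertex nv (y := y)) ?ny // -e in nx.
  rewrite cards0 addn0; apply: eq_card => v; rewrite !inE -andb_orr; congr (_ && _).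
  apply/orP/imsetP => [[]/imsetP[x _ ->]|[x _ ->]]; try by exists x.
  case: (boolP (ext s x)) => nx; [right|left]; apply: imset_f; by rewrite inE.
have h4 : #|int_faces| + #|FE| = #|L @: [set: T]|.
  rewrite -cardsUI; have -> : int_faces :&: FE = set0.
    apply/setP => f; rewrite !inE; apply/negP => /andP[/imsetP[x nx ->] /imsetP[y ny e]].
    by rewrite !inE in nx ny; rewrite (ext_left s e) ny in nx.
  rewrite cards0 addn0; apply: eq_card => v; rewrite !inE.
  apply/orP/imsetP => [[]/imsetP[x _ ->]|[x _ ->]]; try by exists x.
  case: (boolP (ext s x)) => nx; [right|left]; apply: imset_f; by rewrite inE.
have h5 : #|int_edges| + #|EE| + 2 * size s = #|T|.
  rewrite -(cycle_darts M sP) -cardsUI.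
  have -> : int_edges :&: EE = set0.
    by apply/setP => x; rewrite !inE; do 2 case: (ext s _).
  rewrite cards0 addn0 -cardsUI.
  have -> : (int_edges :|: EE) :&: [set x | (x \in s) || (al x \in s)] = set0.
    by apply/setP => x; rewrite !inE !ccw_mem alK; do 2 case: (ext s _).
  rewrite cards0 addn0 -cardsT; apply: eq_card => x.
  by rewrite !inE !ccw_mem alK; do 2 case: (ext s _).
have := euler M; lia.
Qed.
End Ccw.

Lemma ccw_or_rev s : simple_cycle al t s ->
  (forall x, x \in s -> ~~ ext s x) \/
  (forall x, x \in rev (map al s) -> ~~ ext (rev (map al s)) x).
Proof.
move=> sP; have [c cs] : exists c, c \in s.
  by case/and4P: (sP); case: (s) => // c s' _ _ _ _; exists c; rewrite inE eqxx.
case: (boolP (ext s c)) => ec; [right|left].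
  move=> x; rewrite (mem_rev_cycle M) (eq_connect (nocross_rev M s)) => xs.
  rewrite -[x]alK -(ext_connect (right_connected M sP cs xs)).
  apply/negP => ec'; case/negP: (jordan M sP cs).
  by apply: connect_trans ec'; rewrite (nocross_sym M).
by move=> x xs; rewrite -(ext_connect (left_connected M sP cs xs)).
Qed.

Lemma cycle_invariant s (P : pred T) c : simple_cycle al t s -> c \in s -> P c ->
  (forall x y, x \in s -> y \in s -> t y = t (al x) -> P x -> P y) ->
  forall y, y \in s -> P y.
Proof.
move=> sP cs Pc step y ys; have [_ cyc _ _] := and4P sP.
have cyc' : path.cycle [rel x y | [&& x \in s, y \in s & t (al x) == t y]] s.
  apply: (sub_in_cycle (P := mem s)) cyc => [a b as_ bs /= ->|]; last by apply/allP.
  by rewrite /= in as_ bs *; rewrite as_ bs.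
have /connectP[p pP ->] := connect_cycle cyc' cs ys.
elim: p c Pc {cs} pP => //= b p IH a Pa /andP[/and3P[as_ bs /eqP e] bp].
by apply: IH bp; apply: step Pa.
Qed.

(** At the head of a common dart [x] after which the cycles separate, turn on the left of [x] up to
    the first of the two successors: it is reached without crossing the other cycle, so it lies
    inside that cycle. *)
Lemma ccw_diverge s1 s2 x1 x2 : simple_cycle al t s1 -> simple_cycle al t s2 ->
  (forall x, x \in s1 -> ~~ ext s1 x) -> (forall x, x \in s2 -> ~~ ext s2 x) ->
  x1 \in s1 -> x1 \in s2 -> x2 \in s1 -> x2 \notin s2 ->
  (exists a, [/\ a \in s1, t a \in map t s2, ~~ ext s2 a & ~~ ext s2 (al a)]) \/
  (exists a, [/\ a \in s2, t a \in map t s1, ~~ ext s1 a & ~~ ext s1 (al a)]).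
Proof.
move=> P1 P2 C1 C2 x11 x12 x21 x22.
have [x [a [xs1 xs2 as1 ea as2]]] :
    exists x a, [/\ x \in s1, x \in s2, a \in s1, t a = t (al x) & a \notin s2].
  case: (boolP [exists x in s1, [exists a in s1, [&& x \in s2, t a == t (al x) & a \notin s2]]]).
    move=> /existsP[x /andP[xs /existsP[a /and4P[as_ xs2 /eqP e n]]]].
    by exists x, a.
  move=> no; case/negP: x22; apply: (@cycle_invariant s1 (fun z => z \in s2) x1 P1 x11 x12 _ x2 x21) => x y xs ys e /= xs2.
  apply: contraT => ny; case/negP: no; apply/existsP; exists x; rewrite xs.
  by apply/existsP; exists y; rewrite ys xs2 e eqxx ny.
have [b bs2 eb] := cycle_succ P2 xs2.
have bs1 : b \notin s1.
  apply: contra as2 => bs1; rewrite (cycle_tail_inj P1 as1 bs1) //.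
  by rewrite ea eb.
have [||q [qQ qt qc]] := rotate_to M (Q := [set a; b]) (q0 := a) (x := x).
- by rewrite !inE eqxx.
- by [].
have free s : simple_cycle al t s -> x \in s -> forall c, c \in s -> t c = t (al x) ->
    c \in [set a; b] -> connect (nocross al ph s) x q.
  move=> sP xs c cs ec cQ; apply: qc => z tz zQ zx; apply/andP; split.
    by apply: contra zQ => zs; rewrite (cycle_tail_inj sP zs cs) // tz.
  apply: contra zx => zs; rewrite -[x](@cycle_head_inj _ _ _ _ s sP (al z)) ?alK //.
have c1 := free s1 P1 xs1 a as1 ea (setU11 _ _).
have c2 : connect (nocross al ph s2) x q by apply: (free s2 P2 xs2 b bs2 eb); rewrite !inE eqxx orbT.
case/set2P: qQ => qE.
- left; exists a; split=> //; first by apply/mapP; exists b; rewrite ?eb.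
    by rewrite -qE -(ext_connect c2) C2.
  rewrite ext_al //; first by rewrite -qE -(ext_connect c2) C2.
  apply/negP => als2; have e : al a = x.
    by apply: (cycle_head_inj P2 als2 xs2); rewrite alK.
  by move: (cycle_al P1 as1); rewrite e xs1.
- right; exists b; split=> //; first by apply/mapP; exists a; rewrite ?ea.
    by rewrite -qE -(ext_connect c1) C1.
  rewrite ext_al //; first by rewrite -qE -(ext_connect c1) C1.
  apply/negP => als1; have e : al b = x.
    by apply: (cycle_head_inj P1 als1 xs1); rewrite alK.
  by move: (cycle_al P2 bs2); rewrite e xs2.
Qed.

(** A path outside [s] never crosses [c], because the darts of [c] that are off [s] have both sides
    inside [s]. *)
Lemma subcycle_ext s c : (forall x, x \in s -> ~~ ext s x) ->
  (forall x, x \in c -> (x \in s) || (~~ ext s x && ~~ ext s (al x))) ->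
  forall x, ext s x -> ext c x.
Proof.
move=> sC cs; have step a b : ext s a -> nocross al ph s a b -> ext c a -> ext s b && ext c b.
  move=> ea ab eca; have eb : ext s b := connect_trans ea (connect1 ab).
  rewrite eb /=; apply: connect_trans eca (connect1 _).
  case/orP: ab => [/eqP->|/and3P[/eqP bE n1 n2]]; first by rewrite /nocross /= eqxx.
  rewrite bE in eb *; rewrite /nocross /= eqxx /=; apply/orP; right; apply/andP; split.
    by apply/negP => /cs; rewrite (negPf n1) ea.
  by apply/negP => /cs; rewrite (negPf n2) eb.
move=> x /connectP[p pP ->]; move: (connect0 (nocross al ph s) r) (connect0 (nocross al ph c) r) pP.
move: {2 4 5 7}r => a; elim: p a => //= b p IH a ea eca /andP[ab bp].
by have /andP[eb ecb] := step a b ea ab eca; apply: IH.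
Qed.

(** The right side of the shared dart [x0] is outside [s], hence outside [c]. Were [c] clockwise,
    its left side at [x0] would be outside too, against [jordan]. *)
Lemma subcycle_ccw s c x0 : simple_cycle al t s -> (forall x, x \in s -> ~~ ext s x) ->
  simple_cycle al t c ->
  (forall x, x \in c -> (x \in s) || (~~ ext s x && ~~ ext s (al x))) ->
  x0 \in c -> x0 \in s -> forall x, x \in c -> ~~ ext c x.
Proof.
move=> sP sC cP cs x0c x0s x xc; apply/negP => ex.
case/negP: (jordan M cP x0c).
have e0 : ext c x0 by rewrite -(ext_connect (left_connected M cP xc x0c)).
have e1 : ext c (al x0).
  by apply: (subcycle_ext sC cs); apply: ccw_right.
by apply: connect_trans e1; rewrite (nocross_sym M).
Qed.

(** [euler_bound] for [Y], the faces touching it and the edges with an end in it, subtracted from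
    Euler's formula. Connectedness of [Y], given as an induction principle, links all the faces that
    touch it. *)
Lemma coconnected_euler (Y : {set V}) (r0 x0 : T) :
  Y \subset t @: [set: T] -> t r0 \in Y -> t x0 \notin Y ->
  (forall P : pred V, P (t r0) ->
     (forall x, t x \in Y -> t (al x) \in Y -> P (t x) -> P (t (al x))) ->
     forall v, v \in Y -> P v) ->
  #|[set x | (t x \notin Y) && (t (al x) \notin Y)]| + 2 <=
  2 * (#|t @: [set: T] :\: Y| +
       #|L @: [set: T] :\: [set L x | x in [set x | t x \in Y]]|).
Proof.
move=> Ysub r0Y x0Y Yconn; set E' := [set x | _]; set FY := [set L x | x in [set x | t x \in Y]].
pose E := ~: E'.
have h : 2 * (#|Y| + #|FY|) <= #|E| + 2.
  apply: (euler_bound M (f0 := L r0) (x0 := x0)) => //.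
  - by apply: imset_f; rewrite inE.
  - by move=> x; rewrite !inE alK andbC.
  - by move=> x xY; rewrite !inE xY.
  - move=> q qE _ /imsetP[x xY ->]; rewrite inE in xY.
    have vert y z : t y \in Y -> t y = t z -> q (L y) = q (L z).
      move=> yY /eqP; rewrite (tail_eq M) => /connectP[p pP ->].
      elim: p y yY pP => //= c p IH y yY /andP[/eqP e cp].
      rewrite -(IH c) //; last by rewrite -e (tail_ph M) alK.
      by rewrite -e (left_ph M); apply: qE; rewrite !inE yY.
    pose P v := [forall y, (t y == v) ==> (q (L y) == q (L r0))].
    suff /forallP/(_ x) : P (t x) by rewrite eqxx => /eqP.
    apply: Yconn => // [|a aY bY /forallP/(_ a)].
      by apply/forallP => y; apply/implyP => /eqP e; rewrite (vert y r0) // e.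
    rewrite eqxx /= => /eqP e; apply/forallP => y; apply/implyP => /eqP ey.
    by rewrite (vert y (al a)) // -?qE ?e ?ey // !inE aY.
have cE : #|E| + #|E'| = #|T| by rewrite addnC cardsC.
have cY : #|t @: [set: T]| = #|Y| + #|t @: [set: T] :\: Y|.
  by rewrite -(cardsID Y (t @: _)) (setIidPr Ysub).
have cF : #|L @: [set: T]| = #|FY| + #|L @: [set: T] :\: FY|.
  rewrite -(cardsID FY (L @: _)) (setIidPr _) //.
  by apply/subsetP => _ /imsetP[x _ ->]; apply: imset_f.
have := euler M; lia.
Qed.

End Interior.

(** * Lattices generated by cycle pushes *)

Section FlipLattice.
Variables (T : finType) (al : T -> T) (X : {ffun T -> nat} -> Prop).
Variable G : {set {set T}}.
Local Notation W := {ffun T -> nat}.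
Local Open Scope ring_scope.

Definition on_cycles (n : {set T} -> int) (x : T) : int :=
  \sum_(c in G | x \in c) n c.
Definition comb (n : {set T} -> int) (x : T) : int :=
  on_cycles n x - on_cycles n (al x).
Definition push_set (w : W) (c : {set T}) : W :=
  [ffun x => if x \in c then (w x).-1 else if al x \in c then (w x).+1 else w x].
Definition flop (w w' : W) : Prop :=
  exists c, [/\ c \in G, forall x, x \in c -> (0 < w x)%N & w' = push_set w c].
Definition flop_le := clos_refl_trans W flop.

Implicit Types (A B C : W) (c : {set T}) (n m : {set T} -> int).

Hypothesis G_al : forall c x, c \in G -> x \in c -> al x \notin c.
Hypothesis G_disj : forall c c' x, c \in G -> c' \in G -> x \in c -> x \in c' -> c = c'.
Hypothesis G_free : forall n, (forall x, comb n x = 0) -> forall c, c \in G -> n c = 0.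
Hypothesis X_conn : forall A B : W, X A -> X B ->
  exists n, forall x, (A x)%:Z = (B x)%:Z + comb n x.
Hypothesis X_closed : forall (A w : W) n, X A ->
  (forall x, (w x)%:Z = (A x)%:Z - comb n x) -> X w.
Hypothesis G_flex : forall c, c \in G ->
  exists2 A : W, X A & forall x, x \in c -> (0 < A x)%N.

(** Formal pushing: [n c] is the net number of pushes of [c] leading from [A] to [B], regardless of
    whether a sequence of legal pushes realizes it. *)
Definition coord (A B : W) (n : {set T} -> int) :=
  forall x, (B x)%:Z = (A x)%:Z - comb n x.

Lemma on_cyclesE n c x : c \in G -> x \in c -> on_cycles n x = n c.
Proof.
move=> cG xc; rewrite /on_cycles (big_pred1 c) // => c' /=.
by apply/andP/eqP => [[c'G xc']|->//]; apply: (G_disj (x := x)).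
Qed.

Lemma on_cycles0 n x : (forall c, c \in G -> x \notin c) -> on_cycles n x = 0.
Proof.
move=> no; rewrite /on_cycles big_pred0 // => c.
by apply/negP => /andP[/no/negP].
Qed.

Lemma combD n m x : comb (fun c => n c + m c) x = comb n x + comb m x.
Proof. by rewrite /comb /on_cycles !big_split /=; ring. Qed.

Lemma combN n x : comb (fun c => - n c) x = - comb n x.
Proof. by rewrite /comb /on_cycles !sumrN; ring. Qed.

Lemma eq_comb n m : (forall c, c \in G -> n c = m c) -> comb n =1 comb m.
Proof.
move=> nm x; rewrite /comb /on_cycles; congr (_ - _);
  by apply: eq_bigr => c /andP[cG _]; exact: nm.
Qed.

Lemma coord_inj A B n m : coord A B n -> coord A B m -> forall c, c \in G -> n c = m c.
Proof.
move=> cn cm c cG; apply/eqP; rewrite -subr_eq0; apply/eqP.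
apply: (G_free (n := fun c => n c - m c)) => // x.
rewrite combD combN; have := cn x; have := cm x; lia.
Qed.

Lemma coord_trans A B C n m : coord A B n -> coord B C m ->
  coord A C (fun c => n c + m c).
Proof. move=> cn cm x; rewrite combD cm cn; ring. Qed.

Lemma coord_sym A B n : coord A B n -> coord B A (fun c => - n c).
Proof. move=> cn x; rewrite combN cn; ring. Qed.

Lemma coord_eq A B n : coord A B n -> (forall c, c \in G -> n c = 0) -> A = B.
Proof.
move=> cn n0; apply/ffunP => x; have := cn x.
rewrite (eq_comb (m := fun => 0)) // /comb /on_cycles !big1 //; lia.
Qed.

Lemma coord_ex A B : X A -> X B -> exists n, coord A B n.
Proof.
move=> XA XB; have [n nE] := X_conn XB XA; exists (fun c => - n c) => x.
by rewrite combN opprK nE.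
Qed.

Definition unit_at (c c' : {set T}) : int := (c' == c)%:Z.

Lemma on_cycles_unit c x : c \in G -> on_cycles (unit_at c) x = (x \in c)%:Z.
Proof.
move=> cG; case: (boolP (x \in c)) => xc.
  by rewrite (on_cyclesE _ cG xc) /unit_at eqxx.
rewrite /on_cycles big1 // => c' /andP[c'G xc'].
by rewrite /unit_at; case: eqP => // e; rewrite -e xc' in xc.
Qed.

Lemma coord_push A c : c \in G -> (forall x, x \in c -> (0 < A x)%N) ->
  coord A (push_set A c) (unit_at c).
Proof.
move=> cG Apos x; rewrite /comb !on_cycles_unit // ffunE.
case: (boolP (x \in c)) => xc.
  by rewrite (negPf (G_al cG xc)); have := Apos x xc; lia.
by case: (al x \in c); lia.
Qed.

Lemma flop_X A B : X A -> flop A B -> X B.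
Proof. by move=> XA [c [cG Apos ->]]; apply: X_closed XA (coord_push cG Apos). Qed.

Lemma flop_le_coord A B : X A -> flop_le A B ->
  X B /\ exists2 n, coord A B n & forall c, c \in G -> 0 <= n c.
Proof.
move=> XA AB; elim: AB XA => {A B} [A B AB|A|A B C _ IH1 _ IH2] XA.
- split; first exact: flop_X AB.
  have [c [cG Apos ->]] := AB; exists (unit_at c); first exact: coord_push.
  by move=> c' _; rewrite /unit_at; case: eqP.
- split=> //; exists (fun=> 0) => // x.
  by rewrite /comb /on_cycles !big1 //; lia.
- have [XB [n nE n0]] := IH1 XA; have [XC [m mE m0]] := IH2 XB; split=> //.
  by exists (fun c => n c + m c); [exact: coord_trans|move=> c cG; rewrite addr_ge0 ?n0 ?m0].
Qed.

(* If every cycle that still has to be pushed were blocked, following the blocking arcs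
   would increase without bound the coordinates summed over the witnesses of G_flex. *)
Lemma flop_exists A B n : X A -> X B -> coord A B n ->
  (forall c, c \in G -> 0 <= n c) -> (exists2 c, c \in G & 0 < n c) ->
  exists c, [/\ c \in G, 0 < n c & forall x, x \in c -> (0 < A x)%N].
Proof.
move=> XA XB nE n0 [c1 c1G nc1].
have [m mP] : exists m : {set T} -> {set T} -> int, forall c0, c0 \in G ->
    exists2 B0 : W, coord A B0 (m c0) & forall x, x \in c0 -> (0 < B0 x)%N.
  apply: (@fin_all_exists _ _ (fun c0 mm => c0 \in G ->
    exists2 B0 : W, coord A B0 mm & forall x, x \in c0 -> (0 < B0 x)%N)) => c0.
  case: (boolP (c0 \in G)) => [c0G|]; last by exists (fun=> 0).
  have [B0 XB0 pos] := G_flex c0G; have [mm mmE] := coord_ex XA XB0.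
  by exists mm => _; exists B0.
pose tot c := \sum_(c0 in G) m c0 c.
have Sc1 : (c1 \in G) && (0 < n c1) by rewrite c1G.
have [c /andP[cG nc] cmax] := @arg_maxP _ _ _ c1 (fun c => (c \in G) && (0 < n c)) tot Sc1.
exists c; split=> // x xc; rewrite lt0n; apply/negP => /eqP Ax0.
have compn k : comb k x = k c - on_cycles k (al x) by rewrite /comb (on_cyclesE _ cG xc).
have [c' c'G alx] : exists2 c', c' \in G & al x \in c'.
  case: (boolP [exists c', (c' \in G) && (al x \in c')]).
    by move=> /existsP[c' /andP[? ?]]; exists c'.
  move=> no; have := nE x; rewrite compn on_cycles0 ?Ax0; first by lia.
  by move=> c' c'G; apply: contra no => h; apply/existsP; exists c'; rewrite c'G.
have compm k : comb k x = k c - k c' by rewrite compn (on_cyclesE _ c'G alx).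
(* As [A x = 0], the weights of [x] in [B] and in every witness are coordinates at [c'] minus
   coordinates at [c]. They are nonnegative, and positive for the witness of [c], so [tot] is larger
   at [c']. *)
have nc' : 0 < n c' by have := nE x; rewrite compm Ax0; lia.
have := cmax c'; rewrite c'G nc' => /(_ isT); apply/negP; rewrite -ltNge.
rewrite /tot (bigD1 c) //= [ltRHS](bigD1 c) //=; apply: ltr_leD.
  by have [B0 mE pos] := mP c cG; have := pos x xc; have := mE x; rewrite compm Ax0; lia.
apply: ler_sum => c0 /andP[c0G _].
by have [B0 mE _] := mP c0 c0G; have := mE x; rewrite compm Ax0; lia.
Qed.

Lemma coord_flop_le A B n : X A -> X B -> coord A B n ->
  (forall c, c \in G -> 0 <= n c) -> flop_le A B.
Proof.
have [k] := ubnP (\sum_(c in G) `|n c|)%N.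
elim: k A n => // k IH A n kS XA XB nE n0.
case: (boolP [exists c, (c \in G) && (0 < n c)]) => [/existsP[c /andP[cG nc]]|no].
  have [|c' [c'G nc' Apos]] := flop_exists XA XB nE n0; first by exists c.
  have st : flop A (push_set A c') by exists c'.
  apply: rt_trans (rt_step _ _ _ _ st) _.
  have cP := coord_push c'G Apos.
  apply: (IH _ (fun c => - unit_at c' c + n c)) => //.
  - rewrite ltnS in kS; apply: leq_trans kS; rewrite (bigD1 c') //= [X in (_ < X)%N](bigD1 c') //=.
    rewrite -addSn; apply: leq_add; first by rewrite /unit_at eqxx; lia.
    by apply: leq_sum => c0 /andP[_ nc0]; rewrite /unit_at (negPf nc0); lia.
  - exact: flop_X st.
  - exact: coord_trans (coord_sym cP) nE.
  - by move=> c0 c0G; rewrite /unit_at; case: eqP => [->|_]; have := n0 _ c0G; lia.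
rewrite (coord_eq nE); first exact: rt_refl.
move=> c cG; apply/eqP; rewrite eq_le n0 // andbT leNgt.
by apply: contra no => nc; apply/existsP; exists c; rewrite cG.
Qed.

Section Base.
Variable A0 : W.
Hypothesis XA0 : X A0.

Lemma le_coordP A B n m : X A -> X B -> coord A0 A n -> coord A0 B m ->
  flop_le A B <-> (forall c, c \in G -> n c <= m c).
Proof.
move=> XA XB nE mE; have dE := coord_trans (coord_sym nE) mE; split=> [|le].
  move=> /(flop_le_coord XA)[_ [k kE k0]] c cG; have := k0 c cG.
  by rewrite (coord_inj kE dE cG); lia.
by apply: coord_flop_le dE _ => // c cG; have := le c cG; lia.
Qed.

(** An arc and its reverse each lie on at most one cycle of [G], so nonnegativity of a weight bounds
    the difference of two coordinates by the weight in [A0]. Minimum and maximum preserve such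
    bounds, which is the second condition on [mm]; the first gives [mm 0 0 = 0], for arcs on no
    cycle. *)
Lemma extremal_coord (mm : int -> int -> int) A B n m :
  (forall i j, mm i j = i \/ mm i j = j) ->
  (forall a i j i' j', i - i' <= a -> j - j' <= a -> mm i j - mm i' j' <= a) ->
  X A -> X B -> coord A0 A n -> coord A0 B m ->
  exists2 C, X C & coord A0 C (fun c => mm (n c) (m c)).
Proof.
move=> mid lip XA XB nE mE; pose k c := mm (n c) (m c).
have mm00 : mm 0 0 = 0 by case: (mid 0 0).
have onk x : on_cycles k x = mm (on_cycles n x) (on_cycles m x).
  case: (boolP [exists c, (c \in G) && (x \in c)]) => [/existsP[c /andP[cG xc]]|no].
    by rewrite !(on_cyclesE _ cG xc).
  rewrite !on_cycles0 ?mm00 // => c cG; apply: contra no => xc;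
    by apply/existsP; exists c; rewrite cG.
have kle x : comb k x <= (A0 x)%:Z.
  by rewrite /comb !onk; apply: lip; have := nE x; have := mE x; rewrite /comb; lia.
pose C : W := [ffun x => `|(A0 x)%:Z - comb k x|%N].
have CE : coord A0 C k by move=> x; rewrite ffunE; have := kle x; lia.
by exists C => //; apply: X_closed XA0 CE.
Qed.

Lemma max_coord A B n m : X A -> X B -> coord A0 A n -> coord A0 B m ->
  exists2 C, X C & coord A0 C (fun c => Num.max (n c) (m c)).
Proof.
by apply: (extremal_coord (mm := Num.max)) => *; rewrite ?maxEle; repeat case: ifP; lia.
Qed.

Lemma min_coord A B n m : X A -> X B -> coord A0 A n -> coord A0 B m ->
  exists2 C, X C & coord A0 C (fun c => Num.min (n c) (m c)).
Proof.
by apply: (extremal_coord (mm := Num.min)) => *; rewrite ?minEle; repeat case: ifP; lia.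
Qed.

Lemma max_is_lub A B C n m : X A -> X B -> X C -> coord A0 A n -> coord A0 B m ->
  coord A0 C (fun c => Num.max (n c) (m c)) -> is_lub X flop_le A B C.
Proof.
move=> XA XB XC nE mE kE; split=> //.
- by apply/(le_coordP XA XC nE kE) => c _; rewrite le_max lexx.
- by apply/(le_coordP XB XC mE kE) => c _; rewrite le_max lexx orbT.
- move=> Z XZ; have [z zE] := coord_ex XA0 XZ.
  move=> /(le_coordP XA XZ nE zE) h1 /(le_coordP XB XZ mE zE) h2.
  by apply/(le_coordP XC XZ kE zE) => c cG; rewrite ge_max h1 ?h2.
Qed.

Lemma min_is_glb A B C n m : X A -> X B -> X C -> coord A0 A n -> coord A0 B m ->
  coord A0 C (fun c => Num.min (n c) (m c)) -> is_glb X flop_le A B C.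
Proof.
move=> XA XB XC nE mE kE; split=> //.
- by apply/(le_coordP XC XA kE nE) => c _; rewrite ge_min lexx.
- by apply/(le_coordP XC XB kE mE) => c _; rewrite ge_min lexx orbT.
- move=> Z XZ; have [z zE] := coord_ex XA0 XZ.
  move=> /(le_coordP XZ XA zE nE) h1 /(le_coordP XZ XB zE mE) h2.
  by apply/(le_coordP XZ XC zE kE) => c cG; rewrite le_min h1 ?h2.
Qed.

Lemma flop_le_anti A B : X A -> X B -> flop_le A B -> flop_le B A -> A = B.
Proof.
move=> XA XB; have [n nE] := coord_ex XA0 XA; have [m mE] := coord_ex XA0 XB.
move=> /(le_coordP XA XB nE mE) h1 /(le_coordP XB XA mE nE) h2.
apply: (coord_eq (coord_trans (coord_sym nE) mE)) => c cG.
by have := h1 c cG; have := h2 c cG; lia.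
Qed.

(** The distributive law speaks of arbitrary least upper bounds, so their coordinates are obtained
    by uniqueness from the bound built in [max_coord]. *)
Lemma lub_coord A B C n m k : X A -> X B -> coord A0 A n -> coord A0 B m ->
  coord A0 C k -> is_lub X flop_le A B C ->
  forall c, c \in G -> k c = Num.max (n c) (m c).
Proof.
move=> XA XB nE mE kE [XC h1 h2 h3]; have [C' XC' kE'] := max_coord XA XB nE mE.
have [_ h1' h2' h3'] := max_is_lub XA XB XC' nE mE kE'.
rewrite (flop_le_anti XC XC' (h3 _ XC' h1' h2') (h3' _ XC h1 h2)) in kE.
exact: coord_inj kE kE'.
Qed.

Lemma glb_coord A B C n m k : X A -> X B -> coord A0 A n -> coord A0 B m ->
  coord A0 C k -> is_glb X flop_le A B C ->
  forall c, c \in G -> k c = Num.min (n c) (m c).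
Proof.
move=> XA XB nE mE kE [XC h1 h2 h3]; have [C' XC' kE'] := min_coord XA XB nE mE.
have [_ h1' h2' h3'] := min_is_glb XA XB XC' nE mE kE'.
rewrite (flop_le_anti XC XC' (h3' _ XC h1 h2) (h3 _ XC' h1' h2')) in kE.
exact: coord_inj kE kE'.
Qed.
End Base.

Theorem flop_lattice : distributive_lattice X flop_le.
Proof.
split.
- by move=> A _; exact: rt_refl.
- by move=> A B XA; exact: (flop_le_anti XA).
- by move=> A B C _ _ _; exact: rt_trans.
- move=> A B XA XB; have [n nE] := coord_ex XA XA; have [m mE] := coord_ex XA XB.
  have [C XC kE] := max_coord XA XA XB nE mE.
  have [D XD lE] := min_coord XA XA XB nE mE.
  by split; [exists C; exact: max_is_lub kE|exists D; exact: min_is_glb lE].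
- move=> a b c j m1 m2 m3 u Xa Xb Xc lj g1 g2 g3 lu.
  have [[Xj _ _ _] [Xm1 _ _ _] [Xm2 _ _ _]] := And3 lj g1 g2.
  have [[Xm3 _ _ _] [Xu _ _ _]] := conj g3 lu.
  have [na aE] := coord_ex Xa Xa; have [nb bE] := coord_ex Xa Xb.
  have [nc cE] := coord_ex Xa Xc; have [nj jE] := coord_ex Xa Xj.
  have [n1 m1E] := coord_ex Xa Xm1; have [n2 m2E] := coord_ex Xa Xm2.
  have [n3 m3E] := coord_ex Xa Xm3; have [nu uE] := coord_ex Xa Xu.
  apply: (coord_eq (coord_trans (coord_sym m1E) uE)) => g gG.
  rewrite (lub_coord Xa Xm2 Xm3 m2E m3E uE lu gG).
  rewrite (glb_coord Xa Xa Xb aE bE m2E g2 gG) (glb_coord Xa Xa Xc aE cE m3E g3 gG).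
  rewrite (glb_coord Xa Xa Xj aE jE m1E g1 gG) (lub_coord Xa Xb Xc bE cE jE lj gG).
  by rewrite min_maxr addNr.
Qed.

Theorem flop_covers A B : X A -> X B -> covers X flop_le A B <-> flop A B.
Proof.
move=> XA XB; split=> [[_ _ AB nAB cov]|AB].
  have [//|[Y AY YB]] : A = B \/ exists2 Y, flop A Y & flop_le Y B.
    by case: (clos_rt_rt1n _ _ _ _ AB) => [|Y Z AY YZ]; [left|right; exists Y => //; exact: clos_rt1n_rt].
  have XY := flop_X XA AY.
  case: (cov Y XY (rt_step _ _ _ _ AY) YB) => [e|<- //].
  have [c [cG Apos eY]] := AY; have := coord_push cG Apos; rewrite -eY e => h.
  have h0 : coord A A (fun=> 0) by move=> x; rewrite /comb /on_cycles !big1 //; lia.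
  by have := coord_inj h h0 cG; rewrite /unit_at eqxx.
have h0 : coord A A (fun=> 0) by move=> x; rewrite /comb /on_cycles !big1 //; lia.
have [c [cG Apos eB]] := AB; have h1 := coord_push cG Apos; rewrite -eB in h1.
split=> //; first exact: rt_step.
  move=> e; rewrite -e in h1; have := coord_inj h1 h0 cG.
  by rewrite /unit_at eqxx.
move=> Z XZ; have [z zE] := coord_ex XA XZ.
move=> /(le_coordP XA XZ h0 zE) l1 /(le_coordP XZ XB zE h1) l2.
have zc c' : c' \in G -> c' != c -> z c' = 0.
  by move=> c'G ne; have := l1 _ c'G; have := l2 _ c'G; rewrite /unit_at (negPf ne); lia.
case: (eqVneq (z c) 0) => e; [left|right].
  apply/esym/(coord_eq zE) => c' c'G; case: (eqVneq c' c) => [->//|]; exact: zc.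
apply: (coord_eq (coord_trans (coord_sym zE) h1)) => c' c'G.
case: (eqVneq c' c) => [->|ne].
  by have := l1 _ cG; have := l2 _ cG; rewrite /unit_at eqxx; lia.
by rewrite zc // /unit_at (negPf ne).
Qed.

End FlipLattice.

(** * The angular map *)

Lemma porbit_ind (D : finType) (s : {perm D}) (P : D -> Prop) x :
  P x -> (forall y, P y -> P (s y)) -> forall y, y \in porbit s x -> P y.
Proof.
move=> Px step y /porbitP[i ->]; elim: i => [|i IH]; first by rewrite expg0 perm1.
by rewrite expgSr permM; apply: step.
Qed.

Lemma inl_inj (A B : Type) : injective (@inl A B). Proof. by move=> ? ? []. Qed.
Lemma inr_inj (A B : Type) : injective (@inr A B). Proof. by move=> ? ? []. Qed.

Lemma fconnect_ind (T : finType) (f : T -> T) (P : T -> Prop) x :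
  P x -> (forall y, P y -> P (f y)) -> forall y, fconnect f x y -> P y.
Proof. by move=> Px step y /iter_findex <-; elim: (findex f x y) => //= n /step. Qed.

Section AngularMap.
Variables (D : finType) (alpha sigma : {perm D}) (r : D).
Hypothesis PM : plane_map alpha sigma.

Local Notation ph := (phi alpha sigma).
Local Notation fc := (face alpha sigma).
Local Notation vx := (vertex sigma).
Local Notation inn := (inner alpha sigma r).
Local Notation og := (orig alpha sigma r).
Local Notation G := (PD alpha sigma r).

Lemma alphaK x : alpha (alpha x) = x. Proof. by case: PM. Qed.
Lemma alpha_neq x : alpha x != x. Proof. by case: PM. Qed.

Lemma phiE y : ph y = (sigma^-1)%g (alpha y). Proof. by rewrite /phi permM. Qed.

Lemma face_phi y : fc (ph y) = fc y.
Proof. by rewrite /face -[ph y in LHS]/(iter 1 ph y) -permX porbit_perm. Qed.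

Lemma face_phiV y : fc ((ph^-1)%g y) = fc y.
Proof. by rewrite -[in RHS](permKV ph y) face_phi. Qed.

Lemma vertex_sigma y : vx (sigma y) = vx y.
Proof. by rewrite /vertex -[sigma y in LHS]/(iter 1 sigma y) -permX porbit_perm. Qed.

Lemma vertex_sigmaV y : vx ((sigma^-1)%g y) = vx y.
Proof. by rewrite -[in RHS](permKV sigma y) vertex_sigma. Qed.

Lemma vertex_phi y : vx (ph y) = vx (alpha y).
Proof. by rewrite phiE vertex_sigmaV. Qed.

Lemma innerE y : inn y = (fc y != fc r).
Proof. by rewrite /inner /outer_face /face eq_porbit_mem. Qed.

Lemma inner_phi y : inn (ph y) = inn y.
Proof. by rewrite !innerE face_phi. Qed.

Lemma inner_phiV y : inn ((ph^-1)%g y) = inn y.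
Proof. by rewrite !innerE face_phiV. Qed.

Lemma inner_face y z : fc y = fc z -> inn y = inn z.
Proof. by move=> e; rewrite !innerE e. Qed.

Lemma mem_face y : y \in fc y. Proof. exact: porbit_id. Qed.

Lemma face_eq y z : z \in fc y -> fc z = fc y.
Proof. by move=> h; apply/eqP; rewrite /face eq_porbit_mem. Qed.

Lemma face_mem y z : fc z = fc y -> z \in fc y.
Proof. by move=> <-; exact: mem_face. Qed.

Lemma mem_vertex y : y \in vx y. Proof. exact: porbit_id. Qed.


(* The star dart at the corner of y, leaving the star vertex iff b; junk if y is outer. *)
Definition star (y : D) (b : bool) : G := insubd (og r) (inr (y, b)).

Lemma val_star y b : inn y -> val (star y b) = inr (y, b).
Proof. by move=> iy; rewrite val_insubd /= iy. Qed.

Variant pd_spec : G -> Prop :=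
  | PdOrig y : pd_spec (og y)
  | PdStar y b of inn y : pd_spec (star y b).

Lemma pdP x : pd_spec x.
Proof.
case: x => -[y|[y b]] px.
  have -> : exist _ (inl y) px = og y by apply: val_inj.
  exact: PdOrig.
have -> : exist _ (inr (y, b)) px = star y b by apply: val_inj; rewrite /= val_star.
exact: PdStar.
Qed.

Lemma palpha_orig y : palpha (og y) = og (alpha y).
Proof. by apply: val_inj; rewrite /palpha /plift val_insubd. Qed.

Lemma palpha_star y b : inn y -> palpha (star y b) = star y (~~ b).
Proof.
by move=> iy; apply: val_inj; rewrite /palpha /plift val_insubd /= !val_star //= iy.
Qed.

Lemma pphi_orig y : inn y -> pphi (og y) = star (ph y) false.
Proof.
move=> iy; apply: val_inj; rewrite /pphi /plift val_insubd /= iy /=.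
by rewrite inner_phi iy val_star // inner_phi.
Qed.

Lemma pphi_outer y : ~~ inn y -> pphi (og y) = og (ph y).
Proof.
by move=> iy; apply: val_inj; rewrite /pphi /plift val_insubd /= (negPf iy).
Qed.

Lemma pphi_to_star y : inn y -> pphi (star y false) = star ((ph^-1)%g y) true.
Proof.
move=> iy; apply: val_inj; rewrite /pphi /plift val_insubd /= !val_star //=.
  by rewrite inner_phiV iy.
by rewrite inner_phiV.
Qed.

Lemma pphi_from_star y : inn y -> pphi (star y true) = og y.
Proof. by move=> iy; apply: val_inj; rewrite /pphi /plift val_insubd /= !val_star. Qed.

Lemma ptail_orig y : ptail (og y) = inl (vx y). Proof. by []. Qed.
Lemma ptail_to_star y : inn y -> ptail (star y false) = inl (vx y).
Proof. by move=> iy; rewrite /ptail val_star. Qed.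
Lemma ptail_from_star y : inn y -> ptail (star y true) = inr (fc y).
Proof. by move=> iy; rewrite /ptail val_star. Qed.

Lemma orig_inj : injective og.
Proof. by move=> y z /(congr1 val) []. Qed.

Lemma star_inj y z b c : inn y -> inn z -> star y b = star z c -> y = z /\ b = c.
Proof. by move=> iy iz /(congr1 val); rewrite !val_star // => -[-> ->]. Qed.

Lemma orig_star y z b : inn z -> og y <> star z b.
Proof. by move=> iz /(congr1 val); rewrite val_star. Qed.

(* Inner faces of the angular map are indexed by their original dart. *)
Definition pleft (x : G) : option D :=
  match val x with
  | inl y => if inn y then Some y else None
  | inr (y, true) => Some y
  | inr (y, false) => Some ((ph^-1)%g y)
  end.

Lemma pleft_orig y : pleft (og y) = if inn y then Some y else None. Proof. by []. Qed.
Lemma pleft_to_star y : inn y -> pleft (star y false) = Some ((ph^-1)%g y).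
Proof. by move=> iy; rewrite /pleft val_star. Qed.
Lemma pleft_from_star y : inn y -> pleft (star y true) = Some y.
Proof. by move=> iy; rewrite /pleft val_star. Qed.

Lemma palphaK : involutive (@palpha D alpha sigma r).
Proof.
move=> x; case: (pdP x) => [y|y b iy]; first by rewrite !palpha_orig alphaK.
by rewrite !palpha_star // negbK.
Qed.

Lemma palpha_neq (x : G) : palpha x != x.
Proof.
apply/eqP; case: (pdP x) => [y|y b iy].
  by rewrite palpha_orig => /orig_inj e; have := alpha_neq y; rewrite e eqxx.
by rewrite palpha_star // => /star_inj[] // _; case: b.
Qed.

Lemma pphi_inj : injective (@pphi D alpha sigma r).
Proof.
pose g (x : G) : G := match val x with
  | inl y => if inn y then star y true else og ((ph^-1)%g y)
  | inr (y, true) => star (ph y) false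
  | inr (y, false) => og ((ph^-1)%g y) end.
apply: (can_inj (g := g)) => x; case: (pdP x) => [y|y [] iy].
- case: (boolP (inn y)) => iy; first by rewrite pphi_orig // /g val_star ?inner_phi //= permK.
  by rewrite pphi_outer // /g /= inner_phi (negPf iy) permK.
- by rewrite pphi_from_star // /g /= iy.
- by rewrite pphi_to_star // /g val_star ?inner_phiV //= permKV.
Qed.

Let rot (x : G) := pphi (palpha x).
Let rot_inj : injective rot.
Proof. by move=> x y /pphi_inj /(inv_inj palphaK). Qed.

(** [rot] turns clockwise: from [sigma y] back to [y], passing through the star dart of the corner
    between them when that corner is inner. *)
Lemma rot_sigma y : fconnect rot (og (sigma y)) (og y).
Proof.
have e : ph (alpha (sigma y)) = y by rewrite phiE alphaK permK.
case: (boolP (inn y)) => iy.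
  have h : rot (og (sigma y)) = star y false.
    by rewrite /rot palpha_orig pphi_orig ?e // -inner_phi e.
  apply: connect_trans (fconnect1 _ _) _; rewrite h.
  by apply: connect1; rewrite /= /rot palpha_star // pphi_from_star.
apply: connect1; rewrite /= /rot palpha_orig pphi_outer ?e //.
by rewrite -inner_phi e.
Qed.

Lemma rot_to_star y : inn y -> fconnect rot (star y false) (og y).
Proof. by move=> iy; apply: connect1; rewrite /= /rot palpha_star // pphi_from_star. Qed.

Lemma rot_vertex y z : vx y = vx z -> fconnect rot (og y) (og z).
Proof.
move=> e; have: y \in vx z by rewrite -e; exact: mem_vertex.
apply: (porbit_ind (P := fun y => fconnect rot (og y) (og z))) => [|x]; first exact: connect0.
exact: connect_trans (rot_sigma x).
Qed.

Lemma rot_star y z : inn z -> fc y = fc z -> fconnect rot (star y true) (star z true).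
Proof.
move=> iz e; have: y \in fc z by rewrite -e; exact: mem_face.
move=> yz; suff : inn y /\ fconnect rot (star y true) (star z true) by case.
apply: (porbit_ind (P := fun y => inn y /\ fconnect rot (star y true) (star z true))) yz.
  by split=> //; exact: connect0.
move=> x [ix xz]; split; first by rewrite inner_phi.
apply: connect_trans xz; apply: connect1.
by rewrite /= /rot palpha_star ?inner_phi // pphi_to_star ?inner_phi // permK.
Qed.

Lemma ptail_rot x : ptail (rot x) = ptail x.
Proof.
rewrite /rot; case: (pdP x) => [y|y [] iy].
- rewrite palpha_orig; case: (boolP (inn (alpha y))) => iy.
    by rewrite pphi_orig // ptail_to_star ?inner_phi // vertex_phi alphaK.
  by rewrite pphi_outer // /ptail /= vertex_phi alphaK.
- by rewrite palpha_star // pphi_to_star // !ptail_from_star ?inner_phiV // face_phiV.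
- by rewrite palpha_star // pphi_from_star // ptail_to_star.
Qed.

Lemma ptail_eq (x y : G) : (ptail x == ptail y) = fconnect rot x y.
Proof.
apply/eqP/idP => [|xy]; last first.
  by apply/esym; apply: (fconnect_ind (P := fun y => ptail y = ptail x)) xy => // z; rewrite ptail_rot.
have rep z : (exists y, [/\ ptail z = inl (vx y), fconnect rot z (og y) & fconnect rot (og y) z])
   \/ (exists y, [/\ inn y, ptail z = inr (fc y) & z = star y true]).
  case: (pdP z) => [u|u [] iu]; [left|right|left]; exists u; split=> //.
  - exact: ptail_from_star.
  - by rewrite ptail_to_star.
  - exact: rot_to_star.
  - by rewrite fconnect_sym //; exact: rot_to_star.
case: (rep x) => [[a [-> xa _]]|[a [ia -> ->]]]; case: (rep y) => [[b [-> _ yb]]|[b [ib -> ->]]] //.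
  by move=> -[e]; apply: connect_trans xa (connect_trans _ yb); exact: rot_vertex.
by move=> -[e]; exact: rot_star.
Qed.

Lemma pleft_pphi x : pleft (pphi x) = pleft x.
Proof.
case: (pdP x) => [y|y [] iy].
- case: (boolP (inn y)) => iy.
    by rewrite pphi_orig // pleft_to_star ?inner_phi // permK pleft_orig iy.
  by rewrite pphi_outer // !pleft_orig inner_phi (negPf iy).
- by rewrite pphi_from_star // pleft_orig iy pleft_from_star.
- by rewrite pphi_to_star // pleft_from_star ?inner_phiV // pleft_to_star.
Qed.

Lemma pleft_eq (x y : G) : (pleft x == pleft y) = fconnect (@pphi D alpha sigma r) x y.
Proof.
apply/eqP/idP => [|xy]; last first.
  by apply/esym; apply: (fconnect_ind (P := fun y => pleft y = pleft x)) xy => // z; rewrite pleft_pphi.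
have rep z : exists y, [/\ pleft z = pleft (og y), fconnect (@pphi D alpha sigma r) z (og y)
    & fconnect (@pphi D alpha sigma r) (og y) z].
  have H u v : fconnect (@pphi D alpha sigma r) u (og v) -> exists y, [/\ pleft u = pleft (og y),
      fconnect (@pphi D alpha sigma r) u (og y) & fconnect (@pphi D alpha sigma r) (og y) u].
    move=> uv; exists v; split=> //; last by rewrite (fconnect_sym pphi_inj).
    apply: (fconnect_ind (P := fun w => pleft u = pleft w)) uv => // w ->.
    by rewrite pleft_pphi.
  case: (pdP z) => [u|u [] iu].
  - by apply: (H _ u); exact: connect0.
  - by apply: (H _ u); apply: connect1; rewrite /= pphi_from_star.
  - apply: (H _ ((ph^-1)%g u)); apply: connect_trans (fconnect1 _ _) _.
    by rewrite pphi_to_star //; apply: connect1; rewrite /= pphi_from_star // inner_phiV.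
have [a [-> xa _]] := rep x; have [b [-> _ yb]] := rep y.
rewrite !pleft_orig => e; apply: connect_trans xa (connect_trans _ yb).
case: ifP e => ia; case: ifP => ib //; first by move=> [->]; exact: connect0.
move=> _; have : b \in fc a.
  by move: ia ib; rewrite !innerE => /negbFE/eqP e1 /negbFE/eqP e2; apply: face_mem; rewrite e1.
move=> ba; suff [] : ~~ inn b /\ fconnect (@pphi D alpha sigma r) (og a) (og b) by [].
apply: (porbit_ind (P := fun b => ~~ inn b /\ _)) ba => [|w [iw aw]].
  by split; [rewrite ia|exact: connect0].
split; first by rewrite inner_phi.
by apply: connect_trans aw (connect1 _); rewrite /= pphi_outer.
Qed.

Lemma pd_conn (x y : G) : connect [rel a b | (b == pphi a) || (b == palpha a)] x y.
Proof.
set K := [rel a b | _].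
have Kph a b : fconnect (@pphi D alpha sigma r) a b -> connect K a b.
  by apply: connect_sub => u v /= /eqP <-; apply: connect1; rewrite /= eqxx.
have Kal a : connect K a (palpha a) by apply: connect1; rewrite /= eqxx orbT.
have Krot a b : fconnect rot a b -> connect K a b.
  apply: connect_sub => u v /= /eqP <-; apply: connect_trans (Kal _) _.
  by apply: connect1; rewrite /= eqxx.
have to_og z : exists u, connect K z (og u) /\ connect K (og u) z.
  case: (pdP z) => [u|u [] iu]; exists u; split; try exact: connect0.
  - by apply: Kph; apply: connect1; rewrite /= pphi_from_star.
  - apply: Kph; rewrite (fconnect_sym pphi_inj); apply: connect1.
    by rewrite /= pphi_from_star.
  - by apply: Krot; exact: rot_to_star.
  - by apply: Krot; rewrite (fconnect_sym rot_inj); exact: rot_to_star.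
have [a [xa _]] := to_og x; have [b [_ yb]] := to_og y.
apply: connect_trans xa (connect_trans _ yb).
have [_ _ /(_ a b)/connectP[p pP ->] _] := PM.
elim: p a pP => [|c p IH] a /=; first by rewrite connect0.
move=> /andP[ac /IH]; apply: connect_trans.
case/orP: ac => /eqP->; last by rewrite -palpha_orig.
by apply: Krot; rewrite (fconnect_sym rot_inj); exact: rot_sigma.
Qed.

Lemma card_pd : #|{: G}| = #|D| + 2 * #|[set y | inn y]|.
Proof.
rewrite card_sub -[LHS]sum1_card big_sumType /= sum1_card; congr (_ + _).
rewrite sum1_card mulnC -card_bool -(cardsT bool) -cardsX.
by apply: eq_card => -[y b]; rewrite !inE andbT.
Qed.

Lemma card_edges : #|D| = 2 * #|porbits alpha|.
Proof.
rewrite -cardsT (@card_uniform_partition _ 2 (porbits alpha)) 1?mulnC //.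
  move=> _ /imsetP[y _ ->]; rewrite (_ : porbit alpha y = [set y; alpha y]).
    by rewrite cards2 eq_sym alpha_neq.
  apply/setP => z; rewrite !inE; apply/idP/orP => [|[]/eqP->].
  - apply: (porbit_ind (P := fun z => _ \/ _)) => [|x [] /eqP->]; first by left.
      by right.
    by left; rewrite alphaK.
  - exact: porbit_id.
  - exact: (mem_porbit alpha 1).
apply/and3P; split.
- apply/eqP/setP => y; rewrite inE; apply/bigcupP; exists (porbit alpha y).
    exact: imset_f.
  exact: porbit_id.
- apply/trivIsetP => _ _ /imsetP[x _ ->] /imsetP[y _ ->] ne.
  rewrite -setI_eq0; apply/eqP/setP => z; rewrite !inE; apply: contraNF ne.
  by rewrite -!eq_porbit_mem => /andP[/eqP <- /eqP <-].
- by apply/imsetP => -[y _ e]; have := porbit_id alpha y; rewrite -e inE.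
Qed.

(** All faces of [G] but the outer one become vertices, the outer face remains, and each inner dart
    creates one triangle and two star darts, adding 2 to both sides of the doubled Euler formula. *)
Lemma angular_map_plane :
  plane_darts (@palpha D alpha sigma r) (@pphi D alpha sigma r) (@ptail D alpha sigma r) pleft.
Proof.
split; [exact: palphaK|exact: palpha_neq|exact: pphi_inj|exact: ptail_eq|exact: pleft_eq|exact: pd_conn|].
have -> : #|@ptail D alpha sigma r @: [set: G]| = #|porbits sigma| + (#|porbits ph|.-1).
  have -> : @ptail D alpha sigma r @: [set: G] =
      (@inl {set D} {set D} @: porbits sigma) :|: (@inr {set D} {set D} @: (porbits ph :\ fc r)).
    apply/setP => v; rewrite inE; apply/imsetP/orP => [[x _ ->]|].
      case: (pdP x) => [y|y [] iy].
      - by left; rewrite ptail_orig; do 2 apply: imset_f.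
      - right; rewrite ptail_from_star //; apply: imset_f.
        by rewrite inE in_set1 -innerE iy; exact: imset_f.
      - by left; rewrite ptail_to_star //; do 2 apply: imset_f.
    case=> /imsetP[X XP ->]; first by have /imsetP[y _ ->] := XP; exists (og y).
    move: XP; rewrite !inE => /andP[ne /imsetP[y _ eX]]; exists (star y true) => //.
    by rewrite ptail_from_star ?eX // innerE; move: ne; rewrite eX.
  rewrite cardsU disjoint_setI0 ?cards0 ?subn0.
    rewrite (card_imset (mem (porbits sigma)) (@inl_inj _ _)) (card_imset _ (@inr_inj _ _)).
    by rewrite (cardsD1 (fc r) (porbits ph)) imset_f.
  by rewrite -setI_eq0; apply/eqP/setP => i; rewrite !inE; apply/negP => /andP[/imsetP[v _ ->] /imsetP[]].
have -> : #|pleft @: [set: G]| = #|[set y | inn y]| + 1.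
  have -> : pleft @: [set: G] = None |: (Some @: [set y | inn y]).
    apply/setP => v; rewrite in_setU1; apply/imsetP/orP => [[x _ ->]|].
      case: (pdP x) => [y|y [] iy].
      - rewrite pleft_orig; case: ifP => iy; [right|by left]; apply: imset_f; by rewrite inE.
      - by right; rewrite pleft_from_star //; apply: imset_f; rewrite inE.
      - by right; rewrite pleft_to_star //; apply: imset_f; rewrite inE inner_phiV.
    case=> [/eqP->|/imsetP[y]]; first by exists (og r); rewrite // pleft_orig innerE eqxx.
    by rewrite inE => iy ->; exists (og y); rewrite // pleft_orig iy.
  rewrite cardsU1 card_imset; last by move=> ? ? [].
  rewrite addnC; congr (_ + _); rewrite (_ : None \notin _) //.
  by apply/imsetP => -[].
have [_ _ _ e] := PM; rewrite card_pd card_edges.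
have : 0 < #|porbits ph| by rewrite card_gt0; apply/set0Pn; exists (fc r); apply: imset_f.
lia.
Qed.

End AngularMap.

(** * Weight counts *)

Section Counting.
Variables (D : finType) (alpha sigma : {perm D}) (r : D).
Hypothesis PM : plane_map alpha sigma.

Local Notation ph := (phi alpha sigma).
Local Notation fc := (face alpha sigma).
Local Notation vx := (vertex sigma).
Local Notation inn := (inner alpha sigma r).
Local Notation dg := (deg alpha sigma).
Local Notation og := (orig alpha sigma r).
Local Notation star := (@star D alpha sigma r).
Local Notation G := (PD alpha sigma r).
Local Notation pext := (@pexterior D alpha sigma r).
Implicit Types (s : seq G) (w : {ffun G -> nat}) (x : G) (y z : D).

Let M := angular_map_plane r PM.

Lemma big_pd (P : pred G) (F : G -> nat) :
  \sum_(x | P x) F x = \sum_(y | P (og y)) F (og y) +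
    (\sum_(y | inn y && P (star y true)) F (star y true) +
     \sum_(y | inn y && P (star y false)) F (star y false)).
Proof.
pose og' (u : D + D * bool) : G := insubd (og r) u.
have val_og' u : pvalid alpha sigma r u -> val (og' u) = u.
  by move=> pu; rewrite val_insubd pu.
rewrite (reindex_onto og' val); last first.
  by move=> x _; apply: val_inj; rewrite val_og' // (valP x).
rewrite big_sumType /=; congr (_ + _).
  have e y : og' (inl y) = og y by apply: val_inj; rewrite val_og'.
  by apply: eq_big => y; rewrite !e ?eqxx ?andbT.
transitivity (\sum_(y | inn y) \sum_(b | P (star y b)) F (star y b)).
  rewrite pair_big_dep /=; apply: eq_big => -[y b] //=.
  rewrite [P _ && _]andbC; case: (boolP (inn y)) => iy.
    by rewrite val_og' //= eqxx.
  rewrite /og' val_insubd /= (negPf iy); apply/negbTE; rewrite negb_and.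
  by rewrite (_ : (_ == _) = false).
rewrite (eq_bigr (fun y => (if P (star y true) then F (star y true) else 0) +
     (if P (star y false) then F (star y false) else 0))) => [|y _].
  by rewrite big_split /= -!big_mkcondr.
by rewrite big_mkcond /= big_bool.
Qed.

Lemma pext_ph s x : pext s (pphi x) = pext s x.
Proof. exact: (ext_ph M). Qed.

Lemma pext_og_outer s y : ~~ inn y -> pext s (og y).
Proof.
move=> iy; suff -> : pext s (og y) = pext s (og r) by exact: connect0.
by apply: (ext_left M); rewrite !pleft_orig (negPf iy) innerE eqxx.
Qed.

Lemma pint_inner s y : ~~ pext s (og y) -> inn y.
Proof. by apply: contraR; exact: pext_og_outer. Qed.

Lemma pext_from_star s y : inn y -> pext s (star y true) = pext s (og y).
Proof. by move=> iy; rewrite -(pphi_from_star iy) pext_ph. Qed.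

Lemma pext_to_star s y : inn y -> pext s (star y false) = pext s (og ((ph^-1)%g y)).
Proof. by move=> iy; rewrite -pext_from_star ?inner_phiV // -(pphi_to_star iy) pext_ph. Qed.

Lemma ccwP s : ccw s <-> forall x, x \in s -> ~~ pext s x.
Proof. by split=> [/allP|h]; [|apply/allP]. Qed.

Lemma pext_right s x : pcycle s -> ccw s -> x \in s -> pext s (palpha x).
Proof. by move=> sP /ccwP sC; exact: (ccw_right M). Qed.

Lemma pcycle_mem s x : pcycle s -> ccw s ->
  (x \in s) = ~~ pext s x && pext s (palpha x).
Proof. by move=> sP /ccwP sC; exact: (ccw_mem M). Qed.

Lemma pext_vertex s x x' : pcycle s -> ptail x \notin map (@ptail D alpha sigma r) s ->
  ptail x = ptail x' -> pext s x = pext s x'.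
Proof. by move=> sP nx e; exact: (ext_vertex M (og r) sP nx e). Qed.

Lemma pext_edge s x : pcycle s -> ptail x \notin map (@ptail D alpha sigma r) s ->
  pext s (palpha x) = pext s x.
Proof. by move=> sP nx; exact: (ext_edge M (og r) sP nx). Qed.

Lemma outer_vertexP y :
  reflect (exists2 z, ~~ inn z & vx z = vx y) (outer_vertex alpha sigma r (vx y)).
Proof.
by apply: (iffP imsetP) => -[z zo e]; exists z; rewrite ?e // /inner negbK in zo *.
Qed.

Lemma outer_dart_vertex y : outer_edge_dart alpha sigma r y -> outer_vertex alpha sigma r (vx y).
Proof.
move=> /orP[yo|yo]; apply/outer_vertexP; first by exists y; rewrite // /inner negbK.
exists (ph (alpha y)); first by rewrite inner_phi /inner negbK.
by rewrite vertex_phi // (alphaK PM).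
Qed.

Section GSWeights.
Variables (d : nat) (w : {ffun G -> nat}).
Hypothesis wGS : GS d w.

Lemma GS_star y b : inn y -> w (star y b) + w (star y (~~ b)) + dg y = d.
Proof. by case: wGS => _ _ h _ _ iy; rewrite -(h _ _ _ (val_star b iy)) palpha_star. Qed.

Lemma GS_orig y : inn y -> inn (alpha y) ->
  w (og y) + w (og (alpha y)) + d + 2 = dg y + dg (alpha y).
Proof.
case: wGS => _ _ _ _ h iy iay; apply: h.
by rewrite /outer_edge_dart negb_or; apply/andP.
Qed.

(** The outgoing weight of a star vertex falls short of [d] by the degree of its face, that is, by
    the number of darts of this face. *)
Lemma sum_outw (U : {set {set D} + {set D}}) : U \subset @ptail D alpha sigma r @: [set: G] ->
  (forall y, inl (vx y) \in U -> ~~ outer_vertex alpha sigma r (vx y)) ->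
  \sum_(v in U) outw w v + #|[set y | inn y && (inr (fc y) \in U)]| = d * #|U|.
Proof.
move=> Usub Uo.
have -> : #|[set y | inn y && (inr (fc y) \in U)]| =
    \sum_(v in U) #|[set y | inn y && (inr (fc y) == v)]|.
  rewrite -sum1_card (partition_big (fun y => inr (fc y)) (mem U)) /=.
    apply: eq_bigr => v vU; rewrite -[RHS]sum1_card; apply: eq_bigl => y.
    rewrite !in_set; case: (inn y) => //=; case: eqP => [->|]; rewrite ?andbF //.
    by rewrite [_ \in U]vU.
  by move=> y; rewrite inE => /andP[].
rewrite -big_split /= mulnC -sum_nat_const; apply: eq_bigr => v vU.
have [_ h1 _ h2 _] := wGS.
have /imsetP[x _ ex] := subsetP Usub v vU.
rewrite {}ex in vU *; case: (pdP x) vU => [y|y [] iy].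
- rewrite ptail_orig => vU; rewrite h2 ?Uo // [X in _ + X](_ : _ = 0) ?addn0 //.
  by apply/eqP; rewrite cards_eq0; apply/eqP/setP => z; rewrite !inE andbF.
- rewrite ptail_from_star // => vU; rewrite -(h1 y iy); congr (_ + _).
  apply: eq_card => z; rewrite !inE /face -eq_porbit_mem.
  apply/andP/idP => [[_ /eqP[->]] //|e]; split; last by rewrite (eqP e).
  by rewrite (inner_face r (eqP e)).
- rewrite ptail_to_star // => vU; rewrite h2 ?Uo // [X in _ + X](_ : _ = 0) ?addn0 //.
  by apply/eqP; rewrite cards_eq0; apply/eqP/setP => z; rewrite !inE andbF.
Qed.

(** Reindexing by reversal pairs every arc with its opposite, and (A1) and (A2) evaluate each pair.
    The identity is doubled, and negative terms change sides to stay in [nat]. *)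
Lemma sum_edge_weights (E : {set G}) (Mt Pt : {set D}) :
  (forall x, (palpha x \in E) = (x \in E)) ->
  (forall y, (og y \in E) = (y \in Mt)) ->
  (forall y b, inn y -> (star y b \in E) = (y \in Pt)) ->
  {subset Mt <= inn} -> {subset Pt <= inn} ->
  #|E| = #|Mt| + 2 * #|Pt| /\
  2 * (\sum_(x in E) w x) + (d + 2) * #|Mt| + 2 * \sum_(y in Pt) dg y =
  2 * (\sum_(y in Mt) dg y) + 2 * (d * #|Pt|).
Proof.
move=> Eal EM EP Minn Pinn.
have sum_E (F : G -> nat) : \sum_(x in E) F x =
    \sum_(y in Mt) F (og y) + (\sum_(y in Pt) F (star y true) + \sum_(y in Pt) F (star y false)).
  have bP b y : inn y && (star y b \in E) = (y \in Pt).
    case: (boolP (inn y)) => iy /=; first exact: EP.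
    by apply/esym/negbTE; apply: contra iy => /Pinn.
  by rewrite big_pd; congr (_ + (_ + _)); apply: eq_bigl => y.
split; first by rewrite -sum1_card sum_E !sum1_card; lia.
have pal_inj : injective (@palpha D alpha sigma r) by apply: inv_inj; exact: (palphaK PM).
have al_inj : injective alpha by exact: perm_inj.
have Mal y : (alpha y \in Mt) = (y \in Mt) by rewrite -!EM -palpha_orig Eal.
have e1 : \sum_(x in E) w x = \sum_(x in E) w (palpha x).
  by rewrite (reindex_inj pal_inj) /=; apply: eq_bigl => x.
have e2 : \sum_(y in Mt) dg y = \sum_(y in Mt) dg (alpha y).
  by rewrite (reindex_inj al_inj) /=; apply: eq_bigl => y.
have -> : 2 * (\sum_(x in E) w x) = \sum_(x in E) (w x + w (palpha x)).
  by rewrite big_split /= -e1 mul2n addnn.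
have -> : 2 * (\sum_(y in Mt) dg y) = \sum_(y in Mt) (dg y + dg (alpha y)).
  by rewrite big_split /= -e2 mul2n addnn.
rewrite sum_E.
have h1 : \sum_(y in Mt) (w (og y) + w (palpha (og y))) + (d + 2) * #|Mt| =
    \sum_(y in Mt) (dg y + dg (alpha y)).
  rewrite mulnC -sum_nat_const -big_split /=; apply: eq_bigr => y yM.
  have iy := Minn _ yM; have iay : inn (alpha y) by apply: Minn; rewrite Mal.
  by rewrite palpha_orig -(GS_orig iy iay); lia.
have h2 b : \sum_(y in Pt) (w (star y b) + w (palpha (star y b))) + \sum_(y in Pt) dg y = d * #|Pt|.
  rewrite mulnC -sum_nat_const -big_split /=; apply: eq_bigr => y /Pinn iy.
  by rewrite palpha_star // GS_star.
have := h2 true; have := h2 false; lia.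
Qed.
End GSWeights.

Section Cycle.
Variable s : seq G.
Hypothesis sP : pcycle s.
Hypothesis sC : ccw s.

(* tris is the set of triangles inside the cycle; the original edges of tris_orig and
   tris_rest together make up its enclosing cycle. *)
Definition tris := [set y | ~~ pext s (og y)].
Definition tris_orig := [set y | og y \in s].
Definition tris_rest := [set y | [&& inn y, inr (fc y) \in map (@ptail D alpha sigma r) s & pext s (og y)]].
Definition cycle_stars := [set y | inn y && (inr (fc y) \in map (@ptail D alpha sigma r) s)].

(** The star edge at the corner of [y] separates the triangles of [y] and of [ph^-1 y]. Hence [Mt]
    and [Pt] describe the original and the star edges strictly inside [s], [Bt] the corners through
    which [s] leaves a star vertex, and [St] the darts of the faces whose star vertex is strictly
    inside. *)
Let Mt := [set y | (y \in tris) && (alpha y \in tris)].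
Let Pt := [set y | (y \in tris) && ((ph^-1)%g y \in tris)].
Let Bt := [set y | (y \in tris) && ((ph^-1)%g y \notin tris)].
Let E := int_edges (@palpha D alpha sigma r) (@pphi D alpha sigma r) (og r) s.
Let VI := int_vertices (@palpha D alpha sigma r) (@pphi D alpha sigma r) (@ptail D alpha sigma r) (og r) s.
Let St := [set y | inn y && (inr (fc y) \in VI)].

Lemma tris_inner y : y \in tris -> inn y.
Proof. by rewrite inE; exact: pint_inner. Qed.

Lemma tris_origE : tris_orig = [set y | (y \in tris) && (alpha y \notin tris)].
Proof.
by apply/setP => y; rewrite !inE pcycle_mem // palpha_orig negbK.
Qed.

Lemma mem_E x : (x \in E) = ~~ pext s x && ~~ pext s (palpha x).
Proof. by rewrite inE. Qed.

Lemma E_og y : (og y \in E) = (y \in Mt).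
Proof. by rewrite mem_E !inE palpha_orig. Qed.

Lemma E_star y b : inn y -> (star y b \in E) = (y \in Pt).
Proof.
move=> iy; rewrite mem_E palpha_star //; case: b => /=.
  by rewrite pext_from_star // pext_to_star // !inE.
by rewrite pext_from_star // pext_to_star // !inE andbC.
Qed.

Lemma VI_mem x : (ptail x \in VI) = (ptail x \notin map (@ptail D alpha sigma r) s) && ~~ pext s x.
Proof.
rewrite inE (tails_set (@ptail D alpha sigma r)); case: (boolP (_ \in map _ s)) => //= nx.
apply/imsetP/idP => [[x']|ex]; last by exists x => //; rewrite inE.
by rewrite inE => ex' /(pext_vertex sP nx) ->.
Qed.

Lemma int_euler_tris : 2 * (#|VI| + #|tris|) = #|Mt| + 2 * #|Pt| + 2.
Proof.
have h : 2 * (#|VI| + #|int_faces (@palpha D alpha sigma r) (@pphi D alpha sigma r) (@pleft D alpha sigma r) (og r) s|) = #|E| + 2.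
  by apply: (int_euler M sP); apply/ccwP.
have cE : #|E| = #|Mt| + 2 * #|Pt|.
  have bP b y : inn y && (star y b \in E) = (y \in Pt).
    case: (boolP (inn y)) => iy /=; first exact: E_star.
    by apply/esym/negbTE; apply: contra iy; rewrite inE => /andP[/tris_inner].
  rewrite -sum1_card big_pd (eq_bigl _ _ E_og) (eq_bigl _ _ (bP true)) (eq_bigl _ _ (bP false)).
  by rewrite !sum1_card; lia.
rewrite -cE -h; congr (2 * (_ + _)).
rewrite -(@card_imset _ _ (@Some D)); last by move=> ? ? [].
apply: eq_card => f.
apply/imsetP/imsetP => -[].
  move=> y yT ->; exists (og y); first by rewrite inE; rewrite inE in yT.
  by rewrite pleft_orig (tris_inner yT).
move=> x; rewrite inE => ex ->; case: (pdP x) ex => [y|y [] iy] ex.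
- by exists y; rewrite ?inE // pleft_orig (pint_inner ex).
- by exists y; rewrite ?pleft_from_star // inE -pext_from_star.
- by exists ((ph^-1)%g y); rewrite ?pleft_to_star // inE -pext_to_star.
Qed.

(** A simple cycle leaves each of its star vertices through exactly one dart [star y true], so every
    face with its star vertex on [s] is counted once, with its degree. *)
Lemma sum_Bt : \sum_(y in Bt) dg y = #|cycle_stars|.
Proof.
have BtE y : (y \in Bt) = inn y && (star y true \in s).
  case: (boolP (inn y)) => iy /=; last first.
    by apply/negbTE; apply: contra iy; rewrite inE => /andP[/tris_inner].
  by rewrite !inE pcycle_mem // palpha_star //= pext_from_star // pext_to_star // negbK.
have Bt_uniq y z : y \in Bt -> z \in Bt -> fc y = fc z -> y = z.
  rewrite !BtE => /andP[iy ys] /andP[iz zs] e.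
  have := cycle_tail_inj sP ys zs; rewrite !ptail_from_star // e => /(_ erefl).
  by move=> /star_inj[].
transitivity (\sum_(y in Bt) \sum_(z | fc z == fc y) 1).
  apply: eq_bigr => y _; rewrite -[LHS]sum1_card; apply: eq_bigl => z.
  by rewrite /face -eq_porbit_mem.
rewrite (exchange_big_dep predT) //= -sum1_card [RHS]big_mkcond /=; apply: eq_bigr => z _.
case: (boolP (z \in cycle_stars)) => [|nz].
  rewrite inE => /andP[iz /mapP[x xs e]].
  have [y [iy ys fy]] : exists y, [/\ inn y, star y true \in s & fc y = fc z].
    case: (pdP x) e xs => [y|y [] iy]; rewrite ?ptail_orig ?ptail_from_star ?ptail_to_star //.
    by move=> -[e] xs; exists y.
  rewrite (big_pred1 y) // => u; apply/andP/eqP => [[uB /eqP e']|->].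
    by apply: Bt_uniq => //; [rewrite BtE iy|rewrite -e' fy].
  by rewrite BtE iy ys fy.
rewrite big_pred0 // => y; apply: contraNF nz => /andP[]; rewrite BtE => /andP[iy ys] /eqP e.
by rewrite inE (inner_face r e) iy e -(ptail_from_star iy) map_f.
Qed.

(** Both sides count the triangles whose star vertex is on [s] or strictly inside it: by position of
    that vertex on the left, by position of the triangle on the right. *)
Lemma St_rest : #|cycle_stars| + #|St| = #|tris| + #|tris_rest|.
Proof.
have StE z : (z \in St) = [&& inn z, inr (fc z) \notin map (@ptail D alpha sigma r) s & ~~ pext s (og z)].
  rewrite inE; case: (boolP (inn z)) => //= iz.
  by rewrite -(ptail_from_star iz) VI_mem pext_from_star.
have cI (A B : {set D}) : A :&: B = set0 -> #|A| + #|B| = #|A :|: B|.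
  by move=> e; rewrite -cardsUI e cards0 addn0.
rewrite !cI.
- apply: eq_card => z; rewrite !in_setU StE !inE.
  case: (boolP (inn z)) => iz /=; last by rewrite pext_og_outer.
  rewrite -(ptail_from_star iz); case: (boolP (_ \in map _ s)) => //= nz.
    by case: (pext s _).
  by rewrite orbF.
- by apply/setP => z; rewrite !inE; case: (pext s _); rewrite ?andbF.
- by apply/setP => z; rewrite in_setI StE !inE; case: (_ \in map _ s); rewrite /= ?andbF.
Qed.

Variables (d : nat) (w : {ffun G -> nat}).
Hypothesis wGS : GS d w.
Hypothesis deg_le : forall y, inn y -> dg y <= d.

Definition out_weight := \sum_(x | [&& ~~ pext s x, ~~ pext s (palpha x) &
  ptail x \in map (@ptail D alpha sigma r) s]) w x.

Lemma sum_VI : \sum_(v in VI) outw w v + #|St| = d * #|VI|.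
Proof.
apply: (sum_outw wGS) => [|y].
  by apply/subsetP => v /setDP[/imsetP[x _ ->] _]; exact: imset_f.
rewrite -(ptail_orig alpha sigma r) VI_mem => /andP[nx ey].
apply: contra ey => /outer_vertexP[z iz e].
by rewrite (pext_vertex (x' := og z) sP nx) ?pext_og_outer // !ptail_orig e.
Qed.

Lemma sum_E_split : \sum_(x in E) w x = out_weight + \sum_(v in VI) outw w v.
Proof.
rewrite (bigID (fun x => ptail x \in map (@ptail D alpha sigma r) s)) /=; congr (_ + _).
  by apply: eq_bigl => x; rewrite mem_E -andbA.
rewrite (partition_big (@ptail D alpha sigma r) (mem VI)) /=.
  apply: eq_bigr => v vVI; apply: eq_bigl => x.
  case: eqP => [e|]; rewrite ?andbF // andbT.
  move: vVI; rewrite -e VI_mem mem_E => /andP[nx ex].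
  by rewrite (pext_edge sP nx) nx ex.
by move=> x /andP[]; rewrite mem_E VI_mem => /andP[-> _] ->.
Qed.

Lemma sum_E_weights : 2 * (\sum_(x in E) w x) + (d + 2) * #|Mt| + 2 * \sum_(y in Pt) dg y =
  2 * (\sum_(y in Mt) dg y) + 2 * (d * #|Pt|).
Proof.
apply: (sum_edge_weights wGS (E := E) _ E_og E_star _ _).2.
- by move=> x; rewrite /E (int_edges_al M).
- by move=> y; rewrite inE => /andP[/tris_inner].
- by move=> y; rewrite inE => /andP[/tris_inner].
Qed.

(** The weight of the arcs strictly inside is counted by edges in [sum_E_weights] and by tails in
    [sum_E_split]. Interior vertices all emit [d], except that star vertices lack [#|St|] in total;
    [int_euler_tris] multiplied by [d] eliminates their number. *)
Theorem out_weightE : out_weight + d =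
  \sum_(y in tris_orig) (d - dg y) + #|tris_orig| + #|tris_rest|.
Proof.
have splitT (A B : {set D}) : A :&: B = set0 -> A :|: B = tris ->
    \sum_(y in A) dg y + \sum_(y in B) dg y = \sum_(y in tris) dg y /\ #|A| + #|B| = #|tris|.
  move=> e <-; split; last by rewrite -cardsUI e cards0 addn0.
  rewrite -bigU ?(eq_bigl _ _ (in_setU^~ A B)) //=; last by rewrite -setI_eq0 e.
  by apply: eq_bigl => y; rewrite !inE.
have [m1 m2] : \sum_(y in Mt) dg y + \sum_(y in tris_orig) dg y = \sum_(y in tris) dg y /\
    #|Mt| + #|tris_orig| = #|tris|.
  apply: splitT; rewrite tris_origE; apply/setP => y; rewrite !inE;
    by case: (pext s (og y)); case: (pext s _).
have [p1 p2] : \sum_(y in Pt) dg y + \sum_(y in Bt) dg y = \sum_(y in tris) dg y /\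
    #|Pt| + #|Bt| = #|tris|.
  by apply: splitT; apply/setP => y; rewrite !inE; case: (pext s (og y)); case: (pext s _).
have ha : \sum_(y in tris_orig) (d - dg y) + \sum_(y in tris_orig) dg y = d * #|tris_orig|.
  rewrite mulnC -sum_nat_const -big_split /=; apply: eq_bigr => y.
  by rewrite tris_origE inE => /andP[/tris_inner/deg_le h _]; rewrite subnK.
have h5 := congr1 (muln d) int_euler_tris.
have dm : d * #|Mt| + d * #|tris_orig| = d * #|tris| by rewrite -mulnDr m2.
move: sum_E_weights sum_E_split sum_VI sum_Bt St_rest.
move: h5 p1 p2 m1 m2 ha dm.
set a1 := \sum_(y in Pt) _; set a2 := \sum_(y in Mt) _; set a3 := \sum_(y in tris) _; set a4 := \sum_(y in Bt) _.
set a5 := \sum_(v in VI) _; set a6 := \sum_(x in E) _; set a7 := \sum_(y in tris_orig) dg y; set a8 := \sum_(y in tris_orig) _.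
nia.
Qed.

End Cycle.
End Counting.

(** * Weight emitted by a set of vertices with connected complement *)

Section FlowOut.
Variables (D : finType) (alpha sigma : {perm D}) (r : D).
Hypothesis PM : plane_map alpha sigma.

Local Notation ph := (phi alpha sigma).
Local Notation fc := (face alpha sigma).
Local Notation vx := (vertex sigma).
Local Notation inn := (inner alpha sigma r).
Local Notation dg := (deg alpha sigma).
Local Notation og := (orig alpha sigma r).
Local Notation star := (@star D alpha sigma r).
Local Notation G := (PD alpha sigma r).
Local Notation pext := (@pexterior D alpha sigma r).
Local Notation tl := (@ptail D alpha sigma r).
Local Notation pal := (@palpha D alpha sigma r).
Local Notation ov := (outer_vertex alpha sigma r).
Implicit Types (s : seq G) (x : G) (y z : D).

Let M := angular_map_plane r PM.

Variables (d : nat) (w : {ffun G -> nat}).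
Hypothesis wGS : GS d w.
Hypothesis deg_le : forall y, inn y -> dg y <= d.

Lemma sum_le_card (A : {set D}) : {subset A <= inn} -> \sum_(y in A) dg y <= d * #|A|.
Proof.
move=> Ainn; rewrite mulnC -sum_nat_const; apply: leq_sum => y /Ainn; exact: deg_le.
Qed.

(** The weight entering [Y] is the total emitted off [Y] minus the weight of the arcs staying off
    [Y], and [coconnected_euler] limits the number of these arcs. The last hypothesis excludes a
    star vertex off [Y] with all its neighbours in [Y], which would emit only [d] minus the degree
    of its face. *)
Lemma flow_out_bound (Y : {set {set D} + {set D}}) (r0 x0 : G) :
  Y \subset tl @: [set: G] -> tl r0 \in Y -> tl x0 \notin Y ->
  (forall P : pred ({set D} + {set D}), P (tl r0) ->
     (forall x, tl x \in Y -> tl (pal x) \in Y -> P (tl x) -> P (tl (pal x))) ->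
     forall v, v \in Y -> P v) ->
  (forall y, ov (vx y) -> inl (vx y) \in Y) ->
  (forall y, inn y -> inr (fc y) \notin Y ->
     exists2 z, fc z = fc y & inl (vx z) \notin Y) ->
  d <= \sum_(x | (tl x \notin Y) && (tl (pal x) \in Y)) w x.
Proof.
move=> Ysub r0Y x0Y Yconn Yout Ystar; set Om := \sum_(x | _) w x.
pose E := [set x | (tl x \notin Y) && (tl (pal x) \notin Y)].
pose S := [set y | inn y && (inr (fc y) \notin Y)].
(* [K] consists of the corners whose star edge avoids [Y], and [Tt] of the triangles whose three
   vertices all avoid [Y]. *)
pose K := [set y | (y \in S) && (inl (vx y) \notin Y)].
pose Mt := [set y | (inl (vx y) \notin Y) && (inl (vx (alpha y)) \notin Y)].
pose Tt := [set y | (y \in K) && (y \in Mt)].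
have Minn y : y \in Mt -> inn y.
  rewrite inE => /andP[n1 _]; apply: contraR n1 => iy; apply: Yout.
  by apply: outer_dart_vertex; rewrite // /outer_edge_dart -[_ \in _]negbK -/(inn y) iy.
have Kinn y : y \in K -> inn y by rewrite !inE => /andP[/andP[]].
have [cE wE] : #|E| = #|Mt| + 2 * #|K| /\
    2 * (\sum_(x in E) w x) + (d + 2) * #|Mt| + 2 * \sum_(y in K) dg y =
    2 * (\sum_(y in Mt) dg y) + 2 * (d * #|K|).
  apply: (sum_edge_weights PM wGS) => //.
  - by move=> x; rewrite !inE (palphaK PM) andbC.
  - by move=> y; rewrite !inE palpha_orig.
  - move=> y b iy; rewrite !inE palpha_star // iy /=.
    by case: b; rewrite /= !ptail_from_star // !ptail_to_star // andbC.
pose U := tl @: [set: G] :\: Y.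
have wU : \sum_(v in U) outw w v + #|S| = d * #|U|.
  have -> : S = [set y | inn y && (inr (fc y) \in U)].
    apply/setP => y; rewrite !inE; case: (boolP (inn y)) => //= iy.
    by rewrite -(ptail_from_star iy) imset_f // andbT.
  apply: (sum_outw wGS); first exact: subsetDl.
  by move=> y; rewrite inE => /andP[n _]; apply: contra n; exact: Yout.
have euler : #|E| + 2 <= 2 * (#|U| + #|Tt|).
  apply: leq_trans (coconnected_euler M Ysub r0Y x0Y Yconn) _.
  rewrite leq_mul2l /= leq_add2l -(@card_imset _ _ (@Some D)); last by move=> ? ? [].
  apply: subset_leq_card; apply/subsetP => f /setDP[/imsetP[x _ ->] nf].
  have {}nf x' : pleft x' = pleft x -> tl x' \notin Y.
    by move=> e; apply: contra nf => xY; rewrite -e; apply: imset_f; rewrite inE.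
  have [y iy e] : exists2 y, inn y & pleft x = Some y.
    case: (pdP x) nf => [y|y [] iy] nf.
    - case: (boolP (inn y)) => iy; first by exists y; rewrite // pleft_orig iy.
      have /negP[] : tl (og y) \notin Y by apply: nf.
      apply: Yout; apply: outer_dart_vertex => //.
      by rewrite /outer_edge_dart -[_ \in _]negbK -/(inn y) iy.
    - by exists y; rewrite // pleft_from_star.
    - by exists ((ph^-1)%g y); rewrite ?inner_phiV // pleft_to_star.
  rewrite e; apply: imset_f.
  have h1 : inl (vx y) \notin Y by apply: (nf (og y)); rewrite pleft_orig iy e.
  have h2 : inr (fc y) \notin Y.
    by rewrite -(ptail_from_star iy); apply: nf; rewrite pleft_from_star.
  have h3 : inl (vx (alpha y)) \notin Y.
    have ip : inn (ph y) by rewrite inner_phi.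
    rewrite -vertex_phi // -(ptail_to_star ip); apply: nf.
    by rewrite pleft_to_star // permK e.
  by rewrite !inE iy h1 h2 h3.
have flow : \sum_(v in U) outw w v = \sum_(x in E) w x + Om.
  transitivity (\sum_(x | tl x \notin Y) w x).
    rewrite (partition_big tl (mem U)) /=.
      apply: eq_bigr => v; rewrite inE => /andP[nv _]; apply: eq_bigl => x.
      by case: eqP => [->|]; rewrite ?andbF // nv.
    by move=> x nx; rewrite inE nx imset_f.
  rewrite (bigID (fun x => tl (pal x) \notin Y)) /=; congr (_ + _).
    by apply: eq_bigl => x; rewrite inE.
  by apply: eq_bigl => x; rewrite negbK.
have split (A : {set D}) : Tt \subset A ->
    \sum_(y in A) dg y = \sum_(y in Tt) dg y + \sum_(y in A :\: Tt) dg y /\ #|A| = #|Tt| + #|A :\: Tt|.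
  move=> /setIidPr e; split; last by rewrite -(cardsID Tt A) e.
  by rewrite (big_setID Tt) /= e.
have TM : Tt \subset Mt by apply/subsetP => y; rewrite inE => /andP[].
have TK : Tt \subset K by apply/subsetP => y; rewrite inE => /andP[].
have [m1 m2] := split _ TM; have [k1 _] := split _ TK.
have mle : \sum_(y in Mt :\: Tt) dg y <= d * #|Mt :\: Tt|.
  by apply: sum_le_card => y /setDP[/Minn].
(* A face whose star vertex is off [Y] either has all its triangles in [Tt], or has a corner in [K]
   outside [Tt], to which all its darts are charged. *)
have Sle : #|S| <= #|Tt| + \sum_(y in K :\: Tt) dg y.
  have sub : S \subset Tt :|: \bigcup_(y in K :\: Tt) fc y.
    apply/subsetP => y yS; rewrite inE; case: (boolP (y \in Tt)) => //= nT.
    case: (boolP [exists z in K :\: Tt, fc z == fc y]) => [/existsP[z /andP[zK /eqP e]]|no].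
      by apply/bigcupP; exists z => //; apply: face_mem.
    have closed z : z \in K -> fc z = fc y -> z \in Tt.
      move=> zK e; apply: contraR no => nz; apply/existsP; exists z.
      by rewrite inE nz zK e eqxx.
    have [iy nY] : inn y /\ inr (fc y) \notin Y by apply/andP; move: yS; rewrite inE.
    have [z ez nz] := Ystar y iy nY.
    have zK : z \in K by rewrite !inE (inner_face r ez) iy ez nY nz.
    have : y \in fc z by apply: face_mem.
    move=> yz; case/negP: nT; apply: (closed y) => //.
    suff [] : y \in K /\ fc y = fc z by [].
    apply: (porbit_ind (P := fun y => y \in K /\ fc y = fc z)) yz => // u [uK eu].
    rewrite face_phi eu; split=> //.
    have := closed u uK; rewrite eu ez => /(_ erefl); rewrite inE => /andP[_].
    rewrite inE => /andP[_ nu]; rewrite !inE inner_phi face_phi eu ez nY vertex_phi //.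
    by rewrite nu (inner_face r (etrans eu ez)) iy.
  apply: leq_trans (subset_leq_card sub) _.
  apply: leq_trans (leq_card_setU _ _) _; rewrite leq_add2l.
  elim/big_rec2: _ => [|y n A _ le]; first by rewrite cards0.
  by apply: leq_trans (leq_card_setU _ _) _; rewrite leq_add2l.
have h5 : d * (#|Mt| + 2 * #|K| + 2) <= d * (2 * (#|U| + #|Tt|)).
  by rewrite leq_mul2l -cE euler orbT.
have h6 := congr1 (muln d) m2; have h7 := m2.
move: h5 h6 h7 wE wU flow m1 k1 mle Sle; clear.
set a1 := \sum_(y in K) _; set a2 := \sum_(y in Mt) _; set a3 := \sum_(y in Tt) _.
set a4 := \sum_(y in K :\: _) _; set a5 := \sum_(y in Mt :\: _) _.
set a6 := \sum_(v in U) _; set a7 := \sum_(x in E) _.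
nia.
Qed.

End FlowOut.

(** * Walks, and the two halves of a cycle cut by a chord *)

Section Walk.
Variables (T V : finType) (al : T -> T) (t : T -> V).
Hypothesis alK : involutive al.
Hypothesis al_neq : forall x, al x != x.

Fixpoint walk (u : V) (p : seq T) (v : V) : bool :=
  if p is x :: p' then (t x == u) && walk (t (al x)) p' v else u == v.

Lemma walk_cat u p m q v : walk u p m -> walk m q v -> walk u (p ++ q) v.
Proof.
by elim: p u => [|x p IH] u /=; [move/eqP->|move=> /andP[-> /IH h] /h].
Qed.

Lemma walk_rev u p v : walk u p v -> walk v (rev (map al p)) u.
Proof.
elim: p u => [|x p IH] u /=; first by rewrite eq_sym.
move=> /andP[/eqP <- /IH h]; rewrite rev_cons -cats1; apply: walk_cat h _.
by rewrite /= alK !eqxx.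
Qed.

Lemma walk_cycle u p : walk u p u -> path.cycle (fun x y => t (al x) == t y) p.
Proof.
case: p => //= x p /andP[/eqP <-].
suff H y : walk (t (al y)) p (t x) -> path (fun x y => t (al x) == t y) y (rcons p x) by exact: H.
elim: p y => [|z p IH] y /=; first by move->.
by move=> /andP[/eqP e /IH ->]; rewrite e eqxx.
Qed.

Lemma cycle_walk x p : path.cycle (fun x y => t (al x) == t y) (x :: p) ->
  walk (t x) (x :: p) (t x).
Proof.
rewrite /= eqxx /=; suff H c : path (fun x y => t (al x) == t y) c (rcons p x) ->
    walk (t (al c)) p (t x) by exact: H.
elim: p c => [|z p IH] c /=; first by rewrite andbT.
by move=> /andP[/eqP -> /IH ->]; rewrite eqxx.
Qed.

Lemma walk_heads u p v : walk u p v -> map t p ++ [:: v] = u :: map (fun x => t (al x)) p.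
Proof.
elim: p u => [|x p IH] u /=; first by move/eqP->.
by move=> /andP[/eqP-> /IH ->].
Qed.

Lemma walk_split u p q v : walk u (p ++ q) v ->
  exists2 m, walk u p m & walk m q v.
Proof.
elim: p u => [|x p IH] u /=; first by exists u.
by move=> /andP[-> /IH[m h1 h2]]; exists m.
Qed.

Lemma walk_al u p v : walk u p v -> uniq (u :: map (fun x => t (al x)) p) ->
  forall x, x \in p -> al x \notin p.
Proof.
elim: p u => [|x p IH] u //= /andP[/eqP xu wp].
rewrite inE negb_or => /andP[/andP[_ up] un] y.
have back z : z \in p -> t (al z) != u.
  by move=> zp; apply: contra up => /eqP <-; apply/mapP; exists z.
rewrite !inE negb_or => /predU1P[->|yp].
  by rewrite al_neq /=; apply/negP => /back; rewrite alK xu eqxx.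
apply/andP; split; last exact: IH wp un y yp.
by apply/negP => /eqP e; have := back y yp; rewrite e xu eqxx.
Qed.

Lemma walk_of_path (Q : pred T) u vs :
  path (fun v v' => [exists x, [&& Q x, t x == v & t (al x) == v']]) u vs ->
  exists p, [/\ walk u p (last u vs), map (fun x => t (al x)) p = vs & all Q p].
Proof.
elim: vs u => [|v vs IH] u /=; first by exists [::]; rewrite /= eqxx.
move=> /andP[/existsP[x /and3P[Qx /eqP xu /eqP xv]] /IH[p [h1 h2 h3]]].
by exists (x :: p); rewrite /= xu eqxx xv h1 h2 Qx h3.
Qed.

Lemma simple_cycle_of_walk u p : p != [::] -> walk u p u -> uniq (map t p) ->
  (forall x, x \in p -> al x \notin p) -> simple_cycle al t p.
Proof.
move=> p0 wp up pal; apply/and4P; split=> //; first exact: walk_cycle wp.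
rewrite cat_uniq (map_uniq up) (map_inj_uniq (inv_inj alK)) (map_uniq up) andbT.
by apply/hasPn => _ /mapP[x xp ->]; exact: pal.
Qed.

(** [Q] stands for lying strictly inside [s]. Rotated to start at [u], the cycle is cut at [v] into
    [c1] and [c2]; the path [p] meets [s] only at its ends, so it closes up [c2], and its reverse
    closes up [c1]. *)
Lemma split_cycle s u p v (Q : pred T) : simple_cycle al t s ->
  u \in map t s -> v \in map t s -> u != v ->
  walk u p v -> uniq (u :: map (fun x => t (al x)) p) ->
  (forall x, x \in p -> (t x == u) || (t x \notin map t s)) ->
  (forall x, x \in p -> [/\ Q x, Q (al x), x \notin s & al x \notin s]) ->
  (forall x, x \in s -> ~~ Q x) ->
  exists c1 c2, [/\ perm_eq (c1 ++ c2) s, c1 != [::] /\ c2 != [::],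
    simple_cycle al t (p ++ c2) & simple_cycle al t (c1 ++ rev (map al p))].
Proof.
move=> sP /mapP[a as_ ea] /mapP[b bs eb] uv wp up ptl pQ sQ.
have [i s' es] := rot_to as_.
have bs' : b \in s'.
  have : b \in a :: s' by rewrite -es mem_rot.
  rewrite inE => /predU1P[e|//]; move: uv; rewrite ea eb e eqxx //.
case/splitPr: bs' es => p1 p2 es.
rewrite -cat_cons in es.
set c1 := a :: p1 in es *; set c2 := b :: p2 in es *.
have pe : perm_eq (c1 ++ c2) s by rewrite -es perm_rot.
have [_ cyc ut _] := and4P sP.
have ut' : uniq (map t (c1 ++ c2)) by rewrite (perm_uniq (perm_map t pe)).
have w1 : walk (t a) (c1 ++ c2) (t a) by apply: cycle_walk; rewrite -cat_cons -es rot_cycle.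
have [m wc1 wc2] := walk_split w1.
have em : m = v by rewrite eb; have := wc2; rewrite /c2 /= => /andP[/eqP].
rewrite {}em -?ea in wc1 wc2.
have ms x : (x \in c1 ++ c2) = (x \in s) by apply: perm_mem.
have c1s x : x \in c1 -> x \in s by rewrite -ms mem_cat => ->.
have c2s x : x \in c2 -> x \in s by rewrite -ms mem_cat => ->; rewrite orbT.
have sal x : x \in s -> al x \notin s by apply: (cycle_al sP).
have pal := walk_al wp up.
have tails_p : uniq (map t p).
  have := walk_heads wp => h; have : uniq (map t p ++ [:: v]) by rewrite h.
  by rewrite cat_uniq => /and3P[].
have p_disj x : x \in p -> x \notin s by move=> /pQ[].
have p_disj' x : x \in p -> al x \notin s by move=> /pQ[].
move: (ut'); rewrite map_cat cat_uniq => /and3P[u1 /hasPn u12 u2].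
exists c1, c2; split=> //.
- apply: (@simple_cycle_of_walk u).
  + by case: (p).
  + exact: walk_cat wp wc2.
  + rewrite map_cat cat_uniq tails_p u2 andTb andbT; apply/hasPn => _ /mapP[x xc2 ->].
    apply/negP => /mapP[y yp e].
    have := ptl y yp; rewrite -e => /orP[/eqP ex|]; last by rewrite map_f // c2s.
    by have := u12 (t x) (map_f t xc2); rewrite /= ex ea inE eqxx.
  + move=> x; rewrite !mem_cat negb_or => /orP[xp|xc].
      by rewrite pal //=; apply/negP => /c2s; apply/negP; exact: p_disj'.
    apply/andP; split; last by apply/negP => /c2s; apply/negP/sal/c2s.
    by apply/negP => alp; have := p_disj' _ alp; rewrite alK c2s.
- apply: (@simple_cycle_of_walk u).
  + by [].
  + exact: walk_cat wc1 (walk_rev wp).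
  + rewrite map_cat cat_uniq u1 andTb map_rev rev_uniq -map_comp.
    apply/andP; split; last by case/andP: up.
    apply/hasPn => z; rewrite mem_rev => /mapP[x xp ->].
    apply/negP => /mapP[y yc1]; rewrite [LHS]/= => e.
    have : t (al x) \in map t p ++ [:: v].
      by rewrite (walk_heads wp) inE; apply/orP; right; apply/mapP; exists x.
    rewrite mem_cat inE => /orP[/mapP[x' x'p ex']|/eqP ev].
      have := ptl x' x'p; rewrite -ex' e => /orP[/eqP eu|]; last by rewrite map_f // c1s.
      case/andP: up => /negP[]; rewrite -eu -e; apply/mapP; by exists x.
    have vb : v \in map t c2 by rewrite eb map_f // mem_head.
    by case/negP: (u12 v vb); rewrite -ev e; exact: map_f.
  + move=> x; rewrite !mem_cat !mem_rev negb_or.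
    have mal z : (z \in map al p) = (al z \in p).
      by rewrite -{1}(alK z) mem_map //; exact: inv_inj.
    rewrite !mal alK => /orP[xc|xp].
      apply/andP; split; first by apply/negP => /c1s; apply/negP/sal/c1s.
      by apply/negP => /p_disj; rewrite c1s.
    apply/andP; split; last by have := pal _ xp; rewrite alK.
    by apply/negP => /c1s h; have := p_disj _ xp; rewrite h.
Qed.
End Walk.

(** * Existence of a positive chord *)

Section Chord.
Variables (D : finType) (alpha sigma : {perm D}) (r : D).
Hypothesis PM : plane_map alpha sigma.

Local Notation ph := (phi alpha sigma).
Local Notation fc := (face alpha sigma).
Local Notation vx := (vertex sigma).
Local Notation inn := (inner alpha sigma r).
Local Notation dg := (deg alpha sigma).
Local Notation og := (orig alpha sigma r).
Local Notation star := (@star D alpha sigma r).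
Local Notation G := (PD alpha sigma r).
Local Notation pext := (@pexterior D alpha sigma r).
Local Notation tl := (@ptail D alpha sigma r).
Local Notation pal := (@palpha D alpha sigma r).
Local Notation ov := (outer_vertex alpha sigma r).
Local Notation pov := (pouter_vertex alpha sigma r).
Implicit Types (s : seq G) (x : G) (y z : D).

Let M := angular_map_plane r PM.

Variables (d : nat) (w : {ffun G -> nat}).
Hypothesis wGS : GS d w.
Hypothesis deg_le : forall y, inn y -> dg y <= d.

Variable s : seq G.
Hypothesis sP : pcycle s.
Hypothesis sC : ccw s.
Hypothesis sO : avoids_outer s.

Lemma avoids_tail u : u \in map tl s -> ~~ pov u.
Proof. by move=> /mapP[x xs ->]; apply: (allP sO). Qed.

Lemma pouter_vertexP v : pov v -> exists2 z, ~~ inn z & v = tl (og z).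
Proof.
case: v => [X /imsetP[z zo ->]|//].
by exists z; rewrite // /inner negbK.
Qed.

Lemma avoids_interior x : ~~ pext s x -> ~~ pov (tl x).
Proof.
case: (boolP (tl x \in map tl s)) => [/avoids_tail //|nx]; apply: contra.
move=> /pouter_vertexP[z zo e]; rewrite (pext_vertex PM sP nx e).
exact: (pext_og_outer PM).
Qed.

Lemma outw_le u : ~~ pov u -> (exists x, u = tl x) -> outw w u <= d.
Proof.
have [_ h1 _ h2 _] := wGS => nu [x ex]; move: nu; rewrite {}ex.
case: (pdP x) => [y|y [] iy] nu.
- by rewrite ptail_orig in nu *; rewrite h2.
- by rewrite ptail_from_star // -(h1 y iy) leq_addr.
- by rewrite ptail_to_star // in nu *; rewrite h2.
Qed.

(** The last test allows a walk to start at [u] but not to continue after reaching another vertex of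
    [s], so a walk without repetition ending on [s] is a chord. *)
Definition chord_dart (u : {set D} + {set D}) : pred G :=
  fun x => [&& ~~ pext s x, ~~ pext s (pal x), 0 < w x & (tl x == u) || (tl x \notin map tl s)].

Lemma chord_exists a : ~~ pext s a -> ~~ pext s (pal a) -> tl a \in map tl s -> 0 < w a ->
  exists u p v, [/\ u \in map tl s, v \in map tl s, u != v &
    [/\ walk pal tl u p v, uniq (u :: map (fun x => tl (pal x)) p) & all (chord_dart u) p]].
Proof.
move=> ea eaa ta wa; set u := tl a in ta.
pose e : rel ({set D} + {set D}) :=
  fun v v' => [exists x, [&& chord_dart u x, tl x == v & tl (pal x) == v']].
case: (boolP [exists v, [&& v \in map tl s, v != u & connect e u v]]).
  move=> /existsP[v /and3P[vs vu /connectP[p pP ev]]].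
  case: (shortenP pP) ev => p' p'P up' _ ev.
  have [q [wq hq Qq]] := walk_of_path p'P.
  exists u, q, v; rewrite ta vs eq_sym vu hq; split=> //; split=> //.
  by rewrite -ev in wq.
(* Otherwise the vertices reachable from u would emit a weight of at most d - 1, one unit
   of the weight of u being spent on a. *)
move=> no; exfalso.
pose Z0 := [set v | connect e u v].
have Zclosed x : chord_dart u x -> tl x \in Z0 -> tl (pal x) \in Z0.
  rewrite !inE => Qx ux; apply: connect_trans ux (connect1 _).
  by apply/existsP; exists x; rewrite Qx !eqxx.
have Zpred v : v \in Z0 -> v != u -> exists x, [/\ chord_dart u x, tl x \in Z0 & tl (pal x) = v].
  rewrite inE => /connectP[p]; elim/last_ind: p => [|p v' _] /=; first by move=> _ ->; rewrite eqxx.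
  rewrite rcons_path last_rcons => /andP[pP /existsP[x /and3P[Qx /eqP ex /eqP ex']]] -> _.
  exists x; split=> //; rewrite inE ex; apply/connectP; by exists p.
have Zoff v : v \in Z0 -> v != u -> v \notin map tl s.
  move=> vZ vu; apply: contra no => vs; apply/existsP; exists v.
  by rewrite vs vu; rewrite inE in vZ.
have Zint x : tl x \in Z0 -> tl x != u -> ~~ pext s x.
  move=> xZ xu; have [x' [/and4P[_ h _ _] _ e']] := Zpred _ xZ xu.
  by rewrite (pext_vertex PM (x' := pal x') sP) // Zoff.
have Zout v : pov v -> v \notin Z0.
  move=> vo; apply/negP => vZ; case: (eqVneq v u) => [e0|vu].
    by move: (avoids_tail ta); rewrite -e0 vo.
  have [x [_ _ ex]] := Zpred v vZ vu; rewrite -ex in vo vZ vu.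
  by case/negP: (avoids_interior (Zint _ vZ vu)).
pose u0 := tl (og r).
pose eY : rel ({set D} + {set D}) :=
  fun v v' => (v' \notin Z0) && [exists x, (tl x == v) && (tl (pal x) == v')].
(* [Y] is the component of the outer vertices in the complement of [Z0]. Taking it amounts to
   filling the pockets enclosed by [Z0]; an arc that enters [Y] still starts in [Z0]. *)
pose Y := [set v | connect eY u0 v].
have ro : pov u0 by apply/imsetP; exists r => //; exact: mem_face.
have Ystep x : tl x \in Y -> tl (pal x) \notin Z0 -> tl (pal x) \in Y.
  rewrite [tl x \in Y]inE [tl (pal x) \in Y]inE => ux nx; apply: connect_trans ux (connect1 _).
  by rewrite /eY nx; apply/existsP; exists x; rewrite !eqxx.
have YZ v : v \in Y -> v \notin Z0.
  rewrite inE => /connectP[p]; elim/last_ind: p => [_ -> /=|p v' _]; first exact: Zout.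
  by rewrite rcons_path last_rcons => /andP[_ /andP[h _]] ->.
have Yind (P : pred ({set D} + {set D})) : P u0 ->
    (forall x, tl x \in Y -> tl (pal x) \in Y -> P (tl x) -> P (tl (pal x))) ->
    forall v, v \in Y -> P v.
  move=> P0 Pstep v; rewrite inE => /connectP[p pP ->].
  have u0Y : u0 \in Y by rewrite inE connect0.
  elim: p (u0) u0Y P0 pP => //= v1 p IH v0 v0Y Pv0 /andP[/andP[h /existsP[x /andP[/eqP ex /eqP ex']]]].
  have v1Y : v1 \in Y by rewrite -ex'; apply: Ystep; rewrite ?ex ?ex'.
  by apply: IH => //; rewrite -ex'; apply: Pstep; rewrite ?ex ?ex'.
have Yout y : ov (vx y) -> inl (vx y) \in Y.
  move=> /outer_vertexP[z zo <-]; have zr : z \in fc r by rewrite /inner negbK in zo.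
  suff [] : ~~ inn z /\ inl (vx z) \in Y by [].
  apply: (porbit_ind (P := fun z => ~~ inn z /\ inl (vx z) \in Y)) zr => {z zo}.
    by split; [rewrite innerE eqxx|rewrite -/(tl (og r)) inE connect0].
  move=> z [zo zY]; split; first by rewrite inner_phi.
  have ez : inl (vx (ph z)) = tl (pal (og z)) by rewrite palpha_orig ptail_orig vertex_phi.
  rewrite ez; apply: Ystep => //; rewrite -ez; apply: Zout.
  by apply/outer_vertexP; exists (ph z); rewrite ?inner_phi.
have aZ : tl (pal a) \in Z0.
  by apply: Zclosed; rewrite ?inE ?connect0 // /chord_dart ea eaa wa eqxx.
have uZ : u \in Z0 by rewrite inE connect0.
(* A star vertex off [Y] but adjacent to [Y] lies in [Z0]. It then has an original neighbour in
   [Z0]: its predecessor in the search, or the head of [a] when it is [u]. *)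
have Ystar y : inn y -> inr (fc y) \notin Y -> exists2 z, fc z = fc y & inl (vx z) \notin Y.
  move=> iy nY; case: (boolP (inl (vx y) \in Y)) => yY; last by exists y.
  have fZ : inr (fc y) \in Z0.
    apply: contraR nY => nZ; rewrite -(ptail_from_star iy) -[star y true]/(star y (~~ false)).
    rewrite -palpha_star //; apply: Ystep; rewrite ?ptail_to_star //.
    by rewrite palpha_star // ptail_from_star.
  have [x [xZ exy]] : exists x, tl (pal x) \in Z0 /\ tl x = inr (fc y).
    case: (eqVneq (inr (fc y)) u) => [e0|fu]; first by exists a.
    have [x [_ xZ ex]] := Zpred _ fZ fu; exists (pal x); by rewrite (palphaK PM).
  case: (pdP x) xZ exy => [z|z [] iz]; rewrite ?ptail_orig ?ptail_to_star // palpha_star //.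
  rewrite ptail_to_star // ptail_from_star // => zZ [ez]; exists z => //.
  by apply: contraL zZ => /YZ.
have Ysub : Y \subset tl @: [set: G].
  apply/subsetP; apply: Yind; first by apply: imset_f.
  by move=> x _ _ _; apply: imset_f.
have := flow_out_bound PM wGS deg_le (r0 := og r) (x0 := a) Ysub _ _ Yind Yout Ystar.
rewrite inE connect0 => /(_ isT).
have aY : tl a \notin Y by apply: contraL uZ => /YZ.
move=> /(_ aY); apply/negP; rewrite -ltnNge.
(* An arc entering [Y] either leaves [u] and differs from [a], whose head is in [Z0], or leaves
   another vertex of [Z0] and has weight zero, since the search would have followed a positive
   one. *)
have key (n m : nat) : 0 < n -> m < n + m by lia.
have wle : outw w u <= d by apply: outw_le; [exact: avoids_tail|exists a].
apply: leq_trans wle; rewrite /outw [leqRHS](bigD1 a) //=.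
apply: (@leq_trans (\sum_(x | (tl x == u) && (x != a)) w x).+1); last exact: (key _ _ wa).
rewrite ltnS [leqRHS]big_mkcond [leqLHS]big_mkcond /=; apply: leq_sum => x _.
case: ifP => // /andP[xY axY].
have xZ : tl x \in Z0 by apply: contraR xY; have := Ystep (pal x); rewrite (palphaK PM) => h; exact: h.
case: (eqVneq (tl x) u) => [xu|xu] /=.
  by case: eqP => [xa|//]; move: axY; rewrite xa => /YZ; rewrite aZ.
case w0 : (w x) => [//|k]; have := YZ _ axY; rewrite Zclosed //.
have xs := Zoff _ xZ xu.
by rewrite /chord_dart (pext_edge PM sP xs) (Zint _ xZ xu) w0 xs orbT.
Qed.

End Chord.

(** * What all orientations have in common *)

Section Rigidity.
Variables (D : finType) (alpha sigma : {perm D}) (r : D) (d : nat).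
Hypothesis d3 : 3 <= d.
Hypothesis DM : d_map alpha sigma r d.

Local Notation ph := (phi alpha sigma).
Local Notation fc := (face alpha sigma).
Local Notation vx := (vertex sigma).
Local Notation inn := (inner alpha sigma r).
Local Notation dg := (deg alpha sigma).
Local Notation og := (orig alpha sigma r).
Local Notation star := (@star D alpha sigma r).
Local Notation G := (PD alpha sigma r).
Local Notation pext := (@pexterior D alpha sigma r).
Local Notation tl := (@ptail D alpha sigma r).
Local Notation pal := (@palpha D alpha sigma r).
Local Notation ov := (outer_vertex alpha sigma r).
Local Notation pov := (pouter_vertex alpha sigma r).
Implicit Types (s : seq G) (x : G) (y z : D) (w : {ffun G -> nat}).

Let PM : plane_map alpha sigma. Proof. by case: DM. Qed.
Let M := angular_map_plane r PM.

Lemma deg_le_d y : inn y -> dg y <= d. Proof. by case: DM => _ + _ _ => h /h. Qed.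

Lemma outer_inj y z : ~~ inn y -> ~~ inn z -> vx y = vx z -> y = z.
Proof.
by case: DM => _ _ _ inj; rewrite /inner !negbK => yo zo; exact: inj.
Qed.

Lemma alpha_outer y : ~~ inn y -> inn (alpha y).
Proof.
move=> yo; apply: contraT => ayo.
have e1 : ph y = alpha y by apply: outer_inj; rewrite ?inner_phi ?vertex_phi.
have e2 : ph (alpha y) = y.
  by apply: outer_inj; rewrite ?inner_phi ?vertex_phi // (alphaK PM).
have sub : outer_face alpha sigma r \subset [set y; alpha y].
  apply/subsetP => z zr; have : z \in fc y.
    by apply: face_mem; move: yo; rewrite innerE negbK => /eqP ->; exact: face_eq zr.
  apply: (porbit_ind (P := fun z => z \in [set y; alpha y])); rewrite ?set21 //.
  by move=> u /set2P[->|->]; rewrite ?e1 ?e2 ?set21 ?set22.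
have := subset_leq_card sub; rewrite cards2; case: DM => _ _ -> _.
by case: (_ != _); lia.
Qed.

Section OneOrientation.
Variable w : {ffun G -> nat}.
Hypothesis wGS : GS d w.

(** The outer contour, traversed with the inside on its left, has [d] original arcs and no
    [tris_rest], so by [out_weightE] it sends inwards the sum of [d - dg u] over its darts [u]. By
    (A0) only the present star arcs can carry this weight, each at most its own term, so all reach
    it. *)
Lemma GS_outer_star y : ~~ inn y -> w (star (alpha y) false) + dg (alpha y) = d.
Proof.
move=> yo; pose o := fingraph.orbit ph r.
have memo z : (z \in o) = ~~ inn z.
  rewrite /inner negbK /outer_face -fconnect_orbit.
  apply/idP/idP => [rz|zr].
    apply: face_mem; apply: (fconnect_ind (P := fun z => fc z = fc r)) rz => // u.
    by rewrite face_phi.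
  apply: (porbit_ind (P := fun z => fconnect ph r z)) zr => [|u ru]; first exact: connect0.
  by apply: connect_trans ru (fconnect1 _ _).
pose s0 : seq G := map og o.
have og_mem z : (og z \in s0) = ~~ inn z by rewrite mem_map ?memo //; exact: orig_inj.
have s0P : pcycle s0.
  apply/and4P; split.
  - have : og r \in s0 by rewrite og_mem innerE eqxx.
    by case: (s0).
  - rewrite cycle_map; apply: sub_cycle (fingraph.cycle_orbit (@perm_inj _ ph) r).
    by move=> u v /= /eqP <-; rewrite palpha_orig !ptail_orig vertex_phi.
  - rewrite map_inj_in_uniq; first by rewrite map_inj_uniq ?fingraph.orbit_uniq //; exact: orig_inj.
    move=> _ _ /mapP[u uo ->] /mapP[v vo ->]; rewrite !ptail_orig => -[e].
    by congr (og _); apply: outer_inj e; rewrite -memo.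
  - have u0 : uniq s0 by rewrite map_inj_uniq ?fingraph.orbit_uniq //; exact: orig_inj.
    rewrite cat_uniq u0 (map_inj_uniq (inv_inj (palphaK PM))) u0 andbT.
    apply/hasPn => _ /mapP[_ /mapP[u uo ->] ->]; rewrite /= palpha_orig og_mem negbK.
    by apply: alpha_outer; rewrite -memo.
pose s := rev (map pal s0).
have sP : pcycle s by apply: (rev_simple_cycle M).
have mems x : (x \in s) = (pal x \in s0) by apply: (mem_rev_cycle M).
have pextE x : pext s x -> exists2 z, ~~ inn z & x = og z.
  move=> /connectP[p pP ->]; elim/last_ind: p pP => [_|p v IH] /=.
    by exists r; rewrite // innerE eqxx.
  rewrite rcons_path last_rcons => /andP[/IH[z zo ->]] /orP[/eqP->|/and3P[_ _]].
    by exists (ph z); rewrite ?inner_phi // pphi_outer.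
  by rewrite mems (palphaK PM) og_mem zo.
have sC : ccw s.
  apply/ccwP => x; rewrite mems => xs; apply/negP => /pextE[z zo ex].
  by move: xs; rewrite ex palpha_orig og_mem alpha_outer.
pose A := [set u | og u \in s].
have AE u : (u \in A) = ~~ inn (alpha u) by rewrite inE mems palpha_orig og_mem.
have cA : #|A| = d.
  case: DM => _ _ <- _; rewrite -(card_imset _ (@perm_inj _ alpha)); apply: eq_card => u.
  apply/idP/idP => [/imsetP[v vA ->]|uo].
    by move: vA; rewrite AE /inner negbK.
  by apply/imsetP; exists (alpha u); rewrite ?(alphaK PM) // AE (alphaK PM) /inner negbK.
have Ainn u : u \in A -> inn u by rewrite AE => /alpha_outer; rewrite (alphaK PM).
have := out_weightE PM sP sC wGS deg_le_d; rewrite -/A cA.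
rewrite [X in _ = _ + X](_ : _ = 0) ?addn0; last first.
  apply/eqP; rewrite cards_eq0; apply/eqP/setP => u; rewrite !inE.
  by apply/negP => /and3P[iu _ /pextE[z zo /orig_inj e]]; rewrite -e iu in zo.
move=> /addIn ow.
have le1 : \sum_(u in A) (d - dg u) <= \sum_(u in A) w (star u false).
  rewrite -ow.
  have -> : \sum_(u in A) w (star u false) = \sum_(x in [set star u false | u in A]) w x.
    rewrite big_imset // => u v uA vA e.
    by have [] := star_inj (Ainn _ uA) (Ainn _ vA) e.
  rewrite /out_weight [leqLHS]big_mkcond [leqRHS]big_mkcond /=; apply: leq_sum => x _.
  case: ifP => // /and3P[ix iax /mapP[x' x's ex]].
  case: ifP => // xA; rewrite leqn0; apply/eqP.
  case: wGS => -[h1 h2] _ _ _ _.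
  have xout : pov (tl x).
    rewrite ex; move: x's; rewrite mems => /mapP[u uo eu].
    have -> : x' = og (alpha u) by rewrite -palpha_orig -eu (palphaK PM).
    apply/outer_vertexP; exists (ph u); first by rewrite inner_phi -memo.
    by rewrite vertex_phi.
  case: (boolP (pouter_arc x)) => [/h1 //|nx]; apply: h2 => //.
  apply/existsP => -[u /andP[uo /eqP exu]]; case/imsetP: (negbT xA).
  have Au : alpha u \in A by rewrite AE (alphaK PM) /inner negbK.
  by exists (alpha u) => //; apply: val_inj; rewrite exu val_star // Ainn.
have le2 u : u \in A -> w (star u false) <= d - dg u.
  by move=> /Ainn iu; have := GS_star wGS false iu; lia.
have Ay : alpha y \in A by rewrite AE (alphaK PM).
have iy := Ainn _ Ay; have := deg_le_d iy.
have := le1; rewrite (bigD1 (alpha y)) //= [leqRHS](bigD1 (alpha y)) //=.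
have : \sum_(i in A | i != alpha y) w (star i false) <= \sum_(i in A | i != alpha y) (d - dg i).
  by apply: leq_sum => u /andP[/le2].
have := le2 _ Ay; set a := w _; set b := \sum_(i in A | _) _; set c := \sum_(i in A | _) _.
lia.
Qed.

(** Two corners of one inner face at one vertex would form a cycle of two star edges. It has no
    original arc, so [out_weightE] gives [d <= #|tris_rest s|]; but [tris_rest] misses a triangle of
    the face inside the cycle and has fewer than [dg y] elements. *)
Lemma face_vertex_inj y z : inn y -> fc y = fc z -> vx y = vx z -> y = z.
Proof.
move=> iy ef ev; apply/eqP; apply: contraT => yz.
exfalso; have iz : inn z by rewrite -(inner_face r ef).
pose s := [:: star y false; star z true].
have sP : pcycle s.
  rewrite /pcycle /simple_cycle /= !palpha_star //= !ptail_to_star // !ptail_from_star //.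
  rewrite ef ev !eqxx /= !inE /=.
  have ne a b c e : inn a -> inn b -> a != b \/ c != e -> (star a c == star b e) = false.
    move=> ia ib ab; apply/eqP => /(star_inj ia ib)[eab ece].
    by case: ab => /eqP.
  by rewrite !ne //; [left|right|left|left|right|left]; rewrite ?(eq_sym z).
have bad s' b : pcycle s' -> ccw s' -> (forall u, og u \notin s') -> star y b \in s' ->
    (forall u, inn u -> inr (fc u) \in map tl s' -> fc u = fc y) -> False.
  move=> s'P s'C noog ys st; have := out_weightE PM s'P s'C wGS deg_le_d.
  rewrite /tris_orig (_ : [set u | _] = set0); last first.
    by apply/setP => u; rewrite !inE (negPf (noog u)).
  rewrite big_set0 cards0 !add0n => e.
  have [u uy nu] : exists2 u, fc u = fc y & ~~ pext s' (og u).
    have := s'C; move=> /allP/(_ _ ys); rewrite /pinterior; case: b {ys}.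
      by rewrite (pext_from_star PM) // => ny; exists y.
    by rewrite (pext_to_star PM) // => ny; exists ((ph^-1)%g y); rewrite ?face_phiV.
  suff : #|tris_rest s'| < dg y by have := deg_le_d iy; lia.
  apply: proper_card; apply/properP; split.
    by apply/subsetP => v; rewrite inE => /and3P[iv /(st v iv) e' _]; apply: face_mem.
  by exists u; [apply: face_mem|rewrite inE (negPf nu) !andbF].
have stars u : inn u -> inr (fc u) \in map tl s -> fc u = fc y.
  rewrite /= !inE ptail_to_star // ptail_from_star // => iu /orP[//|/eqP[->]] //.
have [/ccwP sC|/ccwP sC] := ccw_or_rev M (og r) sP.
  apply: (bad s false sP sC); last exact: stars.
    by move=> u; rewrite !inE; apply/negP => /orP[]/eqP; apply: orig_star.
  by rewrite !inE eqxx.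
apply: (bad _ true (rev_simple_cycle M sP) sC).
- move=> u; rewrite (mem_rev_cycle M) palpha_orig !inE.
  by apply/negP => /orP[]/eqP; apply: orig_star.
- by rewrite (mem_rev_cycle M) palpha_star // inE eqxx.
- move=> u iu; rewrite map_rev mem_rev -map_comp (perm_mem (heads_perm sP)).
  exact: stars.
Qed.

(** With the same face on both sides, [face_vertex_inj] makes both ends of the edge leaves, and this
    edge would be the whole connected map. *)
Lemma no_isthmus y : inn y -> fc (alpha y) != fc y.
Proof.
move=> iy; apply/eqP => e.
have iay : inn (alpha y) by rewrite (inner_face r e).
have e1 : ph y = alpha y by apply: face_vertex_inj; rewrite ?inner_phi ?face_phi ?vertex_phi.
have e2 : ph (alpha y) = y.
  by apply: face_vertex_inj; rewrite ?inner_phi ?face_phi ?vertex_phi ?(alphaK PM).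
have s1 : sigma y = y.
  by rewrite -{1}e2 phiE (alphaK PM) permKV.
have s2 : sigma (alpha y) = alpha y by rewrite -{1}e1 phiE permKV.
have [_ _ /(_ y r)/connectP[p pP er] _] := PM.
suff : r \in [set y; alpha y].
  by rewrite !inE => /orP[]/eqP er'; [move: iy|move: iay]; rewrite -er' innerE eqxx.
suff H : forall u, u \in [set y; alpha y] -> path [rel a b | (b == sigma a) || (b == alpha a)] u p ->
    last u p \in [set y; alpha y] by rewrite er; apply: H pP; rewrite set21.
elim: (p) => //= z q IH u uy /andP[uz]; apply: IH.
case/set2P: uy uz => -> /orP[]/eqP->; rewrite ?s1 ?s2 ?(alphaK PM) ?set21 ?set22 //.
Qed.
End OneOrientation.

Lemma GS_outer w w' x : GS d w -> GS d w' -> pov (tl x) -> w x = w' x.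
Proof.
move=> wGS w'GS xo; have [[h1 h2] _ _ _ _] := wGS; have [[h1' h2'] _ _ _ _] := w'GS.
case: (boolP (pouter_arc x)) => [xa|nxa]; first by rewrite h1 // h1'.
case: (boolP [exists y, (y \in outer_face alpha sigma r) && (val x == inr (alpha y, false))]).
  move=> /existsP[y /andP[yo /eqP ex]].
  have yn : ~~ inn y by rewrite /inner negbK.
  have -> : x = star (alpha y) false by apply: val_inj; rewrite ex val_star // alpha_outer.
  by have := GS_outer_star wGS yn; have := GS_outer_star w'GS yn; lia.
by move=> no; rewrite h2 // h2'.
Qed.

Lemma GS_edge w w' x : GS d w -> GS d w' -> w x + w (pal x) = w' x + w' (pal x).
Proof.
move=> wGS w'GS; case: (pdP x) => [y|y b iy]; last first.
  by have := GS_star wGS b iy; have := GS_star w'GS b iy; rewrite palpha_star //; lia.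
case: (boolP (outer_edge_dart alpha sigma r y)) => [yo|yi].
  have [[h1 _] _ _ _ _] := wGS; have [[h1' _] _ _ _ _] := w'GS.
  have yo' : outer_edge_dart alpha sigma r (alpha y).
    by move: yo; rewrite /outer_edge_dart (alphaK PM) orbC.
  by rewrite palpha_orig (h1 (og y)) // (h1 (og (alpha y))) // (h1' (og y)) // (h1' (og (alpha y))).
have [_ _ _ _ h] := wGS; have [_ _ _ _ h'] := w'GS.
by have := h y yi; have := h' y yi; rewrite palpha_orig; lia.
Qed.

Lemma GS_outw w w' v : GS d w -> GS d w' -> outw w v = outw w' v.
Proof.
move=> wGS w'GS; case: (boolP (pov v)) => [vo|nv].
  by apply: eq_bigr => x /eqP ex; apply: GS_outer; rewrite ?ex.
have [_ h1 _ h2 _] := wGS; have [_ h1' _ h2' _] := w'GS.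
case: (boolP [exists x, tl x == v]) => [/existsP[x /eqP ex]|no]; last first.
  by rewrite /outw !big_pred0 // => x; apply: contraNF no => ex; apply/existsP; exists x.
move: nv; rewrite -{}ex; case: (pdP x) => [y|y [] iy] nv.
- by rewrite ptail_orig in nv *; rewrite h2 ?h2'.
- by rewrite ptail_from_star //; have := h1 y iy; have := h1' y iy; lia.
- by rewrite ptail_to_star // in nv *; rewrite h2 ?h2'.
Qed.

(** In this form membership is visibly preserved by circulations that avoid the outer vertices. *)
Lemma GS_transfer w w' : GS d w -> (forall x, w x + w (pal x) = w' x + w' (pal x)) ->
  (forall x, pov (tl x) -> w' x = w x) -> (forall v, outw w v = outw w' v) -> GS d w'.
Proof.
move=> [[h1 h1'] h2 h3 h4 h5] we wo wv; split.
- split=> [x xo|x nx vo h]; last by rewrite wo // h1'.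
  rewrite wo; first exact: h1.
  by move: xo; case: (pdP x) => [y|y b iy]; rewrite /pouter_arc ?val_star //; exact: outer_dart_vertex.
- by move=> y iy; rewrite -wv h2.
- by move=> x y b e; rewrite -we (h3 x y b).
- by move=> y iy; rewrite -wv h4.
- by move=> y iy; have := we (og y); rewrite palpha_orig => <-; exact: h5.
Qed.

End Rigidity.

(** * Enclosing cycles *)

Section Enclosing.
Variables (D : finType) (alpha sigma : {perm D}) (r : D) (d : nat).
Hypothesis d3 : 3 <= d.
Hypothesis DA : d_adapted alpha sigma r d.

Local Notation ph := (phi alpha sigma).
Local Notation fc := (face alpha sigma).
Local Notation vx := (vertex sigma).
Local Notation inn := (inner alpha sigma r).
Local Notation dg := (deg alpha sigma).
Local Notation og := (orig alpha sigma r).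
Local Notation star := (@star D alpha sigma r).
Local Notation G := (PD alpha sigma r).
Local Notation pext := (@pexterior D alpha sigma r).
Local Notation tl := (@ptail D alpha sigma r).
Local Notation pal := (@palpha D alpha sigma r).
Implicit Types (x : G) (y z u v : D).

Let DM : d_map alpha sigma r d. Proof. by case: DA. Qed.
Let PM : plane_map alpha sigma. Proof. by case: DM. Qed.
Let M := angular_map_plane r PM.

Lemma edge_eq y z : edge alpha y = edge alpha z -> y = z \/ y = alpha z.
Proof.
move=> e; have : y \in edge alpha z by rewrite -e set21.
by case/set2P; [left|right].
Qed.

Lemma edge_alpha y : edge alpha (alpha y) = edge alpha y.
Proof. by rewrite /edge (alphaK PM) setUC. Qed.

Variable s : seq G.
Hypothesis sP : pcycle s.
Hypothesis sC : ccw s.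

Local Notation TT := (tris s).
Local Notation TO := (tris_orig s).
Local Notation TR := (tris_rest s).

Definition disc_faces := [set y | [exists z in fc y, z \in TT]].
Local Notation Q := disc_faces.

Lemma discP y : reflect (exists2 z, fc z = fc y & z \in TT) (y \in Q).
Proof.
rewrite inE; apply: (iffP existsP) => [[z /andP[zy zT]]|[z e zT]]; exists z => //.
  exact: face_eq.
by rewrite zT andbT; apply: face_mem.
Qed.

Lemma tris_disc y : y \in TT -> y \in Q.
Proof. by move=> yT; apply/discP; exists y. Qed.

Lemma disc_inner y : y \in Q -> inn y.
Proof. by move=> /discP[z e zT]; rewrite -(inner_face r e); apply: (tris_inner PM zT). Qed.

Lemma disc_face y z : fc y = fc z -> (y \in Q) = (z \in Q).
Proof. by move=> e; apply/discP/discP => -[u e' uT]; exists u; rewrite // e' e. Qed.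

Lemma rest_disc y : y \in TR -> y \in Q.
Proof.
rewrite inE => /and3P[iy /mapP[x xs e] _]; apply/discP.
have ix : ~~ pext s x by apply: (allP sC).
case: (pdP x) ix e => [z|z [] iz] ix; rewrite ?ptail_orig ?ptail_to_star // ptail_from_star //.
by move=> -[e]; exists z; rewrite // inE -(pext_from_star PM).
Qed.

Lemma orig_disc y : y \in TO -> y \in Q.
Proof. by rewrite (tris_origE PM sP sC) inE => /andP[/tris_disc]. Qed.

(** Around a star vertex off [s] all triangles lie on the same side, so a face cut by [s] has its
    star vertex on [s]. *)
Lemma disc_rest y : y \in Q -> y \notin TT -> y \in TR.
Proof.
move=> yQ; rewrite inE negbK => ey; rewrite inE (disc_inner yQ) ey andbT /=.
have /discP[z e] := yQ; rewrite inE => nz.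
apply: contraR nz => ny; have iy := disc_inner yQ; have iz : inn z by rewrite (inner_face r e).
rewrite -(pext_from_star PM) // -(pext_vertex PM (x := star y true) sP) ?ptail_from_star ?e //.
by rewrite pext_from_star.
Qed.

Lemma disc_boundary y : y \in Q -> alpha y \notin Q -> y \in TO :|: TR.
Proof.
move=> yQ aQ; rewrite inE; case: (boolP (y \in TT)) => yT; last by rewrite disc_rest ?orbT.
apply/orP; left; rewrite (tris_origE PM sP sC) inE yT.
by apply: contra aQ; exact: tris_disc.
Qed.

Lemma orig_rest_disjoint : TO :&: TR = set0.
Proof.
apply/setP => y; rewrite in_set0 in_setI (tris_origE PM sP sC) !inE.
by case: (pext s (og y)); rewrite ?andbF.
Qed.

Lemma enclosing_lengthE : enclosing_length s = #|edge alpha @: (TO :|: TR)|.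
Proof.
apply: eq_card => X; apply/imsetP/imsetP => -[y].
  rewrite !inE => /orP[/orP[ys|ys]|yR] ->.
  - by exists y; rewrite // !inE ys.
  - by exists (alpha y); rewrite ?edge_alpha // !inE ys.
  - exists y => //; rewrite !inE; apply/orP; right.
    case/and3P: yR => /existsP[x /andP[xs /eqP e]] -> ->; rewrite andbT /=.
    by rewrite -e map_f.
rewrite !inE => /orP[ys|/and3P[iy /mapP[x xs e] ey]] ->; exists y => //; rewrite !inE.
  by rewrite ys.
apply/orP; right; rewrite iy ey !andbT; apply/existsP; exists x.
by rewrite xs e eqxx.
Qed.

Lemma enclosing_le : enclosing_length s <= #|TO| + #|TR|.
Proof.
rewrite enclosing_lengthE; apply: leq_trans (leq_imset_card _ _) _.
exact: leq_card_setU.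
Qed.

Lemma disc_nonempty : exists y, y \in TT.
Proof.
have [x xs] : exists x, x \in s.
  by case/and4P: (sP); case: (s) => // x s' _ _ _ _; exists x; rewrite inE eqxx.
have := allP sC x xs; rewrite /pinterior; case: (pdP x) => [y|y [] iy] nx.
- by exists y; rewrite inE.
- by exists y; rewrite inE -(pext_from_star PM).
- by exists ((ph^-1)%g y); rewrite inE -(pext_to_star PM).
Qed.

(* The part of the boundary of the disc facing the outer face contains a simple cycle of G,
   to which adaptedness applies. *)
Lemma disc_cycle y1 y2 : y1 \in Q -> y2 \in Q -> fc y1 != fc y2 ->
  exists c : seq D, [/\ uniq c, d <= size c & forall v, v \in c -> v \in Q /\ alpha v \notin Q].
Proof.
move=> y1Q y2Q y12.
(* [O] is the region of the outer face in the complement of [Q], explored in [G] itself; a dart of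
   [B] below has [Q] on its left and [O] on its right. *)
pose K : rel D := [rel a b | (b == ph a) || ((b == alpha a) && (b \notin Q))].
pose O := [set y | connect K r y].
have rO : r \in O by rewrite inE connect0.
have phO y : y \in O -> ph y \in O.
  rewrite !inE => ry; apply: connect_trans ry (connect1 _); by rewrite /K /= eqxx.
have alO y : y \in O -> alpha y \notin Q -> alpha y \in O.
  move=> yO nQ; rewrite [_ \in O]inE; rewrite [_ \in O]inE in yO.
  by apply: connect_trans yO (connect1 _); rewrite /K /= eqxx nQ orbT.
have Oface y z : y \in O -> fc z = fc y -> z \in O.
  move=> yO e; have : z \in fc y by apply: face_mem.
  exact: (porbit_ind (P := fun z => z \in O) yO phO).
have OQ y : y \in O -> y \notin Q.
  rewrite inE => /connectP[p]; elim/last_ind: p y => [|p v IH] y /=.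
    by move=> _ ->; apply/negP => /disc_inner; rewrite innerE eqxx.
  rewrite rcons_path last_rcons => /andP[pP /orP[/eqP->|/andP[_ h]]] -> //.
  by rewrite (disc_face (face_phi _ _ _)); apply: (IH _ pP).
pose B := [set y | (y \notin O) && (alpha y \in O)].
have BQ y : y \in B -> y \in Q /\ alpha y \notin Q.
  rewrite inE => /andP[nO aO]; split; last exact: OQ.
  by apply: contraR nO => nQ; rewrite -(alphaK PM y); apply: alO; rewrite // (alphaK PM).
have [b bB] : exists b, b \in B.
  apply/set0Pn; apply: contraL (y1Q) => /eqP B0; apply: OQ.
  have [_ _ /(_ r y1)/connectP[p pP ->] _] := PM.
  have Oal y : y \in O -> alpha y \in O.
    move=> yO; apply: contraT => nO; have : alpha y \in B by rewrite inE nO (alphaK PM).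
    by rewrite B0 inE.
  elim: p (r) rO pP => //= v p IH u uO /andP[uv]; apply: IH.
  case/orP: uv => /eqP->; last exact: Oal.
  rewrite -(alphaK PM (sigma u)); apply: Oal; apply: (Oface u) => //.
  by rewrite -(face_phi alpha sigma (alpha _)) phiE (alphaK PM) permK.
have Bnext y : y \in B -> exists2 z, z \in B & vx z = vx (alpha y).
  move=> yB; have [nO aO] : y \notin O /\ alpha y \in O by apply/andP; rewrite inE in yB.
  case: (boolP [exists z in B, vx z == vx (alpha y)]) => [/existsP[z /andP[zB /eqP e]]|no].
    by exists z.
  have h : alpha y \in porbit sigma^-1 (ph y).
    by rewrite porbitV -/(vx _) vertex_phi // mem_vertex.
  suff [] : alpha y \notin O /\ vx (alpha y) = vx (alpha y) by rewrite aO.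
  apply: (porbit_ind (P := fun z => z \notin O /\ vx z = vx (alpha y))) h => [|z [zO ez]].
    rewrite vertex_phi //; split=> //; apply: contra nO => pO.
    by apply: (Oface _ _ pO); rewrite face_phi.
  rewrite vertex_sigmaV; split=> //.
  have azO : alpha z \notin O.
    apply: contra no => azO; apply/existsP; exists z; by rewrite inE zO azO ez eqxx.
  have <- : ph (alpha z) = (sigma^-1)%g z by rewrite phiE (alphaK PM).
  by apply: contra azO => pO; apply: (Oface _ _ pO); rewrite face_phi.
have BO y : y \in B -> y \notin O by rewrite inE => /andP[].
have Bal y : y \in B -> alpha y \notin B.
  by rewrite !inE => /andP[_ ->].
have [c cP cB] := find_simple_cycle (t := vx) (@perm_inj _ alpha) bB Bal Bnext.
have cu : uniq c := cycle_uniq cP.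
exists c; split=> //; last by move=> v /cB; exact: BQ.
case: DA => _ /(_ c cP) adapted.
case: (boolP [exists y, dedges alpha [set z in c] == dedges alpha (fc y)]); last exact: adapted.
move=> /existsP[y /eqP ey].
have yc z : z \in fc y -> (z \in c) || (alpha z \in c).
  move=> zy; have : z \in dedges alpha (fc y) by rewrite inE zy.
  by rewrite -ey !inE.
have yB z : z \in fc y -> (z \in B) || (alpha z \in B).
  by move=> /yc/orP[/cB->|/cB->]; rewrite ?orbT.
(* The contour of the outer face is a face contour too, but has [d] edges. A face on the side of [O]
   bounded by [c] must be the outer one, since [c] separates it from the rest of [O]. *)
case: (boolP (y \in O)) => yO.
  have fyO z : z \in fc y -> z \in O by move=> zy; apply: (Oface y) => //; exact: face_eq.
  have ry : fc r = fc y.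
    apply/eqP; apply: contraT => nry.
    have : y \in O by []; rewrite inE => /connectP[p pP e].
    have : fc (last r p) != fc y.
      elim: p (r) rO nry pP {e} => //= v p IH u uO nu /andP[uv]; apply: IH.
        case/orP: uv => [/eqP->|/andP[/eqP-> nQ]]; [exact: phO|exact: alO].
      case/orP: uv => [/eqP->|/andP[/eqP-> nQ]]; first by rewrite face_phi.
      apply/eqP => e; have ay : alpha u \in fc y by apply: face_mem.
      by have := yB _ ay; rewrite (alphaK PM) => /orP[]/BO/negP[] //; exact: fyO.
    by rewrite -e eqxx.
  have [_ _ <- _] := DM; rewrite /outer_face ry -(card_imset _ (@perm_inj _ alpha)).
  rewrite -(card_uniqP cu); apply: subset_leq_card; apply/subsetP => _ /imsetP[z zy ->].
  by have := yc z zy => /orP[/cB/BO/negP[]|//]; exact: fyO.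
have yQ z : z \in fc y -> z \in Q /\ alpha z \notin Q.
  move=> zy; apply: BQ; have := yB z zy => /orP[//|]; rewrite [alpha z \in B]inE (alphaK PM) => /andP[_ zO].
  by case/negP: yO; apply: (Oface _ _ zO); apply/esym/face_eq.
exfalso.
have [y3 y3Q ny3] : exists2 y3, y3 \in Q & fc y3 != fc y.
  case: (eqVneq (fc y1) (fc y)) => [e|ne]; last by exists y1.
  by exists y2 => //; rewrite -e eq_sym.
have /discP[z0 e0 z0T] : y \in Q by have [] := yQ y (mem_face _ _ _).
have /discP[z3 e3 z3T] := y3Q.
(* [gf] gives the face of [G] on the left of [x]; it changes only across original edges. All edges
   of the face of [y] lead out of [Q], so no path inside [s] can go from this face to the second
   face of [Q]. *)
pose gf (x : G) := match val x with inl u => fc u | inr (u, _) => fc u end.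
have gfs u b' : inn u -> gf (star u b') = fc u by move=> iu; rewrite /gf val_star.
have /connectP[p pP ep] : connect (nocross pal (@pphi D alpha sigma r) s) (og z0) (og z3).
  by apply: (int_connected M sP (r := og r)); [apply/ccwP|rewrite inE in z0T|rewrite inE in z3T].
suff H x : ~~ pext s x -> gf x = fc y -> path (nocross pal (@pphi D alpha sigma r) s) x p ->
    gf (last x p) = fc y.
  have := H (og z0); rewrite -ep => /(_ _ _ pP) h; case/eqP: ny3.
  by rewrite -e3; apply: h; [rewrite inE in z0T|].
elim: p x {pP ep} => //= x' p IH x nx gx /andP[xx' x'p].
apply: (IH x') => //.
  by case/orP: xx' => [/eqP->|/and3P[/eqP-> n1 n2]]; rewrite ?(pext_ph PM) // [pext _ _](ext_al M).
case/orP: xx' => [/eqP->|/and3P[/eqP-> n1 n2]].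
  case: (pdP x) nx gx => [u|u [] iu] nx.
  - by rewrite pphi_orig ?(pint_inner PM nx) // gfs ?inner_phi ?(pint_inner PM nx) // face_phi.
  - by rewrite pphi_from_star // gfs.
  - by rewrite pphi_to_star // !gfs ?inner_phiV // face_phiV.
case: (pdP x) nx gx n1 n2 => [u|u b' iu] nx gx n1 n2; last by rewrite palpha_star // gfs // -gx gfs.
have [_ /negP[]] := yQ u (face_mem gx).
by apply: tris_disc; rewrite inE -palpha_orig [pext _ _](ext_al M).
Qed.

(** The cycle [c] provides [d] distinct enclosing edges, each with a face outside [Q] across it. If
    there are no others, none is met from both sides, so the count with multiplicity is [d] as
    well. *)
Lemma disc_single : (forall y z, y \in Q -> z \in Q -> fc y = fc z) \/
  (d <= enclosing_length s /\ (enclosing_length s = d -> #|TO| + #|TR| = d)).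
Proof.
case: (boolP [exists y in Q, [exists z in Q, fc y != fc z]]); last first.
  move=> no; left=> y z yQ zQ; apply/eqP; apply: contraR no => ne.
  by apply/existsP; exists y; rewrite yQ; apply/existsP; exists z; rewrite zQ.
move=> /existsP[y1 /andP[y1Q /existsP[y2 /andP[y2Q ne]]]]; right.
have [c [cu dc cQ]] := disc_cycle y1Q y2Q ne.
have edge_inj u v : u \in Q -> v \in c -> edge alpha u = edge alpha v -> u = v.
  by move=> uQ vc /edge_eq[//|e]; have [_] := cQ v vc; rewrite -e uQ.
have csub : edge alpha @: [set v in c] \subset edge alpha @: (TO :|: TR).
  apply: imsetS; apply/subsetP => v; rewrite inE => /cQ[h1 h2]; exact: disc_boundary.
have cc : #|edge alpha @: [set v in c]| = size c.
  rewrite card_in_imset; first by rewrite cardsE; apply/card_uniqP.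
  by move=> u v; rewrite !inE => /cQ[uQ _] vc; exact: edge_inj.
have dle : d <= enclosing_length s.
  by rewrite enclosing_lengthE; apply: leq_trans (subset_leq_card csub); rewrite cc.
split=> // e; apply/eqP; rewrite eqn_leq; apply/andP; split; last by rewrite -e enclosing_le.
have eqs : edge alpha @: [set v in c] = edge alpha @: (TO :|: TR).
  by apply/eqP; rewrite eqEcard csub -enclosing_lengthE e cc.
have sub : TO :|: TR \subset [set v in c].
  apply/subsetP => u uT; have : edge alpha u \in edge alpha @: [set v in c].
    by rewrite eqs; apply: imset_f.
  move=> /imsetP[v vc ev]; rewrite (edge_inj u v) //; last by rewrite inE in vc.
  by case/setUP: uT; [exact: orig_disc|exact: rest_disc].
rewrite -[leqLHS]cardsUI orig_rest_disjoint cards0 addn0.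
apply: leq_trans (subset_leq_card sub) _.
by rewrite -[leqRHS]e enclosing_lengthE -eqs cc cardsE card_size.
Qed.

Hypothesis sO : avoids_outer s.

Section Weights.
Variable w : {ffun G -> nat}.
Hypothesis wGS : GS d w.

Let degd := deg_le_d DM.

Lemma orig_deg_gt1 y : y \in TO -> 1 < dg y.
Proof.
move=> yT; have iy := disc_inner (orig_disc yT).
have iay : inn (alpha y).
  apply: contraT => ay; have : outer_vertex alpha sigma r (vx y).
    apply: outer_dart_vertex => //; rewrite /outer_edge_dart; apply/orP; right.
    by rewrite -[_ \in _]negbK.
  by move: yT; rewrite inE => /(allP sO); rewrite /= => /negbTE ->.
by have := GS_orig wGS iy iay; have := degd iay; lia.
Qed.

Lemma single_orig : (forall y z, y \in Q -> z \in Q -> fc y = fc z) -> TO = TT.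
Proof.
move=> single; rewrite (tris_origE PM sP sC); apply/setP => y; rewrite inE.
case: (boolP (y \in TT)) => //= yT; apply/negP => ayT.
have := no_isthmus d3 DM wGS (disc_inner (tris_disc yT)).
by rewrite (single (alpha y) y) ?eqxx // tris_disc.
Qed.

Lemma pint_left x : ~~ pext s x -> exists2 y, y \in TT & pleft x = Some y.
Proof.
case: (pdP x) => [y|y [] iy] nx.
- by exists y; rewrite ?inE // pleft_orig (pint_inner PM nx).
- by exists y; rewrite ?pleft_from_star // inE -(pext_from_star PM).
- by exists ((ph^-1)%g y); rewrite ?pleft_to_star // inE -(pext_to_star PM).
Qed.

Lemma contour_of_triangle y0 : TT = [set y0] -> inner_face_contour s.
Proof.
move=> T0; have y0T : y0 \in TT by rewrite T0 set11.
have iy0 := tris_inner PM y0T.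
have intE x : ~~ pext s x = (pleft x == Some y0).
  apply/idP/eqP => [/pint_left[y yT ->]|e]; first by move: yT; rewrite T0 inE => /eqP->.
  have e' : pleft x = pleft (og y0) by rewrite e pleft_orig iy0.
  have -> : pext s x = pext s (og y0) := ext_left M (og r) s e'.
  by rewrite inE in y0T.
have faceE x : fconnect (@pphi D alpha sigma r) (og y0) x = (pleft x == Some y0).
  by rewrite -pleft_eq pleft_orig iy0 eq_sym.
(* No edge borders this triangle twice: a star edge that did would belong to a face of degree 1. *)
have one x : pleft x = Some y0 -> pleft (pal x) = Some y0 -> False.
  have TOy : y0 \in TO by rewrite single_orig // => y z /discP[u <- +] /discP[v <-]; rewrite T0 !inE => /eqP-> /eqP->.
  have dg1 := orig_deg_gt1 TOy.
  have loop : ph y0 = y0 -> False.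
    move=> e; have sub : fc y0 \subset [set y0].
      apply/subsetP => z zf; apply: (porbit_ind (P := fun z => z \in [set y0])) zf => [|u].
        by rewrite set11.
      by rewrite inE => /eqP->; rewrite e set11.
    by have := subset_leq_card sub; rewrite cards1 leqNgt dg1.
  case: (pdP x) => [y|y b iy].
    rewrite palpha_orig !pleft_orig; case: ifP => // _ [->]; case: ifP => // _ [e].
    by have := alpha_neq PM y0; rewrite e eqxx.
  rewrite palpha_star //; case: b => /=; rewrite pleft_from_star // pleft_to_star //.
    by move=> [->] [e]; apply: loop; rewrite -{1}e permKV.
  by move=> [e] [e']; apply: loop; rewrite -{1}e permKV e'.
apply/existsP; exists (og y0); rewrite -pleft_eq !pleft_orig iy0 innerE eqxx /=.
apply/eqP/setP => x; rewrite !inE !faceE !(pcycle_mem PM _ sP sC) (palphaK PM).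
rewrite -[pext s x]negbK -[pext s (pal x)]negbK !intE.
by case: eqP => e1; case: eqP => e2 //=; case: (one x).
Qed.

Lemma out_zero_type : positive w s -> out_weight s w = 0 ->
  inner_face_contour s \/ (compatible d s /\ enclosing_length s = d).
Proof.
move=> pos ow; have := out_weightE PM sP sC wGS degd; rewrite ow add0n => eN.
have compat : (forall y, y \in TO -> dg y = d) -> compatible d s.
  move=> TOd; apply/andP; split; apply/allP => x xs.
    have := allP pos x xs; case: (pdP x) xs => [y|y [] iy] xs; rewrite ?ptail_orig ?ptail_to_star //.
    rewrite ptail_from_star // => wx; have := GS_star wGS true iy.
    by rewrite /deg; case: eqP => //; lia.
  have := allP sC x xs; case: (pdP x) xs => [y|y b iy] xs nx; last by rewrite val_star.
  rewrite /= TOd ?inE // eqxx implybT /= /pinterior.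
  by rewrite (pext_right PM sP sC xs).
(* With several faces, [d <= enclosing_length s <= #|TO| + #|TR| <= d], so every [d - dg y] over
   [TO] vanishes. *)
have [single|[h1 _]] := disc_single; last first.
  right; have := enclosing_le => h2.
  have s0 : \sum_(y in TO) (d - dg y) = 0 by lia.
  split; last by lia.
  apply: compat => y yT; have := degd (disc_inner (orig_disc yT)).
  by move/eqP: s0; rewrite sum_nat_eq0 => /forallP/(_ y); rewrite yT /= => /eqP; lia.
have TOT := single_orig single; have [y0 y0T] := disc_nonempty.
have iy0 := tris_inner PM y0T.
have TTdg y : y \in TO -> dg y = dg y0.
  by rewrite TOT => yT; rewrite /deg (single y y0) ?tris_disc.
have sumE : \sum_(y in TO) (d - dg y) = #|TT| * (d - dg y0).
  by rewrite -sum_nat_const -TOT; apply: eq_bigr => y /TTdg ->.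
have dg1 : 1 < dg y0 by apply: orig_deg_gt1; rewrite TOT.
have dgd := degd iy0.
have Tf : TT \subset fc y0.
  by apply/subsetP => y yT; apply: face_mem; apply: single; exact: tris_disc.
have TRf y : y \in TR -> fc y = fc y0.
  by move=> yR; apply: single; [exact: rest_disc|exact: tris_disc].
case: (boolP (inr (fc y0) \in map tl s)) => st; last first.
  have TR0 : TR = set0.
    apply/setP => y; rewrite in_set0; apply/negP => yR; have := TRf y yR.
    by move: yR; rewrite inE => /and3P[_ + _] e; rewrite e (negPf st).
  have Tall : TT = fc y0.
    apply/eqP; rewrite eqEsubset Tf; apply/subsetP => y yf.
    apply: contraT => nT; have yQ : y \in Q by rewrite (disc_face (face_eq yf)) tris_disc.
    by have := disc_rest yQ nT; rewrite TR0 inE.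
  have dgE : #|TT| = dg y0 by rewrite Tall.
  (* The count reads [dg y0 * (d - dg y0) + dg y0 = d], that is [(dg y0 - 1) * (d - dg y0) = 0]. *)
  have dd : dg y0 = d by move: eN; rewrite sumE TR0 cards0 TOT dgE; nia.
  right; split; first by apply: compat => y /TTdg ->.
  rewrite enclosing_lengthE TR0 setU0 TOT card_in_imset ?dgE ?dd // => u v uT vT.
  move=> /edge_eq[//|e]; move: uT; rewrite -TOT (tris_origE PM sP sC) inE e => /andP[_].
  by rewrite (alphaK PM) vT.
left; have dglt : dg y0 < d.
  case/mapP: st => x xs; have := allP pos x xs; case: (pdP x) xs => [y|y [] iy] xs wx; rewrite ?ptail_orig ?ptail_to_star //.
  rewrite ptail_from_star // => -[e]; have := GS_star wGS true iy; rewrite /deg e -/(dg y0).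
  by lia.
have TRE : TR = fc y0 :\: TT.
  apply/setP => y; rewrite in_setD; apply/idP/andP => [yR|[nT yf]].
    split; last by apply: face_mem; exact: TRf.
    by move: yR; rewrite !inE negbK => /and3P[].
  by apply: disc_rest; rewrite // (disc_face (face_eq yf)) tris_disc.
have cTR : #|TT| + #|TR| = dg y0.
  by rewrite TRE -[dg y0]/#|fc y0| -(cardsID TT (fc y0)) (setIidPr Tf).
(* As [#|TT| + #|TR| = dg y0], the count reads [(#|TT| - 1) * (d - dg y0) = 0], with [dg y0 < d]. *)
have /eqP/cards1P[y1 T1] : #|TT| = 1 by move: eN; rewrite sumE TOT; nia.
exact: contour_of_triangle T1.
Qed.

(** This holds for every orientation [w], whether or not [s] is positive in it, which allows
    comparing cycles that are positive in different orientations. *)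
Lemma type_out_zero :
  inner_face_contour s \/ (compatible d s /\ enclosing_length s = d) -> out_weight s w = 0.
Proof.
case=> [/existsP[x /andP[xo /eqP ex]]|[/andP[c1 c2] en]].
  rewrite /out_weight big_pred0 // => z; apply/negP => /and3P[nz naz _].
  have Kx (u : G) : connect (nocross pal (@pphi D alpha sigma r) s) x u -> u \in pface x.
    move=> /connectP[p pP ->]; have : x \in pface x by rewrite inE connect0.
    elim: p {1 2 4}x pP => //= v p IH a /andP[av vp] af; apply: (IH v) => //.
    case/orP: av => [/eqP->|/and3P[/eqP-> n1 n2]].
      by rewrite inE in af; rewrite inE; apply: connect_trans af (fconnect1 _ _).
    have : a \in dedges pal (pface x) by rewrite inE af.
    by rewrite -ex !inE (negPf n1) (negPf n2).
  have nx : ~~ pext s x.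
    apply: contra xo => rx; have : og r \in pface x by apply: Kx; rewrite (nocross_sym M).
    by rewrite inE (fconnect_sym (@pphi_inj D alpha sigma r)).
  have zf : z \in pface x by apply: Kx; apply: (int_connected M sP (r := og r)) => //; apply/ccwP.
  have : z \in dedges pal (pface x) by rewrite inE zf.
  by rewrite -ex !inE !(pcycle_mem PM _ sP sC) (palphaK PM) (negPf nz) (negPf naz).
have := out_weightE PM sP sC wGS degd.
have TOd y : y \in TO -> dg y = d.
  rewrite inE => ys; have := allP c2 _ ys; rewrite /= => /andP[/implyP h _].
  by apply/eqP/h; apply: (allP sC).
rewrite big1 ?add0n => [|y /TOd ->]; last by rewrite subnn.
have [single|[_ /(_ en)]] := disc_single; last by lia.
have TOT := single_orig single; have [y0 y0T] := disc_nonempty.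
have d0 : dg y0 = d by apply: TOd; rewrite TOT.
have TR0 : TR = set0.
  apply/setP => y; rewrite in_set0; apply/negP => yR.
  have e : fc y = fc y0 by apply: single; [exact: rest_disc|exact: tris_disc].
  move: yR; rewrite inE e => /and3P[_ /mapP[x xs ex] _].
  by have := allP c1 x xs; rewrite -ex -/(dg y0) d0 eqxx.
have Tf : TT \subset fc y0.
  by apply/subsetP => y yT; apply: face_mem; apply: single; exact: tris_disc.
have := subset_leq_card Tf; rewrite -/(dg y0) d0 TR0 cards0 TOT; lia.
Qed.
End Weights.

End Enclosing.

(** * The lattice of angular orientations *)

Lemma lattice_ext (T : Type) (P : T -> Prop) (le le' : T -> T -> Prop) :
  (forall a b, P a -> P b -> le a b <-> le' a b) ->
  distributive_lattice P le -> distributive_lattice P le'.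
Proof.
move=> e [h1 h2 h3 h4 h5].
have lubE a b c : P a -> P b -> is_lub P le a b c <-> is_lub P le' a b c.
  move=> Pa Pb; split=> -[Pc ac bc hz]; split=> //.
  - exact/(e a c Pa Pc).
  - exact/(e b c Pb Pc).
  - by move=> z Pz /(e a z Pa Pz) az /(e b z Pb Pz) bz; apply/(e c z Pc Pz); exact: hz.
  - exact/(e a c Pa Pc).
  - exact/(e b c Pb Pc).
  - by move=> z Pz /(e a z Pa Pz) az /(e b z Pb Pz) bz; apply/(e c z Pc Pz); exact: hz.
have glbE a b c : P a -> P b -> is_glb P le a b c <-> is_glb P le' a b c.
  move=> Pa Pb; split=> -[Pc ac bc hz]; split=> //.
  - exact/(e c a Pc Pa).
  - exact/(e c b Pc Pb).
  - by move=> z Pz /(e z a Pz Pa) az /(e z b Pz Pb) bz; apply/(e z c Pz Pc); exact: hz.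
  - exact/(e c a Pc Pa).
  - exact/(e c b Pc Pb).
  - by move=> z Pz /(e z a Pz Pa) az /(e z b Pz Pb) bz; apply/(e z c Pz Pc); exact: hz.
split.
- by move=> a Pa; apply/(e a a Pa Pa); exact: h1.
- by move=> a b Pa Pb /(e a b Pa Pb) ab /(e b a Pb Pa) ba; exact: h2.
- move=> a b c Pa Pb Pc /(e a b Pa Pb) ab /(e b c Pb Pc) bc.
  by apply/(e a c Pa Pc); exact: h3 ab bc.
- move=> a b Pa Pb; have [[c cP] [c' c'P]] := h4 a b Pa Pb.
  by split; [exists c; exact/lubE|exists c'; exact/glbE].
- move=> a b c j m1 m2 m3 u Pa Pb Pc l1 g1 g2 g3 l2.
  have [[Pj _ _ _] [Pm2 _ _ _] [Pm3 _ _ _]] := And3 l1 g2 g3.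
  apply: (h5 a b c j m1 m2 m3 u) => //; [exact/(lubE b c j)|exact/(glbE a j m1)|
    exact/(glbE a b m2)|exact/(glbE a c m3)|exact/(lubE m2 m3 u)].
Qed.

Lemma covers_ext (T : Type) (P : T -> Prop) (le le' : T -> T -> Prop) a b :
  (forall a b, P a -> P b -> le a b <-> le' a b) ->
  covers P le a b <-> covers P le' a b.
Proof.
move=> e; split=> -[Pa Pb ab ne hz]; split=> //; try exact/(e a b Pa Pb).
  by move=> z Pz /(e a z Pa Pz) az /(e z b Pz Pb) zb; exact: hz.
by move=> z Pz /(e a z Pa Pz) az /(e z b Pz Pb) zb; exact: hz.
Qed.

(** The [i] tell whether a dart lies on the two arcs of a cut cycle and on the chord, the [j] do so
    for its reverse, and [n] is its weight. With these exclusions as one boolean, the push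
    identities become finite case analyses. *)
Definition split_excl (i1 i2 ip j1 j2 jp : bool) (n : nat) : bool :=
  [&& (i1 ==> ~~ i2) && (j1 ==> ~~ j2), (i1 || i2) ==> ~~ (j1 || j2),
      ip ==> [&& ~~ (i1 || i2), ~~ (j1 || j2) & ~~ jp], jp ==> ~~ (i1 || i2) && ~~ (j1 || j2) &
      (i1 || i2) || ip ==> (0 < n)].

Lemma split_excl_pos i1 i2 ip j1 j2 jp n : split_excl i1 i2 ip j1 j2 jp n ->
  i1 || jp -> 0 < (if ip || i2 then n.-1 else if jp || j2 then n.+1 else n).
Proof. by case: i1 i2 ip j1 j2 jp => [] [] [] [] [] []. Qed.

Lemma split_excl_push i1 i2 ip j1 j2 jp n : split_excl i1 i2 ip j1 j2 jp n ->
  (if i1 || i2 then n.-1 else if j1 || j2 then n.+1 else n) =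
  (let m := if ip || i2 then n.-1 else if jp || j2 then n.+1 else n in
   if i1 || jp then m.-1 else if j1 || ip then m.+1 else m).
Proof. by case: i1 i2 ip j1 j2 jp => [] [] [] [] [] [] //=; case: n. Qed.

Section Main.
Variables (D : finType) (alpha sigma : {perm D}) (r : D) (d : nat).
Hypothesis d3 : 3 <= d.
Hypothesis DA : d_adapted alpha sigma r d.

Local Notation inn := (inner alpha sigma r).
Local Notation og := (orig alpha sigma r).
Local Notation G := (PD alpha sigma r).
Local Notation pext := (@pexterior D alpha sigma r).
Local Notation tl := (@ptail D alpha sigma r).
Local Notation pal := (@palpha D alpha sigma r).
Local Notation pov := (pouter_vertex alpha sigma r).
Local Notation X := (@GS D alpha sigma r d).
Implicit Types (s : seq G) (x : G) (w A B : {ffun G -> nat}).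

Let DM : d_map alpha sigma r d. Proof. by case: DA. Qed.
Let PM : plane_map alpha sigma. Proof. by case: DM. Qed.
Let M := angular_map_plane r PM.
Let degd := deg_le_d DM.
Let palK := palphaK (r := r) PM.

Definition flop_type s := inner_face_contour s \/ (compatible d s /\ enclosing_length s = d).

(** A cycle becomes a set of darts, which forgets its starting point. The witness [A] keeps only the
    cycles that can be pushed somewhere, as [flops_disj] and [flops_flex] require. *)
Definition flop_spec (c : {set G}) := exists s A,
  [/\ c = [set x in s], pcycle s /\ ccw s, avoids_outer s, flop_type s & X A /\ positive A s].

Definition flops : {set {set G}} := [set c | `[< flop_spec c >]].

Lemma flopsP c : c \in flops <-> flop_spec c.
Proof. by rewrite inE; split=> /asboolP. Qed.

Lemma cycle_balance s v : pcycle s ->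
  \sum_(x | tl x == v) (x \in s) = \sum_(x | tl x == v) (pal x \in s).
Proof.
move=> sP; have us := cycle_uniq sP.
have cnt (f : G -> {set D} + {set D}) : \sum_(x | f x == v) (x \in s) = count_mem v (map f s).
  rewrite count_map -size_filter -(card_uniqP (filter_uniq _ us)) -sum1_card.
  rewrite big_mkcond [RHS]big_mkcond; apply: eq_bigr => x _; rewrite mem_filter /=.
  by case: (f x == v); case: (x \in s).
rewrite cnt -(seq.permP (heads_perm sP)) -cnt (reindex_inj (inv_inj palK)) /=.
by apply: eq_bigl => x; rewrite palK.
Qed.

Lemma cycle_heads_avoid s x : pcycle s -> avoids_outer s -> pov (tl x) ->
  (x \notin s) /\ (pal x \notin s).
Proof.
move=> sP sO xo; split; apply: contraL xo => xs; first exact: (allP sO).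
apply: (avoids_tail sO); rewrite -(perm_mem (heads_perm sP)).
by apply/mapP; exists (pal x); rewrite ?palK.
Qed.

Lemma push_GS w s : X w -> pcycle s -> avoids_outer s -> positive w s -> X (push w s).
Proof.
move=> wX sP sO pos.
have pE x : push w s x + (x \in s) = w x + (pal x \in s).
  rewrite ffunE; case: (boolP (x \in s)) => xs.
    by rewrite (negPf (cycle_al sP xs)); have := allP pos x xs; lia.
  by case: (pal x \in s); lia.
apply: (GS_transfer DM wX).
- by move=> x; have := pE x; have := pE (pal x); rewrite palK; lia.
- by move=> x /(cycle_heads_avoid sP sO)[n1 n2]; have := pE x; rewrite (negPf n1) (negPf n2); lia.
- move=> v; have e : \sum_(x | tl x == v) (push w s x + (x \in s)) =
      \sum_(x | tl x == v) (w x + (pal x \in s)) by apply: eq_bigr => x _; exact: pE.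
  move: e; rewrite !big_split /= -(cycle_balance v sP) /outw => /addIn e.
  exact: esym e.
Qed.

Lemma push_setE w s : push w s = push_set pal w [set x in s].
Proof. by apply/ffunP => x; rewrite !ffunE !inE. Qed.

Lemma flop_push w s : X w -> pcycle s -> ccw s -> avoids_outer s -> positive w s ->
  flop_type s -> flop pal flops w (push w s).
Proof.
move=> wX sP sC sO pos ty; exists [set x in s]; split; last exact: push_setE.
  by apply/flopsP; exists s, w.
by move=> x; rewrite inE => /(allP pos).
Qed.

(* A cycle that is not of one of the two types has a positive chord in its interior, and
   pushing it amounts to pushing successively the two halves. *)
Lemma push_flop_le w s : X w -> pcycle s -> ccw s -> avoids_outer s -> positive w s ->
  flop_le pal flops w (push w s).
Proof.
have [n] := ubnP #|[set x | ~~ pext s x]|.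
elim: n w s => // n IH w s sn wX sP sC sO pos.
case: (eqVneq (out_weight s w) 0) => [ow|].
  by apply: rt_step; apply: flop_push => //; exact: (out_zero_type d3 DA sP sC sO wX pos ow).
rewrite /out_weight sum_nat_eq0 negb_forall => /existsP[a].
rewrite negb_imply -lt0n => /andP[/and3P[na naa ta] wa].
have [u [p [v [us vs uv [wp up chp]]]]] := chord_exists PM wX degd sP sC sO na naa ta wa.
have chP x : x \in p -> [/\ ~~ pext s x, ~~ pext s (pal x), 0 < w x & (tl x == u) || (tl x \notin map tl s)].
  by move=> xp; apply/and4P; apply: (allP chp).
pose Qd x := ~~ pext s x && ~~ pext s (pal x).
have Qs x : x \in s -> ~~ Qd x by move=> xs; rewrite /Qd (pext_right PM sP sC xs) andbF.
have pQ x : x \in p -> [/\ Qd x, Qd (pal x), x \notin s & pal x \notin s].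
  move=> /chP[h1 h2 _ _]; have q1 : Qd x by rewrite /Qd h1.
  have q2 : Qd (pal x) by rewrite /Qd palK h2.
  by split=> //; apply/negP => /Qs; rewrite ?q1 ?q2.
have ptl x : x \in p -> (tl x == u) || (tl x \notin map tl s) by move=> /chP[].
have [c1 [c2 [pc [c1n c2n] s1P s2P]]] :=
  split_cycle palK (al_neq M) sP us vs uv wp up ptl pQ Qs.
have cs x : (x \in s) = (x \in c1) || (x \in c2) by rewrite -(perm_mem pc) mem_cat.
(* [s1] comes first because the chord is positive in [w]; pushing it makes the reversed chord
   positive, as [s2] requires. *)
set s1 := p ++ c2 in s1P; set s2 := c1 ++ rev (map pal p) in s2P.
have m1 x : (x \in s1) = (x \in p) || (x \in c2) by rewrite mem_cat.
have m2 x : (x \in s2) = (x \in c1) || (pal x \in p).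
  rewrite mem_cat mem_rev; congr (_ || _).
  by rewrite -{1}(palK x) mem_map //; exact: inv_inj palK.
have Qint c : (forall x, x \in c -> (x \in s) || Qd x) -> pcycle c ->
    (exists2 x, x \in c & x \in s) -> (exists2 x, x \in c & Qd x) ->
    [/\ ccw c, avoids_outer c & #|[set x | ~~ pext c x]| < n].
  move=> csub cP [x0 x0c x0s] [x1 x1c x1Q].
  have sC' := (ccwP s).1 sC.
  have cC : ccw c.
    by apply/ccwP => x; apply: (subcycle_ccw M sP sC' cP csub x0c x0s).
  split=> //.
    apply/allP => x xc; apply: (avoids_interior PM sP sO).
    by have := csub x xc => /orP[/sC'|/andP[]].
  apply: leq_trans (sn : #|_| <= n); apply: proper_card; apply/properP; split.
    apply/subsetP => x; rewrite !inE; apply: contra; exact: (subcycle_ext sC' csub).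
  exists (pal x1); first by case/andP: x1Q => _; rewrite inE.
  by rewrite inE negbK (pext_right PM cP cC).
have [x1 x1p] : exists x, x \in p.
  case: (p) wp => [/= e|x p' _]; first by rewrite (eqP e) eqxx in uv.
  by exists x; rewrite inE eqxx.
have [s1C s1O s1n] : [/\ ccw s1, avoids_outer s1 & #|[set x | ~~ pext s1 x]| < n].
  apply: Qint => //.
  - by move=> x; rewrite m1 cs => /orP[/pQ[-> _ _ _]|->]; rewrite !orbT.
  - by case: (c2) c2n cs m1 => // x c _ cs m1; exists x; rewrite ?m1 ?cs inE eqxx /= ?orbT.
  - by exists x1; [rewrite m1 x1p|have [] := pQ _ x1p].
have [s2C s2O s2n] : [/\ ccw s2, avoids_outer s2 & #|[set x | ~~ pext s2 x]| < n].
  apply: Qint => //.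
  - move=> x; rewrite m2 cs => /orP[->//|/pQ[_ h _ _]]; by rewrite palK in h; rewrite h orbT.
  - by case: (c1) c1n cs m2 => // x c _ cs m2; exists x; rewrite ?m2 ?cs inE eqxx /= ?orbT.
  - by exists (pal x1); [rewrite m2 palK x1p orbT|have [] := pQ _ x1p].
have pos1 : positive w s1.
  apply/allP => x; rewrite m1 => /orP[/chP[]//|xc]; apply: (allP pos); by rewrite cs xc orbT.
have excl x : split_excl (x \in c1) (x \in c2) (x \in p) (pal x \in c1) (pal x \in c2) (pal x \in p) (w x).
  have d12 y : y \in c1 -> y \notin c2.
    move=> yc1; have : uniq (c1 ++ c2) by rewrite (perm_uniq pc) (cycle_uniq sP).
    by rewrite cat_uniq => /and3P[_ /hasPn h _]; apply/negP => /h; rewrite /= yc1.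
  have dp y : y \in p -> [&& y \notin s, pal y \notin s & pal y \notin p].
    move=> yp; have [_ _ -> ->] := pQ y yp; apply/negP => ayp.
    by have := cycle_al s1P (x := y); rewrite !m1 yp ayp => /(_ isT).
  rewrite /split_excl -!cs; apply/and5P; split; first (by apply/andP; split; apply/implyP; exact: d12); apply/implyP.
  - exact: (cycle_al sP).
  - exact: dp.
  - by move=> /dp; rewrite palK => /and3P[-> ->].
  - by move=> /orP[/(allP pos)//|/chP[]].
have pos2 : positive (push w s1) s2.
  apply/allP => x; rewrite m2 ffunE !m1; exact: split_excl_pos.
have -> : push w s = push (push w s1) s2.
  apply/ffunP => x; rewrite !ffunE !m1 !m2 palK !cs; exact: split_excl_push.
apply: rt_trans (IH w s1 s1n wX s1P s1C s1O pos1) _.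
exact: (IH _ _ s2n (push_GS wX s1P s1O pos1) s2P s2C s2O pos2).
Qed.

Lemma flops_al c x : c \in flops -> x \in c -> pal x \notin c.
Proof. by move=> /flopsP[s [A [-> [sP _] _ _ _]]]; rewrite !inE; exact: (cycle_al sP). Qed.

Lemma type_no_inward s A x : X A -> pcycle s -> ccw s -> avoids_outer s -> flop_type s ->
  0 < A x -> tl x \in map tl s -> ~~ pext s x -> ~~ pext s (pal x) -> False.
Proof.
move=> AX sP sC sO ty Ax tx nx nax; have /eqP := type_out_zero d3 DA sP sC sO AX ty.
rewrite /out_weight sum_nat_eq0 => /forallP/(_ x); rewrite nx nax tx /= => /eqP e.
by rewrite e in Ax.
Qed.

Lemma flops_disj c c' x : c \in flops -> c' \in flops -> x \in c -> x \in c' -> c = c'.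
Proof.
move=> /flopsP[s [A [-> [sP sC] sO sty [AX Apos]]]].
move=> /flopsP[s' [A' [-> [s'P s'C] s'O s'ty [A'X A'pos]]]].
rewrite !inE => xs xs'.
have sub (s1 s2 : seq G) B1 B2 : pcycle s1 -> ccw s1 -> avoids_outer s1 -> flop_type s1 ->
    X B1 -> positive B1 s1 -> pcycle s2 -> ccw s2 -> avoids_outer s2 -> flop_type s2 ->
    X B2 -> positive B2 s2 -> x \in s1 -> x \in s2 -> {subset s1 <= s2}.
  move=> s1P s1C s1O s1t B1X p1 s2P s2C s2O s2t B2X p2 x1 x2 y y1; apply: contraT => y2.
  case: (ccw_diverge M s1P s2P ((ccwP _).1 s1C) ((ccwP _).1 s2C) x1 x2 y1 y2) => -[a [a1 ta na naa]].
    by case: (type_no_inward B1X s2P s2C s2O s2t (allP p1 _ a1) ta na naa).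
  by case: (type_no_inward B2X s1P s1C s1O s1t (allP p2 _ a1) ta na naa).
apply/setP => y; rewrite !inE; apply/idP/idP.
  exact: (sub s s' A A').
exact: (sub s' s A' A).
Qed.

(* Outermost cycles of a vanishing combination would have nothing to cancel with. *)
Lemma flops_free (n : {set G} -> int) : (forall x, comb pal flops n x = 0%R) ->
  forall c, c \in flops -> n c = 0%R.
Proof.
move=> n0 c0 c0F; apply/eqP; apply: contraT => nc0.
(* [pexterior] takes a list but depends only on membership, so [enum c] serves even though it need
   not follow the cycle. *)
pose I (c : {set G}) := [set x | ~~ pext (enum c) x].
have IE c s : c = [set x in s] -> forall x, (x \in I c) = ~~ pext s x.
  move=> ec x; rewrite inE; congr (~~ _); apply: eq_connect => a b /=.
  by rewrite !mem_enum ec !inE.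
have cI c x : c \in flops -> (x \in c) = (x \in I c) && (pal x \notin I c).
  move=> /flopsP[s [A [ec [sP sC] _ _ _]]]; rewrite !(IE c s ec) ec inE negbK.
  exact: (pcycle_mem PM).
pose U := \bigcup_(c in flops | n c != 0%R) I c.
have UI c x : c \in flops -> n c != 0%R -> x \in I c -> x \in U.
  by move=> cF nc xc; apply/bigcupP; exists c; rewrite ?cF.
have [x /andP[xU axU]] : exists x, (x \in U) && (pal x \notin U).
  case: (boolP [exists x, (x \in U) && (pal x \notin U)]) => [/existsP //|no]; exfalso.
  have Uph x : (pphi x \in U) = (x \in U).
    have Iph c : (pphi x \in I c) = (x \in I c) by rewrite !inE (pext_ph PM).
    by apply/bigcupP/bigcupP => -[c cF]; rewrite ?Iph => h; exists c; rewrite ?Iph.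
  have Ual1 x : x \in U -> pal x \in U.
    move=> xU; apply: contraR no => h; apply/existsP; exists x; by rewrite xU.
  have Ual x : (pal x \in U) = (x \in U).
    by apply/idP/idP => [/Ual1|/Ual1 //]; rewrite palK.
  have [x xU] : exists x, x \in U.
    have /flopsP[s [A [ec [sP sC] _ _ _]]] := c0F.
    have [x xs] : exists x, x \in s.
      by case/and4P: (sP); case: (s) => // x s' _ _ _ _; exists x; rewrite inE eqxx.
    by exists x; apply: (UI c0) => //; rewrite (IE c0 s ec); exact: (allP sC).
  have := dart_const M (p := fun x => x \in U) Uph Ual x (og r); rewrite xU => /esym.
  by move=> /bigcupP[c _]; rewrite inE [pext _ _]connect0.
have /bigcupP[c /andP[cF nc] xI] := xU.
have xc : x \in c.
  by rewrite (cI c x cF) xI /=; apply: contra axU; exact: UI.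
have := n0 x; rewrite /comb (on_cyclesE flops_disj n cF xc).
rewrite [on_cycles _ _ (pal x)](_ : _ = 0%R) ?subr0; first by move=> e; rewrite e eqxx in nc.
rewrite /on_cycles big1 // => c' /andP[c'F axc']; apply/eqP; apply: contraNT axU => nc'.
by apply: (UI c' _ c'F nc'); move: axc'; rewrite (cI c' _ c'F) => /andP[].
Qed.

Lemma flops_outer c x : c \in flops -> pov (tl x) -> (x \notin c) /\ (pal x \notin c).
Proof.
by move=> /flopsP[s [A [-> [sP _] sO _ _]]] xo; rewrite !inE; exact: cycle_heads_avoid.
Qed.

Lemma comb_out n v : (\sum_(x | tl x == v) comb pal flops n x = 0)%R.
Proof.
have onE x : on_cycles flops n x = (\sum_(c in flops) n c * (x \in c)%:Z)%R.
  rewrite /on_cycles big_mkcondr; apply: eq_bigr => c _.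
  by case: (x \in c); rewrite ?mulr1 ?mulr0.
rewrite /comb sumrB; under eq_bigr do rewrite onE.
under [X in (_ - X)%R]eq_bigr do rewrite onE.
rewrite exchange_big [X in (_ - X)%R]exchange_big -sumrB /= big1 // => c cF.
rewrite -!mulr_sumr -mulrBr; apply/eqP; rewrite mulf_eq0 subr_eq0; apply/orP; right; apply/eqP.
have /flopsP[s [A [-> [sP _] _ _ _]]] := cF.
rewrite -!(big_morph Posz PoszD (erefl _)); congr Posz.
transitivity (\sum_(x | tl x == v) (x \in s)).
  by apply: eq_bigr => x _; rewrite inE.
by rewrite (cycle_balance v sP); apply: eq_bigr => x _; rewrite inE.
Qed.

Lemma GS_comb A w n : X A -> (forall x, ((w x)%:Z = (A x)%:Z - comb pal flops n x)%R) -> X w.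
Proof.
move=> AX wE; have cal x : (comb pal flops n (pal x) = - comb pal flops n x)%R.
  by rewrite /comb palK opprB.
apply: (GS_transfer DM AX).
- by move=> x; have := wE x; have := wE (pal x); rewrite cal; lia.
- move=> x xo; have c0 : (comb pal flops n x = 0)%R.
    by rewrite /comb !on_cycles0 ?subrr // => c cF; have [] := flops_outer cF xo.
  by have := wE x; rewrite c0; lia.
- move=> v; apply/eqP; rewrite -eqz_nat /outw !(big_morph Posz PoszD (erefl _)); apply/eqP.
  rewrite [RHS](eq_bigr (fun x => ((A x)%:Z - comb pal flops n x)%R)) => [|x _]; last exact: wE.
  by rewrite sumrB comb_out subr0.
Qed.

Lemma flop_le_conn A B : X A -> flop_le pal flops A B ->
  X B /\ exists n, forall x, ((A x)%:Z = (B x)%:Z + comb pal flops n x)%R.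
Proof.
move=> AX AB; have [BX [n nE _]] := flop_le_coord flops_al flops_disj GS_comb AX AB.
by split=> //; exists n => x; rewrite nE; ring.
Qed.

(** Equal outgoing weights continue any arc heavier in [A] than in [B] by another such arc, and
    equal edge weights make the reverses lighter. Pushing in [A] a simple cycle of such arcs brings
    it closer to [B]; the cycle avoids outer vertices, where the orientations agree. *)
Lemma GS_conn A B : X A -> X B ->
  exists n, forall x, ((A x)%:Z = (B x)%:Z + comb pal flops n x)%R.
Proof.
move=> + BX; have [k] := ubnP (\sum_x ((A x - B x) + (B x - A x))).
elim: k A => // k IH A kA AX.
case: (boolP [exists x, B x < A x]) => [/existsP[x0 x0S]|no]; last first.
  have le x : A x <= B x by rewrite leqNgt; apply: contra no => h; apply/existsP; exists x.
  exists (fun=> 0%R) => x; rewrite /comb /on_cycles !big1 // subrr addr0.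
  by have := le x; have := le (pal x); have := GS_edge d3 DM x AX BX => /= h1 h2 h3; congr Posz; lia.
pose S := [set x | B x < A x].
have Sal x : x \in S -> pal x \notin S.
  by rewrite !inE; have := GS_edge d3 DM x AX BX => /=; lia.
have Snext x : x \in S -> exists2 y, y \in S & tl y = tl (pal x).
  move=> xS; case: (boolP [exists y in S, tl y == tl (pal x)]).
    by move=> /existsP[y /andP[yS /eqP e]]; exists y.
  move=> no; have := GS_outw d3 DM (tl (pal x)) AX BX; rewrite /outw.
  rewrite (bigD1 (pal x)) //= [RHS](bigD1 (pal x)) //=.
  have ax : A (pal x) < B (pal x).
    by move: xS; rewrite inE; have := GS_edge d3 DM x AX BX => /=; lia.
  have : \sum_(i | (tl i == tl (pal x)) && (i != pal x)) A i <=
      \sum_(i | (tl i == tl (pal x)) && (i != pal x)) B i.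
    apply: leq_sum => y /andP[ey _]; rewrite leqNgt; apply: contra no => h.
    by apply/existsP; exists y; rewrite inE h.
  by move=> h e; move: (leq_add ax h); rewrite addSn e ltnn.
have x0S' : x0 \in S by rewrite inE.
have [s sP sS] := find_simple_cycle (inv_inj palK) x0S' Sal Snext.
have sO : avoids_outer s.
  apply/allP => x /sS; rewrite inE => h; apply/negP => xo.
  by move: h; rewrite (GS_outer d3 DM AX BX xo) ltnn.
have pos : positive A s by apply/allP => x /sS; rewrite inE; lia.
have A1X := push_GS AX sP sO pos.
have [m mE] : exists n, forall x, ((A x)%:Z = (push A s x)%:Z + comb pal flops n x)%R.
  have [/ccwP sC|/ccwP sC] := ccw_or_rev M (og r) sP.
    by have [] := flop_le_conn AX (push_flop_le AX sP sC sO pos).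
  (* The push of a clockwise cycle is undone by pushing its reverse, counterclockwise and now
     positive, so the decomposition runs from [push A s] back to [A]. *)
  set s' := rev (map pal s) in sC.
  have s'P : pcycle s' by exact: (rev_simple_cycle M sP).
  have ms x : (x \in s') = (pal x \in s) by exact: (mem_rev_cycle M).
  have s'O : avoids_outer s'.
    by apply/allP => x; rewrite ms => xs; apply/negP => /(cycle_heads_avoid sP sO)[_ /negP].
  have pos' : positive (push A s) s'.
    apply/allP => x; rewrite ms ffunE => xs; rewrite xs.
    by have := cycle_al sP xs; rewrite palK => /negbTE ->.
  have back : push (push A s) s' = A.
    apply/ffunP => x; rewrite !ffunE !ms palK; case: (boolP (x \in s)) => xs.
      by rewrite (negPf (cycle_al sP xs)) prednK //; exact: (allP pos x xs).
    by case: (pal x \in s); rewrite ?xs.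
  have [_ [n nE]] := flop_le_conn A1X (push_flop_le A1X s'P sC s'O pos').
  exists (fun c => - n c)%R => x; rewrite combN; have := nE x; rewrite back; lia.
have less x : (push A s x - B x) + (B x - push A s x) + (x \in s) <= (A x - B x) + (B x - A x).
  rewrite ffunE; case: (boolP (x \in s)) => xs; first by have := sS x xs; rewrite inE; lia.
  case: (boolP (pal x \in s)) => axs; last by lia.
  by have := sS _ axs; rewrite inE; have := GS_edge d3 DM x AX BX => /=; lia.
have [x1 x1s] : exists x, x \in s.
  by case/and4P: (sP); case: (s) => // x s' _ _ _ _; exists x; rewrite inE eqxx.
have [|m' m'E] := IH (push A s) _ A1X.
  rewrite ltnS in kA; apply: leq_trans kA; rewrite (bigD1 x1) //= [ltnRHS](bigD1 x1) //= -addSn.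
  apply: leq_add; first by have := less x1; rewrite x1s addn1.
  by apply: leq_sum => x _; apply: leq_trans (less x); exact: leq_addr.
exists (fun c => m c + m' c)%R => x; rewrite combD mE m'E; ring.
Qed.

Lemma flops_flex c : c \in flops -> exists2 A : {ffun G -> nat}, X A & forall x, x \in c -> 0 < A x.
Proof.
move=> /flopsP[s [A [-> _ _ _ [AX pos]]]]; exists A => // x.
by rewrite inE; exact: (allP pos).
Qed.

Lemma flopP A A' : X A -> flop pal flops A A' <-> exists s,
  [/\ pcycle s /\ ccw s, positive A s, avoids_outer s, A' = push A s & flop_type s].
Proof.
move=> AX; split=> [[c [/flopsP[s [B [ec [sP sC] sO ty _]]] pos e]]|[s [[sP sC] pos sO -> ty]]].
  exists s; split=> //; last by rewrite e ec push_setE.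
  by apply/allP => x xs; apply: pos; rewrite ec inE.
exact: flop_push.
Qed.

Lemma pleP A B : X A -> ple A B <-> flop_le pal flops A B.
Proof.
move=> AX; split=> AB.
  suff [] : X B /\ flop_le pal flops A B by [].
  elim: AB AX => {A B} [A B [s [sP sC pos sO ->]]|A|A B C _ IH1 _ IH2] AX.
  - by split; [exact: push_GS|exact: push_flop_le].
  - by split=> //; exact: rt_refl.
  - by have [BX AB] := IH1 AX; have [CX BC] := IH2 BX; split=> //; exact: rt_trans AB BC.
suff [] : X B /\ ple A B by [].
elim: AB AX => {A B} [A B AB|A|A B C _ IH1 _ IH2] AX.
- have [s [[sP sC] pos sO -> _]] := (flopP B AX).1 AB.
  by split; [exact: push_GS|apply: rt_step; exists s].
- by split=> //; exact: rt_refl.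
- by have [BX AB] := IH1 AX; have [CX BC] := IH2 BX; split=> //; exact: rt_trans AB BC.
Qed.

End Main.

Theorem mainTheorem4 (D : finType) (alpha sigma : {perm D}) (r : D) (d : nat) :
  3 <= d -> @d_adapted D alpha sigma r d ->
  distributive_lattice (@GS D alpha sigma r d) (@ple D alpha sigma r) /\
  (forall A A' : {ffun @PD D alpha sigma r -> nat},
     @GS D alpha sigma r d A -> @GS D alpha sigma r d A' ->
     (covers (@GS D alpha sigma r d) (@ple D alpha sigma r) A A' <->
      exists s : seq (@PD D alpha sigma r),
        [/\ @pcycle D alpha sigma r s /\ @ccw D alpha sigma r s,
            @positive D alpha sigma r A s, @avoids_outer D alpha sigma r s,
            A' = @push D alpha sigma r A s &
            @inner_face_contour D alpha sigma r s \/
            (@compatible D alpha sigma r d s /\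
             @enclosing_length D alpha sigma r s = d)])).
Proof.
move=> d3 DA.
have hal := @flops_al D alpha sigma r d; have hdisj := flops_disj d3 DA.
have hfree := flops_free d3 DA; have hconn := GS_conn d3 DA.
have hcomb := GS_comb d3 DA; have hflex := @flops_flex D alpha sigma r d.
have le_ext A B : GS d A -> GS d B -> flop_le (@palpha D alpha sigma r) (flops alpha sigma r d) A B <-> ple A B.
  by move=> AX _; apply: iff_sym; exact: pleP.
split; first exact: lattice_ext le_ext (flop_lattice hal hdisj hfree hconn hcomb hflex).
move=> A A' AX A'X; apply: iff_trans (iff_sym (covers_ext A A' le_ext)) _.
apply: iff_trans (flop_covers hal hdisj hfree hconn hcomb hflex AX A'X) _.
exact: flopP.
Qed.
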